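(* Fix $B_0\in\mathbb{R}^m_{>0}$ and consider the budget $B=tB_0$ with $t\to\infty$. Suppose $X$ has finite second moments, $\Sigma=\operatorname{Cov}(X)$ is positive definite, and the continuous problem \[ \min_{\underline\nu}\ a^\top\Big(\sum_{I}\nu_IP_I^\top\Sigma_I^{-1}P_I\Big)^\dagger a\quad\text{s.t.}\quad \underline\nu\in\mathbb{R}_{\ge0}^{\mathcal I},\ \sum_I\nu_Ic_I\le B_0,\ \operatorname{supp}(a)\subseteq\textstyle\bigcup\{I:\nu_I>0\} \] has a unique minimizer $\underline\nu^\star$; let $\mathcal V^*$ be its minimum value. Let $\widehat\Sigma=\widehat\Sigma_t$ be random symmetric matrices (allowed to depend arbitrarily on the sample array below) with $\widehat\Sigma\to\Sigma$ in probability in operator norm as $t\to\infty$. Let $(\hat{\underline n},\hat{\underline\lambda})$ be a minimizer of $\sum_{I:n_I>0}\frac1{n_I}\lambda_I^\top\widehat\Sigma_I\lambda_I$ over integer allocations with $\sum_In_Ic_I\le tB_0$ and weights with $\sum_{I:n_I>0}P_I^\top\lambda_I=a$, and let $\hat\theta=\sum_{I:\hat n_I>0}\frac1{\hat n_I}\sum_{j=1}^{\hat n_I}\hat\lambda_I^\top X_I^{(I,j)}$, where $(X^{(I,j)})_{I\in\mathcal I,j\ge1}$ is an array of i.i.d. copies of $X$. Then \[ \sqrt t\,\big(\hat\theta-a^\top\mathbb{E}X\big)\xrightarrow{d}\mathcal N(0,\mathcal V^* ), \] and $\mathcal V^*=\lim_{t\to\infty}t\,\mathcal V_{tB_0}$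.
   Context: $X\in\mathbb{R}^k$, $a\in\mathbb{R}^k\setminus\{0\}$; $\mathcal I$ a collection of nonempty subsets of $\{1,\dots,k\}$; $P_I:\mathbb{R}^k\to\mathbb{R}^{|I|}$ the coordinate projection onto $I$; $X_I=P_IX$; for a matrix $A$, $A_I=P_IAP_I^\top$. Costs $c_I\in\mathbb{R}^m_{\ge0}$ with vector inequalities componentwise. $\dagger$ is the Moore–Penrose pseudo-inverse. For a budget $B$, $\mathcal V_B=\min\{a^\top(\sum_In_IP_I^\top\Sigma_I^{-1}P_I)^\dagger a:\ \underline n\in\mathbb{Z}^{\mathcal I}_{\ge0},\ \sum_In_Ic_I\le B,\ \operatorname{supp}(a)\subseteq\bigcup\{I:n_I>0\}\}$. *)

(* Defs.v *)
From HB Require Import structures.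
From mathcomp Require Import all_boot all_order all_algebra.
From mathcomp Require Import all_classical all_reals all_analysis.
From mathcomp Require Import finmap.

Set Implicit Arguments.
Unset Strict Implicit.
Unset Printing Implicit Defensive.

Import Order.TTheory GRing.Theory Num.Theory.
Import numFieldNormedType.Exports.

Local Open Scope classical_set_scope.
Local Open Scope ring_scope.

Section LinearAlgebra.
Variable R : realType.

(* coordinate projection P_I : R^k -> R^{|I|}; coordinates of I taken in
   increasing order *)
Definition projI (k : nat) (I : {set 'I_k}) : 'M[R]_(#|I|, k) :=
  \matrix_(i < #|I|, j < k) ((j == @enum_val _ (pred_of_set I) i)%:R).

Definition subM (k : nat) (A : 'M[R]_k) (I : {set 'I_k}) : 'M[R]_#|I| :=
  projI I *m A *m (projI I)^T.

Definition is_MP_inverse (n : nat) (A G : 'M[R]_n) : Prop :=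
  [/\ A *m G *m A = A, G *m A *m G = G,
      (A *m G)^T = A *m G & (G *m A)^T = G *m A].

(* the Moore--Penrose pseudo-inverse (it exists and is unique) *)
Definition pinv (n : nat) (A : 'M[R]_n) : 'M[R]_n :=
  xget 0 [set G | is_MP_inverse A G].

Definition quadf (n : nat) (M : 'M[R]_n) (v : 'cV[R]_n) : R :=
  ((v^T *m M *m v) 0 0).

Definition posdef (n : nat) (A : 'M[R]_n) : Prop :=
  A^T = A /\ forall v : 'cV[R]_n, v != 0 -> 0 < quadf A v.

Definition vnorm2 (n : nat) (v : 'cV[R]_n) : R := Num.sqrt (\sum_i v i 0 ^+ 2).

Definition opnorm (n : nat) (A : 'M[R]_n) : R :=
  sup [set vnorm2 (A *m v) | v in [set v : 'cV[R]_n | vnorm2 v <= 1]].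

Definition info_mx (k : nat) (Sigma : 'M[R]_k) (calI : {set {set 'I_k}})
    (nu : {set 'I_k} -> R) : 'M[R]_k :=
  \sum_(I in calI) nu I *: ((projI I)^T *m invmx (subM Sigma I) *m projI I).

Definition var_obj (k : nat) (Sigma : 'M[R]_k) (calI : {set {set 'I_k}})
    (a : 'cV[R]_k) (nu : {set 'I_k} -> R) : R :=
  quadf (pinv (info_mx Sigma calI nu)) a.

Definition cont_feasible (k m : nat) (calI : {set {set 'I_k}})
    (c : {set 'I_k} -> 'I_m -> R) (B : 'I_m -> R) (a : 'cV[R]_k)
    (nu : {set 'I_k} -> R) : Prop :=
  [/\ (forall I, I \notin calI -> nu I = 0),
      (forall I, 0 <= nu I),
      (forall r, \sum_(I in calI) nu I * c I r <= B r) &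
      (forall i, a i 0 != 0 -> exists2 I, I \in calI & 0 < nu I /\ i \in I)].

Definition disc_feasible (k m : nat) (calI : {set {set 'I_k}})
    (c : {set 'I_k} -> 'I_m -> R) (B : 'I_m -> R) (a : 'cV[R]_k)
    (n : {set 'I_k} -> nat) : Prop :=
  [/\ (forall I, I \notin calI -> n I = 0%N),
      (forall r, \sum_(I in calI) (n I)%:R * c I r <= B r) &
      (forall i, a i 0 != 0 -> exists2 I, I \in calI & (0 < n I)%N /\ i \in I)].

Definition V_disc (k m : nat) (Sigma : 'M[R]_k) (calI : {set {set 'I_k}})
    (c : {set 'I_k} -> 'I_m -> R) (B : 'I_m -> R) (a : 'cV[R]_k) : R :=
  inf [set var_obj Sigma calI a (fun I => (n I)%:R) |
        n in [set n | disc_feasible calI c B a n]].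

Definition est_obj (k : nat) (Sh : 'M[R]_k) (calI : {set {set 'I_k}})
    (n : {set 'I_k} -> nat) (lam : forall I : {set 'I_k}, 'cV[R]_#|I|) : R :=
  \sum_(I in calI | (0 < n I)%N) ((n I)%:R^-1 * quadf (subM Sh I) (lam I)).

Definition est_feasible (k m : nat) (calI : {set {set 'I_k}})
    (c : {set 'I_k} -> 'I_m -> R) (B : 'I_m -> R) (a : 'cV[R]_k)
    (n : {set 'I_k} -> nat) (lam : forall I : {set 'I_k}, 'cV[R]_#|I|) : Prop :=
  [/\ (forall I, I \notin calI -> n I = 0%N),
      (forall r, \sum_(I in calI) (n I)%:R * c I r <= B r) &
      \sum_(I in calI | (0 < n I)%N) ((projI I)^T *m lam I) = a].

Definition est_minimizer (k m : nat) (Sh : 'M[R]_k) (calI : {set {set 'I_k}})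
    (c : {set 'I_k} -> 'I_m -> R) (B : 'I_m -> R) (a : 'cV[R]_k)
    (n : {set 'I_k} -> nat) (lam : forall I : {set 'I_k}, 'cV[R]_#|I|) : Prop :=
  est_feasible calI c B a n lam /\
  forall n' lam', est_feasible calI c B a n' lam' ->
    est_obj Sh calI n lam <= est_obj Sh calI n' lam'.

(* theta_hat = sum_{I : n_I > 0} 1/n_I sum_{j=1}^{n_I} lam_I^T X_I^{(I,j)}
   (the sample index j = 1..n_I is shifted to 0..n_I-1) *)
Definition theta_hat (k : nat) (calI : {set {set 'I_k}})
    (n : {set 'I_k} -> nat) (lam : forall I : {set 'I_k}, 'cV[R]_#|I|)
    (Xs : {set 'I_k} -> nat -> 'cV[R]_k) : R :=
  \sum_(I in calI | (0 < n I)%N)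
     ((n I)%:R^-1 * \sum_(j < n I) ((lam I)^T *m (projI I *m Xs I j)) 0 0).

End LinearAlgebra.

Section Probability.
Context {d : measure_display} {Omega : measurableType d} {R : realType}.
Variable P : probability Omega R.

Definition rvec (k : nat) (Y : 'I_k -> Omega -> R) (w : Omega) : 'cV[R]_k :=
  \col_i Y i w.

Definition gen_sigma (k : nat) (Y : 'I_k -> Omega -> R) : set (set Omega) :=
  <<s [set E | exists i A, measurable A /\ E = Y i @^-1` A] >>.

Definition mutually_indep (L : choiceType) (k : nat) (S : set L)
    (Y : L -> 'I_k -> Omega -> R) : Prop :=
  forall (F : {fset L}), [set` F] `<=` S ->
  forall E : L -> set Omega, (forall l, l \in F -> gen_sigma (Y l) (E l)) ->
  P (\bigcap_(l in [set` F]) E l) = (\prod_(l <- F) P (E l))%E.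

(* equality in law of two random vectors (on measurable rectangles,
   which determine the joint law) *)
Definition same_law (k : nat) (Y Z : 'I_k -> Omega -> R) : Prop :=
  forall A : 'I_k -> set R, (forall i, measurable (A i)) ->
  P (\bigcap_(i in [set: 'I_k]) (Y i @^-1` A i)) =
  P (\bigcap_(i in [set: 'I_k]) (Z i @^-1` A i)).

Definition mean_vec (k : nat) (Y : 'I_k -> Omega -> R) : 'cV[R]_k :=
  \col_i fine ('E_P[Y i]).

Definition cov_mx (k : nat) (Y : 'I_k -> Omega -> R) : 'M[R]_k :=
  \matrix_(i, j) fine (covariance P (Y i) (Y j)).

Definition cvg_prob_opnorm (k : nat) (Sh : R -> Omega -> 'M[R]_k) (S : 'M[R]_k) :=
  forall eps : R, 0 < eps ->
    (P [set w | eps < opnorm (Sh t w - S)]) @[t --> +oo] --> 0%E.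

Definition cvg_dist_normal (Y : R -> Omega -> R) (V : R) : Prop :=
  forall f : R -> R, continuous f -> (exists M : R, forall x, `|f x| <= M) ->
    ('E_P[f \o Y t])%E @[t --> +oo] -->
      (\int[normal_prob 0 (Num.sqrt V)]_x (f x)%:E)%E.

End Probability.

(* Main.v *)
(** By duality, a^T M(nu)^+ a is the maximum over w of 2 a^T w - w^T M(nu) w,
    attained where M(nu) w = a, and also the minimum of
    sum_I lam_I^T Sigma_I lam_I / nu_I over the weights with
    sum_I P_I^T lam_I = a.  Compactness and uniqueness then show that, for
    Sigma_hat close to Sigma and t large, every minimizer (n, lam) has n_I / t
    close to nustar_I, t lam_I / n_I close to u_I = Sigma_I^-1 P_I w where
    nustar_I > 0, and t lam_I / n_I bounded elsewhere.  Hence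
    sqrt t (theta_hat - a^T mu) differs from the statistic with deterministic
    design t^(-1/2) sum_I sum_(j < t nustar_I) u_I^T P_I (X^(I,j) - mu) by
    fluctuations of partial sums over windows of length o(t), which Ottaviani's
    maximal inequality makes negligible however Sigma_hat depends on the
    sample.  The deterministic statistic is asymptotically normal by
    Lindeberg's replacement argument, first for test functions with a uniform
    second-order expansion; finite differences of iterated primitives
    approximate every bounded continuous function by such test functions. *)
Require Import Defs.
From HB Require Import structures.
From mathcomp Require Import all_boot all_order all_algebra.
From mathcomp Require Import all_classical all_reals all_analysis.
From mathcomp Require Import finmap measurable_realfun ring lra.

Set Implicit Arguments.
Unset Strict Implicit.
Unset Printing Implicit Defensive.

Import Order.TTheory GRing.Theory Num.Theory.
Import numFieldNormedType.Exports.
Local Open Scope classical_set_scope.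
Local Open Scope ring_scope.

(** * Integration against the normal law *)

(** The design is computed from the same data as the estimator, so conditioning on it destroys
    independence. The randomness is therefore confined to bounded coefficients multiplying
    coordinate sums that do not involve the design: exceptional events are fixed for these sums
    beforehand, and outside them the comparison with the deterministic design is an inequality at
    each sample point. The delicate sets are those with [nustar I = 0]. They may still be sampled
    o(t) times, by a nearly degenerate design whose dual solution the limit problem does not
    control. Boundedness of their weights is enough, and it comes from an induction over coordinates
    with a constant that does not see the size of the allocation. The pseudo-inverse is
    discontinuous where the set of covered coordinates changes, so limits of allocations are taken
    in the dual objective, which is affine in the allocation. Exchanging one summand at a time
    requires Gaussian averages to form a semigroup, whence the computations with the normal density
    that come next. *)

Section density.
Context d (T : measurableType d) (R : realType).
Variables (mu nu : {measure set T -> \bar R}) (p : T -> R).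
Hypotheses (mp : measurable_fun setT p) (p0 : forall x, 0 <= p x).
Hypothesis nuE : forall A, measurable A -> nu A = (\int[mu]_(x in A) (p x)%:E)%E.

Import HBNNSimple.

Let integral_density_nnsfun (f : {nnsfun T >-> R}) :
  (\int[nu]_x (f x)%:E = \int[mu]_x ((f x)%:E * (p x)%:E))%E.
Proof.
under [LHS]eq_integral do rewrite fimfunE -fsumEFin//.
rewrite [LHS]ge0_integral_fsum//; last 2 first.
  - by move=> r; exact/measurable_EFinP/measurableT_comp.
  - by move=> n x _; rewrite EFinM nnfun_muleindic_ge0.
under [RHS]eq_integral.
  move=> x xD; rewrite fimfunE -fsumEFin// ge0_mule_fsuml; last first.
    by move=> r; rewrite EFinM nnfun_muleindic_ge0.
  over.
rewrite [RHS]ge0_integral_fsum//; last 2 first.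
  - move=> r; apply: emeasurable_funM; last exact/measurable_EFinP.
    by apply/measurable_EFinP; do 2 apply/measurableT_comp => //.
  - by move=> n x _; rewrite EFinM mule_ge0// ?nnfun_muleindic_ge0// lee_fin.
apply: eq_fsbigr => r _.
have mE : measurable (f @^-1` [set r]) by exact: measurable_sfunP.
rewrite !integralZl_indic_nnsfun//= integral_indic// setIT nuE//.
have [r0|r0] := ltP r 0.
  rewrite preimage_nnfun0// integral_set0 mule0.
  by rewrite integral0_eq// => x _; rewrite indicE in_set0 mulr0 mul0e.
under [RHS]eq_integral do rewrite EFinM -muleA.
rewrite ge0_integralZl//; last 2 first.
  - by apply: emeasurable_funM; exact/measurable_EFinP.
  - by move=> x _; rewrite mule_ge0// lee_fin.
congr (_ * _)%E; rewrite integral_mkcond; apply: eq_integral => x _.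
by rewrite patchE indicE; case: ifPn => _; rewrite ?mul1e ?mul0e.
Qed.

Lemma ge0_integral_density (f : T -> \bar R) :
  measurable_fun setT f -> (forall x, 0 <= f x)%E ->
  (\int[nu]_x f x = \int[mu]_x (f x * (p x)%:E))%E.
Proof.
move=> mf f0.
pose f_ := nnsfun_approx measurableT mf.
transitivity (lim (\int[nu]_x (f_ n x)%:E @[n --> \oo])%E).
  rewrite -monotone_convergence//=.
  - apply: eq_integral => ? _; apply/esym/cvg_lim => //=.
    exact: cvg_nnsfun_approx.
  - by move=> n; exact/measurable_EFinP/measurable_funTS.
  - by move=> n ? _; rewrite lee_fin.
  - by move=> ? _ ? ? mn; rewrite lee_fin; exact/lefP/nd_nnsfun_approx.
transitivity (lim (\int[mu]_x ((f_ n x)%:E * (p x)%:E) @[n --> \oo])%E).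
  by apply: congr_lim; apply/funext => n /=; exact: integral_density_nnsfun.
rewrite -monotone_convergence//=.
- apply: eq_integral => x _; apply/cvg_lim => //=.
  apply: cvgeZr => //; exact: cvg_nnsfun_approx.
- by move=> n; apply: emeasurable_funM; exact/measurable_EFinP.
- by move=> n x _; rewrite mule_ge0// lee_fin.
- move=> x _ a b ab; rewrite lee_wpmul2r ?lee_fin//.
  exact/lefP/nd_nnsfun_approx.
Qed.

End density.

Section normal.
Variable R : realType.
Notation mu := (@lebesgue_measure R).

Lemma ge0_integral_normal_prob (m s : R) (f : _ -> \bar R) :
  measurable_fun setT f -> (forall x, 0 <= f x)%E ->
  (\int[normal_prob m s]_x f x = \int[mu]_x (f x * (normal_pdf m s x)%:E))%E.
Proof.
move=> mf f0; apply: ge0_integral_density => //.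
  exact: measurable_normal_pdf.
exact: normal_pdf_ge0.
Qed.

(** Completing the square in [x]: the joint density of two independent centred Gaussians with sum
    [y] factors into the density of the sum at [y] and the conditional density of the first variable
    given the sum, which makes [x] easy to integrate out. *)
Lemma normal_pdf_convolution (s s' x y : R) : 0 < s -> 0 < s' ->
  normal_pdf 0 s x * normal_pdf 0 s' (y - x) =
  normal_pdf 0 (Num.sqrt (s ^+ 2 + s' ^+ 2)) y *
  normal_pdf (s ^+ 2 * y / (s ^+ 2 + s' ^+ 2))
    (s * s' / Num.sqrt (s ^+ 2 + s' ^+ 2)) x.
Proof.
move=> s0 s'0.
have S0 : 0 < s ^+ 2 + s' ^+ 2 by rewrite addr_gt0// exprn_gt0.
have q0 : 0 < Num.sqrt (s ^+ 2 + s' ^+ 2) by rewrite sqrtr_gt0.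
rewrite !normal_pdfE ?gt_eqF ?divr_gt0 ?mulr_gt0//.
rewrite /normal_peak /normal_fun mulrACA [in RHS]mulrACA -!expRD.
congr (_ * expR _).
  rewrite -!invfM -!sqrtrM ?mulrn_wge0 ?mulr_ge0 ?pi_ge0 ?sqr_ge0 ?ltW//.
  congr ((Num.sqrt _)^-1); rewrite expr_div_n sqr_sqrtr ?ltW//.
  by field; rewrite gt_eqF.
rewrite expr_div_n sqr_sqrtr ?ltW//.
by field; rewrite ?gt_eqF.
Qed.

Lemma ge0_integral_translate (f : R -> R) (c : R) : continuous f ->
  (forall x, 0 <= f x) ->
  (\int[mu]_x (f x)%:E = \int[mu]_x (f (x - c))%:E)%E.
Proof.
move=> cf f0.
have dF (x : R) : is_derive x 1 (fun x => x - c) 1.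
  by have := @is_deriveB _ R^o R^o id (cst c) x 1 1 0 _ _; rewrite subr0; apply.
have dE : (fun x : R => x - c)^`()%classic = cst 1.
  by apply/funext => x; rewrite derive1E; exact: derive_val.
rewrite (@increasing_ge0_integration_by_substitutionT _ (fun x => x - c) f)//.
- by apply: eq_integral => x _; rewrite dE /= mulr1.
- by move=> x y xy; rewrite ltrD2r.
- by rewrite dE => x; exact: cvg_cst.
- by rewrite dE; exact: is_cvg_cst.
- by rewrite dE; exact: is_cvg_cst.
- exact: cvg_addrr_Ny.
- exact: cvg_addrr.
Qed.

Lemma ge0_integral_scale (f : R -> R) (s : R) : 0 < s -> continuous f ->
  (forall x, 0 <= f x) ->
  (\int[mu]_x (f x)%:E = \int[mu]_x (f (s * x) * s)%:E)%E.
Proof.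
move=> s0 cf f0.
have dF (x : R) : is_derive x 1 (fun x => s * x) s.
  have : is_derive x 1 (s \*: (@id R)) (s *: 1) by exact: is_deriveZ.
  by rewrite /GRing.scale/= mulr1.
have dE : (fun x : R => s * x)^`()%classic = cst s.
  by apply/funext => x; rewrite derive1E; exact: derive_val.
rewrite (@increasing_ge0_integration_by_substitutionT _ (fun x => s * x) f)//.
- by apply: eq_integral => x _; rewrite dE.
- by move=> x y xy; rewrite ltr_pM2l.
- by rewrite dE => x; exact: cvg_cst.
- by rewrite dE; exact: is_cvg_cst.
- by rewrite dE; exact: is_cvg_cst.
- by apply: gt0_cvgMrNy => //; exact: cvg_id.
- by apply: gt0_cvgMry => //; exact: cvg_id.
Qed.

Lemma normal_pdf_rescale (s x : R) : 0 < s ->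
  normal_pdf 0 s (s * x) * s = normal_pdf 0 1 x.
Proof.
move=> s0; rewrite !normal_pdfE ?oner_neq0 ?gt_eqF// /normal_peak /normal_fun.
rewrite !subr0 expr1n mul1r -mulrnAr sqrtrM ?sqr_ge0// sqrtr_sqr gtr0_norm//.
rewrite invfM mulrAC (mulrAC s^-1) mulVf ?gt_eqF// mul1r.
by congr (_ * expR _); field; rewrite gt_eqF.
Qed.

Lemma continuous_affine (b s : R) : continuous (fun x : R => b + s * x).
Proof.
move=> x; apply: cvgD; first exact: cvg_cst.
by apply: cvgM; [exact: cvg_cst|exact: cvg_id].
Qed.

Lemma measurable_fun_affine (b s : R) : measurable_fun setT (fun x : R => b + s * x).
Proof. by apply: continuous_measurable_fun; exact: continuous_affine. Qed.

Lemma ge0_integral_normal_scale (s : R) (g : R -> R) : 0 < s -> continuous g ->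
  (forall x, 0 <= g x) ->
  (\int[normal_prob 0 1]_x (g (s * x))%:E = \int[normal_prob 0 s]_x (g x)%:E)%E.
Proof.
move=> s0 cg g0.
have mg : measurable_fun setT g by exact: continuous_measurable_fun.
rewrite !ge0_integral_normal_prob; last 4 first.
- exact/measurable_EFinP.
- by move=> x; rewrite lee_fin.
- apply/measurable_EFinP; apply: (measurableT_comp mg).
  exact: measurable_funM.
- by move=> x; rewrite lee_fin.
under [RHS]eq_integral do rewrite -EFinM.
rewrite (@ge0_integral_scale (fun x => g x * normal_pdf 0 s x) s)//.
- apply: eq_integral => x _; rewrite -EFinM; congr EFin.
  by rewrite -mulrA normal_pdf_rescale.
- move=> x; apply: cvgM; first exact: cg.
  by apply: continuous_normal_pdf; rewrite gt_eqF.
- by move=> x; rewrite mulr_ge0// normal_pdf_ge0.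
Qed.

Lemma ge0_normal_semigroup (s s' x : R) (g : R -> R) : 0 < s -> 0 < s' ->
  continuous g -> (forall x, 0 <= g x) ->
  (\int[normal_prob 0 1]_z \int[normal_prob 0 1]_z' (g (x + s * z + s' * z'))%:E =
   \int[normal_prob 0 1]_z (g (x + Num.sqrt (s ^+ 2 + s' ^+ 2) * z))%:E)%E.
Proof.
move=> s0 s'0 cg g0.
have S0 : 0 < s ^+ 2 + s' ^+ 2 by rewrite addr_gt0// exprn_gt0.
set S := Num.sqrt _; have q0 : 0 < S by rewrite sqrtr_gt0.
have mg : measurable_fun setT g by exact: continuous_measurable_fun.
have cgx b : continuous (fun y => g (b + y)).
  move=> y; apply: (@continuous_comp _ _ _ (fun y => b + y) g); last exact: cg.
  by apply: cvgD; [exact: cvg_cst|exact: cvg_id].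
have cp m : continuous (normal_pdf 0 s' \o (fun y => y - m)).
  move=> y; apply: continuous_comp; last by apply: continuous_normal_pdf; rewrite gt_eqF.
  by apply: cvgB; [exact: cvg_id|exact: cvg_cst].
have inner z : (\int[normal_prob 0 1]_z' (g (x + s * z + s' * z'))%:E =
    \int[mu]_y ((g (x + y))%:E * (normal_pdf 0 s' (y - s * z))%:E))%E.
  rewrite (@ge0_integral_normal_scale s' (fun y => g (x + s * z + y)))//.
  rewrite ge0_integral_normal_prob; last 2 first.
    by apply/measurable_EFinP; apply: continuous_measurable_fun; exact: cgx.
    by move=> y; rewrite lee_fin.
  pose f y := g (x + s * z + y) * normal_pdf 0 s' y.
  transitivity (\int[mu]_y (f y)%:E)%E.
    by apply: eq_integral => y _; rewrite -EFinM.
  transitivity (\int[mu]_y (f (y - s * z))%:E)%E.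
    apply: ge0_integral_translate.
      move=> y; apply: cvgM; first exact: cgx.
      by apply: continuous_normal_pdf; rewrite gt_eqF.
    by move=> y; rewrite mulr_ge0 ?normal_pdf_ge0.
  have E y : x + s * z + (y - s * z) = x + y by ring.
  by apply: eq_integral => y _; rewrite -EFinM /f E.
under eq_integral do rewrite inner.
pose F (zy : R * R) := (g (x + zy.2) * normal_pdf 0 s' (zy.2 - s * zy.1) *
  normal_pdf 0 1 zy.1)%:E.
have mF : measurable_fun [set: measurableTypeR R * measurableTypeR R] F.
  apply/measurable_EFinP; apply: measurable_funM; last first.
    by apply: (measurableT_comp (measurable_normal_pdf 0 1)); exact: measurable_fst.
  apply: measurable_funM.
    by apply: (measurableT_comp mg); apply: measurable_funD => //; exact: measurable_snd.
  apply: (measurableT_comp (measurable_normal_pdf 0 s')); apply: measurable_funB.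
    exact: measurable_snd.
  by apply: measurable_funM => //; exact: measurable_fst.
have F0 zy : (0 <= F zy)%E by rewrite lee_fin !mulr_ge0 ?normal_pdf_ge0.
transitivity (\int[mu]_z \int[mu]_y F (z, y))%E.
  rewrite ge0_integral_normal_prob; last 2 first.
  - have := @measurable_fun_fubini_tonelli_F _ _ _ _ _ mu
      (fun zy => ((g (x + zy.2))%:E * (normal_pdf 0 s' (zy.2 - s * zy.1))%:E)%E).
    apply.
    + apply/measurable_EFinP; apply: measurable_funM.
        by apply: (measurableT_comp mg); apply: measurable_funD => //; exact: measurable_snd.
      apply: (measurableT_comp (measurable_normal_pdf 0 s')); apply: measurable_funB.
        exact: measurable_snd.
      by apply: measurable_funM => //; exact: measurable_fst.
    + by move=> zy; rewrite -EFinM lee_fin mulr_ge0 ?normal_pdf_ge0.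
  - by move=> z; apply: integral_ge0 => y _; rewrite -EFinM lee_fin mulr_ge0 ?normal_pdf_ge0.
  apply: eq_integral => z _; rewrite -ge0_integralZr//.
  - apply/measurable_EFinP; apply: measurable_funM.
      by apply: continuous_measurable_fun; exact: cgx.
    by apply: continuous_measurable_fun; exact: cp.
  - by move=> y _; rewrite -EFinM lee_fin mulr_ge0 ?normal_pdf_ge0.
  - by rewrite lee_fin normal_pdf_ge0.
(* With the order exchanged, the inner integral is, after rescaling by [s], that of the conditional
   density in [normal_pdf_convolution], hence 1. *)
rewrite fubini_tonelli//.
rewrite (@ge0_integral_normal_scale S (fun y => g (x + y)))//.
rewrite ge0_integral_normal_prob//; last 2 first.
  by apply/measurable_EFinP; apply: continuous_measurable_fun; exact: cgx.
  by move=> y; rewrite lee_fin.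
apply: eq_integral => y _.
transitivity (\int[mu]_u ((g (x + y) * normal_pdf 0 S y)%:E *
    (normal_pdf (s ^+ 2 * y / (s ^+ 2 + s' ^+ 2)) (s * s' / S) u)%:E))%E.
  pose f u := g (x + y) * normal_pdf 0 S y *
    normal_pdf (s ^+ 2 * y / (s ^+ 2 + s' ^+ 2)) (s * s' / S) u.
  transitivity (\int[mu]_u (f (s * u) * s)%:E)%E.
    have E z : normal_pdf 0 s' (y - s * z) * normal_pdf 0 1 z = normal_pdf 0 S y *
        (normal_pdf (s ^+ 2 * y / (s ^+ 2 + s' ^+ 2)) (s * s' / S) (s * z) * s).
      rewrite -(normal_pdf_rescale z s0) mulrA [RHS]mulrA.
      rewrite -(normal_pdf_convolution (s * z) y s0 s'0).
      by rewrite (mulrC (normal_pdf 0 s' _)).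
    by apply: eq_integral => z _; rewrite /F /f /= -mulrA E !mulrA.
  transitivity (\int[mu]_u (f u)%:E)%E; last first.
    by apply: eq_integral => u _; rewrite -EFinM.
  apply/esym/ge0_integral_scale => //.
    move=> u; apply: cvgM; first exact: cvg_cst.
    by apply: continuous_normal_pdf; rewrite gt_eqF// divr_gt0// mulr_gt0.
  by move=> u; rewrite /f !mulr_ge0 ?normal_pdf_ge0.
rewrite ge0_integralZl//.
- by rewrite integral_normal_pdf mule1.
- by apply/measurable_EFinP; exact: measurable_normal_pdf.
- by move=> u _; rewrite lee_fin normal_pdf_ge0.
- by rewrite lee_fin mulr_ge0 ?normal_pdf_ge0.
Qed.

End normal.

(** * Second moments *)

Section second_moment.
Context d (T : measurableType d) (R : realType) (P : probability T R).
Implicit Types f xi : T -> R.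

Lemma bounded_integrable f M : measurable_fun setT f ->
  (forall x, `|f x| <= M) -> P.-integrable setT (EFin \o f).
Proof.
move=> mf fM; apply: measurable_bounded_integrable => //.
  by rewrite (le_lt_trans (probability_le1 _ _)) ?ltry.
exists M; split; first exact: num_real.
by move=> x Mx y _; exact/ltW/(le_lt_trans (fM y)).
Qed.

Lemma integrable_sqrW xi : measurable_fun setT xi ->
  P.-integrable setT (EFin \o (fun w => xi w ^+ 2)) ->
  P.-integrable setT (EFin \o xi).
Proof.
move=> mxi i2.
have i1 := integrableD measurableT
  (finite_measure_integrable_cst P 1 measurableT) i2.
apply: le_integrable i1 => //; first exact/measurable_EFinP.
move=> x _; rewrite lee_fin ler_norml; have := sqr_ge0 (`|xi x| - 1).
have := sqr_ge0 (`|xi x|); rewrite sqrrB1 real_normK ?num_real//.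
have := ler_norm (xi x); have := ler_norm (- xi x); rewrite normrN.
have : 1 + xi x ^+ 2 <= `|1 + xi x ^+ 2| by exact: ler_norm.
lra.
Qed.

Lemma Rintegral_cst_prob (r : R) : \int[P]_w r = r.
Proof. by rewrite Rintegral_cst//= probability_setT mulr1. Qed.

Lemma integrable_lin (a b : R) f g : P.-integrable setT (EFin \o f) ->
  P.-integrable setT (EFin \o g) ->
  P.-integrable setT (EFin \o (fun w => a * f w + b * g w)).
Proof.
move=> iF iG.
exact: (integrableD measurableT (integrableZl measurableT a iF)
                                (integrableZl measurableT b iG)).
Qed.

Lemma Rintegral_lin (a b : R) f g : P.-integrable setT (EFin \o f) ->
  P.-integrable setT (EFin \o g) ->
  \int[P]_w (a * f w + b * g w) = a * (\int[P]_w f w) + b * (\int[P]_w g w).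
Proof.
move=> iF iG; rewrite RintegralD//.
- by rewrite !RintegralZl.
- exact: (integrableZl measurableT a iF).
- exact: (integrableZl measurableT b iG).
Qed.

Lemma integrable_quadratic (a b c : R) xi : measurable_fun setT xi ->
  P.-integrable setT (EFin \o (fun w => xi w ^+ 2)) ->
  P.-integrable setT (EFin \o (fun w => a + b * xi w + c * xi w ^+ 2)).
Proof.
move=> mxi i2; have i1 := integrable_sqrW mxi i2.
have ic := finite_measure_integrable_cst P a measurableT.
have := integrable_lin 1 1 ic (integrable_lin b c i1 i2).
by apply: eq_integrable => // w _ /=; rewrite !mul1r addrA.
Qed.

Lemma Rintegral_quadratic (a b c : R) xi : measurable_fun setT xi ->
  P.-integrable setT (EFin \o (fun w => xi w ^+ 2)) ->
  \int[P]_w (a + b * xi w + c * xi w ^+ 2) =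
  a + b * (\int[P]_w xi w) + c * (\int[P]_w (xi w ^+ 2)).
Proof.
move=> mxi i2; have i1 := integrable_sqrW mxi i2.
have ic := finite_measure_integrable_cst P a measurableT.
transitivity (\int[P]_w (1 * a + 1 * (b * xi w + c * xi w ^+ 2))).
  by apply: eq_Rintegral => w _; rewrite !mul1r addrA.
rewrite (Rintegral_lin 1 1 ic (integrable_lin b c i1 i2)).
by rewrite (Rintegral_lin b c i1 i2) Rintegral_cst_prob !mul1r addrA.
Qed.

Lemma le_normr_Rintegral_bound f M : measurable_fun setT f ->
  (forall x, `|f x| <= M) -> `|\int[P]_w f w| <= M.
Proof.
move=> mf fM; have iF := bounded_integrable mf fM.
apply: le_trans (le_normr_Rintegral _ iF) _ => //.
rewrite -[leRHS]Rintegral_cst_prob; apply: le_Rintegral => //.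
  by have := integrable_norm iF.
exact: finite_measure_integrable_cst.
Qed.

(** Tonelli gives measurability in the parameter for nonnegative integrands, so [C] is added to [g]
    and subtracted afterwards. *)
Lemma measurable_shift_avg (Y : T -> R) (g : R -> R) (C : R) : measurable_fun setT Y ->
  measurable_fun setT g -> (forall y, `|g y| <= C) ->
  measurable_fun setT (fun x : R => \int[P]_w g (x + Y w)).
Proof.
move=> mY mg gC.
have gC0 y : 0 <= g y + C by have := gC y; rewrite ler_norml; lra.
have mgY x : measurable_fun setT (fun w => g (x + Y w)).
  by apply: (measurableT_comp mg); exact: measurable_funD.
have igY x := bounded_integrable (mgY x) (fun w => gC (x + Y w)).
have iC := finite_measure_integrable_cst P C measurableT.
suff : measurable_fun setT (fun x : R => \int[P]_w (g (x + Y w) + C) - C).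
  apply: eq_measurable_fun => x _.
  by rewrite (RintegralD measurableT (igY x) iC) Rintegral_cst_prob addrK.
apply: measurable_funB => //.
apply/measurable_EFinP.
apply: (eq_measurable_fun (fun x : R => \int[P]_w (g (x + Y w) + C)%:E)%E).
  move=> x _; rewrite /= fineK//.
  exact: integrable_fin_num (integrableD measurableT (igY x) iC).
apply: (@measurable_fun_fubini_tonelli_F _ _ R T R P
   (fun xw => (g (xw.1 + Y xw.2) + C)%:E)).
  apply/measurable_EFinP; apply: measurable_funD => //; apply: (measurableT_comp mg).
  apply: measurable_funD; first exact: measurable_fst.
  by apply: (measurableT_comp mY); exact: measurable_snd.
by move=> xw; rewrite lee_fin.
Qed.

End second_moment.

(** * Moments of the standard normal law *)

Section moments.
Variable R : realType.
Notation mu := (@lebesgue_measure R).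

Lemma is_derive_ext (f g : R -> R) (x a b : R) : f =1 g -> a = b ->
  is_derive x 1 f a -> is_derive x 1 g b.
Proof. by move=> /funext -> ->. Qed.

Lemma integral_is_derive (F f : R -> R) (a b : R) : a < b -> continuous f ->
  (forall x : R, is_derive x 1 F (f x)) ->
  (\int[mu]_(x in `[a, b]) (f x)%:E = (F b - F a)%:E)%E.
Proof.
move=> ab cf dF.
have cF : continuous F.
  by move=> x; apply/differentiable_continuous/derivable1_diffP; exact: ex_derive.
rewrite (@continuous_FTC2 _ f F a b) ?EFinB//.
- exact/continuous_subspaceT.
- split; first by move=> x _; exact: ex_derive.
  + exact/cvg_at_right_filter/cF.
  + exact/cvg_at_left_filter/cF.
- by move=> x _; rewrite derive1E; exact: derive_val.
Qed.

Notation p := (@normal_pdf R 0 1).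

Lemma is_derive_normal_pdf (x : R) : is_derive x 1 p (- (x * p x)).
Proof.
have pE : p = (fun y : R => normal_peak 1 * expR (- (2^-1) * y ^+ 2)).
  apply/funext => y; rewrite normal_pdfE ?oner_neq0// /normal_fun subr0 expr1n.
  by congr (_ * expR _); field.
rewrite pE.
have d1 : is_derive x 1 (fun y : R => - (2^-1) * y ^+ 2) (- x).
  have : is_derive x 1 (- (2^-1) \*: ((@id R) ^+ 2)) (- (2^-1) *: ((2%:R * x ^+ 1) *: 1)).
    by apply: is_deriveZ; exact: is_deriveX.
  apply: is_derive_ext; first by move=> y; rewrite /GRing.scale/= fctE.
  by rewrite /GRing.scale/= expr1; field.
have d2 := @is_derive1_comp _ expR (fun y : R => - (2^-1) * y ^+ 2) x _ _ (is_derive_expR _) d1.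
have : is_derive x 1 (normal_peak 1 \*: (expR \o (fun y : R => - (2^-1) * y ^+ 2)))
   (normal_peak 1 *: (expR (- (2^-1) * x ^+ 2) * - x)) by exact: is_deriveZ.
by apply: is_derive_ext => //; rewrite /GRing.scale/=; ring.
Qed.

Lemma is_derive_id_normal_pdf (x : R) :
  is_derive x 1 (fun y => y * p y) (p x - x ^+ 2 * p x).
Proof.
have : is_derive x 1 ((@id R) * p) (x *: (- (x * p x)) + p x *: 1).
  by apply: is_deriveM; exact: is_derive_normal_pdf.
by apply: is_derive_ext => //; rewrite /GRing.scale/=; ring.
Qed.

Let continuous_p : continuous p.
Proof. by apply: continuous_normal_pdf; rewrite oner_neq0. Qed.

(** The boundary term of an integration by parts; [1 + y <= expR y] at [y = n ^ 2 / 2] bounds it by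
    [2 * normal_peak 1 / n]. *)
Lemma natr_normal_pdf_cvg0 : (n%:R * p n%:R) @[n --> \oo] --> (0 : R).
Proof.
have h : (2 * normal_peak 1 * (n%:R : R)^-1) @[n --> \oo] --> (0 : R).
  rewrite -[X in _ --> X](mulr0 (2 * normal_peak 1)).
  apply: cvgM; first exact: cvg_cst.
  rewrite gtr0_cvgV0; first exact: cvgr_idn.
  by near=> n; rewrite ltr0n; near: n; exact: nbhs_infty_gt.
apply: squeeze_cvgr (cvg_cst 0) h; near=> n.
have n0 : (0 : R) < n%:R by rewrite ltr0n; near: n; exact: nbhs_infty_gt.
rewrite mulr_ge0 ?normal_pdf_ge0 ?ler0n//=.
rewrite normal_pdfE ?oner_neq0// /normal_fun subr0 expr1n.
rewrite mulNr expRN mulrCA [leRHS]mulrAC [leRHS]mulrC ler_pM2l ?normal_peak_gt0 ?oner_neq0//.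
rewrite ler_pdivrMr ?expR_gt0// mulrAC ler_pdivlMr// -expr2.
have := expR_ge1Dx ((n%:R : R) ^+ 2 / 2); lra.
Unshelve. all: by end_near. Qed.

Let itvN (n : nat) : set R := `[- n%:R, n%:R].

Let itvN_bigcup : \bigcup_n itvN n = setT.
Proof.
apply/seteqP; split => // x _; exists (Num.bound `|x|) => //=.
rewrite /itvN/= in_itv/= -ler_norml ltW//.
exact: archi_boundP.
Qed.

Let itvN_homo : {homo itvN : n m / (n <= m)%N >-> (n <= m)%O}.
Proof.
move=> n m nm; apply/subsetPset; apply: subset_itv; rewrite bnd_simp ?lerN2 ler_nat//.
Qed.

(** The derivative of [x * p x] is [p x - x ^ 2 * p x], so over [[-n, n]] the mass and the second
    moment differ by the boundary term [2 * n * p n], which tends to 0. *)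
Lemma integral_sqr_normal :
  (\int[@normal_prob R 0 1]_x (x ^+ 2)%:E = 1)%E.
Proof.
rewrite ge0_integral_normal_prob; last 2 first.
  by apply/measurable_EFinP; exact: measurable_funX.
  by move=> x; rewrite lee_fin sqr_ge0.
have m2 : measurable_fun setT (fun x : R => x ^+ 2 * p x).
  by apply: measurable_funM; [exact: measurable_funX|exact: measurable_normal_pdf].
under eq_integral do rewrite -EFinM.
rewrite -itvN_bigcup.
have c2 : (\int[mu]_(x in itvN n) (x ^+ 2 * p x)%:E)%E @[n --> \oo] -->
    (\int[mu]_(x in \bigcup_n itvN n) (x ^+ 2 * p x)%:E)%E.
  apply: (@ge0_nondecreasing_set_cvg_integral _ (measurableTypeR R) R _ _ mu itvN_homo) => [i|i|i x _].
  - exact: measurable_itv.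
  - exact/measurable_EFinP/measurable_funTS.
  - by rewrite lee_fin mulr_ge0 ?sqr_ge0 ?normal_pdf_ge0.
suff c4 : (\int[mu]_(x in itvN n) (x ^+ 2 * p x)%:E)%E @[n --> \oo] --> 1%E.
  exact: (cvg_unique _ c2 c4).
have c1 : (\int[mu]_(x in itvN n) (p x)%:E)%E @[n --> \oo] --> 1%E.
  rewrite -(integral_normal_pdf 0 1) -itvN_bigcup.
  apply: (@ge0_nondecreasing_set_cvg_integral _ (measurableTypeR R) R _ _ mu itvN_homo) => [i|i|i x _].
  - exact: measurable_itv.
  - by apply/measurable_EFinP; apply: measurable_funTS; exact: measurable_normal_pdf.
  - by rewrite lee_fin normal_pdf_ge0.
have c3 : ((n%:R * p n%:R) *+ 2)%:E @[n --> \oo] --> (0 : R)%:E.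
  apply: cvg_EFin; first by near=> n.
  change ((fun n : nat => n%:R * p n%:R *+ 2) @ \oo --> (0 : R)).
  rewrite -[X in _ --> X](addr0 (0 : R)); under eq_fun do rewrite mulr2n.
  by apply: cvgD; exact: natr_normal_pdf_cvg0.
have : (\int[mu]_(x in itvN n) (p x)%:E - ((n%:R * p n%:R) *+ 2)%:E)%E @[n --> \oo] --> 1%E.
  by rewrite -[X in _ --> X]sube0; apply: cvgeB.
apply: cvg_trans; apply: near_eq_cvg; near=> n.
have n0 : (0 : R) < n%:R by rewrite ltr0n; near: n; exact: nbhs_infty_gt.
have intE (f : R -> R) : continuous f -> mu.-integrable (itvN n) (EFin \o f).
  move=> cf; apply: continuous_compact_integrable; first exact: segment_compact.
  exact: continuous_subspaceT.
have c2p : continuous (fun x : R => x ^+ 2 * p x).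
  by move=> x; apply: cvgM; [exact: sqr_continuous|exact: continuous_p].
have ip := intE _ continuous_p; have i2p := intE _ c2p.
have mi : measurable (itvN n : set (measurableTypeR R)) by exact: measurable_itv.
have fp := integrable_fin_num mi ip.
have f2p := integrable_fin_num mi i2p.
have h : (\int[mu]_(x in itvN n) (p x - x ^+ 2 * p x)%:E =
    (n%:R * p n%:R - (- n%:R) * p (- n%:R))%:E)%E.
  apply: (@integral_is_derive (fun y => y * p y)).
  - by rewrite gtrN.
  - by move=> x; apply: cvgB; [exact: continuous_p|exact: c2p].
  - exact: is_derive_id_normal_pdf.
have pN x : p (- x) = p x.
  by rewrite !normal_pdfE ?oner_neq0// /normal_fun !subr0 sqrrN.
move: h; rewrite pN integralB_EFin//=.
rewrite -(fineK fp) -(fineK f2p) -!EFinB => -[h]; congr EFin.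
by rewrite mulNr opprK in h; rewrite mulr2n -h; ring.
Unshelve. all: by end_near. Qed.

Notation N := (@normal_prob R 0 1).

Lemma integrable_sqr_normal : N.-integrable setT (fun x => (x ^+ 2)%:E).
Proof.
apply/integrableP; split; first by apply/measurable_EFinP; exact: measurable_funX.
under eq_integral do rewrite abse_EFin ger0_norm ?sqr_ge0//.
by rewrite integral_sqr_normal ltry.
Qed.

Lemma integrable_id_normal : N.-integrable setT (fun x => x%:E).
Proof. exact: (@integrable_sqrW _ _ _ N (@id R) _ integrable_sqr_normal). Qed.

Lemma integral_quadratic_normal (a b c : R) :
  (\int[N]_x (a * x ^+ 2 + b * x + c)%:E =
   (a + b * fine (\int[N]_x x%:E) + c)%:E)%E.
Proof.
have ic := finite_measure_integrable_cst N c measurableT.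
have i2 := integrableZl measurableT a integrable_sqr_normal.
have i1 := integrableZl measurableT b integrable_id_normal.
under eq_integral do rewrite !EFinD !EFinM.
rewrite integralD//; last exact: integrableD.
rewrite integralD// integralZl//; last exact: integrable_sqr_normal.
rewrite integralZl//; last exact: integrable_id_normal.
rewrite integral_sqr_normal integral_cst//.
rewrite [X in (_ + c%:E * X)%E](_ : _ = 1%E); last exact: (probability_setT N).
rewrite !mule1.
rewrite !EFinD EFinM fineK//.
exact: integrable_fin_num integrable_id_normal.
Qed.

(* The semigroup identity for x^2 reads 2 + 2 m^2 = 2 for the mean m. *)
Lemma integral_id_normal : (\int[N]_x x%:E = 0)%E.
Proof.
have fm := integrable_fin_num measurableT integrable_id_normal.
set m := fine (\int[N]_x x%:E)%E.
have inner z : (\int[N]_z' ((0 + 1 * z + 1 * z') ^+ 2)%:E =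
    (1 * z ^+ 2 + (2 * m) * z + 1)%:E)%E.
  transitivity (\int[N]_z' (1 * z' ^+ 2 + (2 * z) * z' + z ^+ 2)%:E)%E.
    by apply: eq_integral => z' _; congr EFin; ring.
  by rewrite integral_quadratic_normal -/m; congr EFin; ring.
have S2 : (\int[N]_z ((0 + Num.sqrt (1 ^+ 2 + 1 ^+ 2) * z) ^+ 2)%:E =
    (2 + 0 * m + 0)%:E)%E.
  transitivity (\int[N]_z (2 * z ^+ 2 + 0 * z + 0)%:E)%E.
    apply: eq_integral => z _; congr EFin.
    by rewrite add0r exprMn sqr_sqrtr ?addr_ge0 ?sqr_ge0//; ring.
  by rewrite integral_quadratic_normal.
have : (\int[N]_z (1 * z ^+ 2 + (2 * m) * z + 1)%:E = (2 + 0 * m + 0)%:E)%E.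
  rewrite -S2; apply: etrans (@ge0_normal_semigroup R 1 1 0 (fun x => x ^+ 2)
    ltr01 ltr01 (@sqr_continuous R) (fun x => sqr_ge0 x)).
  by apply: eq_integral => z _; rewrite inner.
rewrite integral_quadratic_normal -/m => -[h].
have /eqP : m ^+ 2 = 0 by nra.
by rewrite sqrf_eq0 => /eqP m0; rewrite -(fineK fm) -/m m0.
Qed.

End moments.

(* g2 plays the role of half the second derivative. *)
Definition taylor2_class (R : realType) (K L : R) (g : R -> R) : Prop :=
  exists M : R, exists g1 g2 : R -> R,
  [/\ measurable_fun setT g1, measurable_fun setT g2,
      (forall x, `|g1 x| <= M), (forall x, `|g2 x| <= M) &
      forall x h, `|g (x + h) - (g x + g1 x * h + g2 x * h ^+ 2)| <=
        Num.min (K * h ^+ 2) (L * `|h| ^+ 3)].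

(** The minimum is Lindeberg's device: the cubic bound is small for small values of [xi], while the
    quadratic one keeps the integral finite under a second moment alone. *)
Definition taylor2_err d (T : measurableType d) (R : realType)
    (P : probability T R) (K L : R) (xi : T -> R) : R :=
  \int[P]_w (Num.min (K * xi w ^+ 2) (L * `|xi w| ^+ 3)).

Section taylor2.
Context (R : realType).
Variables (K L : R).
Hypotheses (K0 : 0 <= K) (L0 : 0 <= L).

Lemma integrable_taylor2_err d (T : measurableType d) (P : probability T R)
    (xi : T -> R) : measurable_fun setT xi ->
  P.-integrable setT (EFin \o (fun w => xi w ^+ 2)) ->
  P.-integrable setT
    (EFin \o (fun w => Num.min (K * xi w ^+ 2) (L * `|xi w| ^+ 3))).
Proof.
move=> mxi i2; apply: le_integrable (integrableZl measurableT K i2) => //.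
  apply/measurable_EFinP; apply: measurable_minr.
    by apply: measurable_funM => //; exact: measurable_funX.
  apply: measurable_funM => //; apply: measurable_funX.
  exact: measurableT_comp.
move=> w _ /=; have m0 : 0 <= Num.min (K * xi w ^+ 2) (L * `|xi w| ^+ 3).
  by rewrite le_min; apply/andP; split; apply: mulr_ge0; rewrite ?sqr_ge0 ?exprn_ge0.
rewrite lee_fin (ger0_norm m0) (le_trans _ (ler_norm _))//.
by rewrite ge_min; apply/orP; left.
Qed.

(** The linear term integrates to 0 and the quadratic one sees only the variance, so up to
    [taylor2_err] the result is the same for all centred laws of variance [v]. *)
Lemma taylor2_step d (T : measurableType d) (P : probability T R)
    (xi : T -> R) (g g1 g2 : R -> R) (C v x : R) :
  measurable_fun setT g -> (forall y, `|g y| <= C) ->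
  (forall h, `|g (x + h) - (g x + g1 x * h + g2 x * h ^+ 2)| <=
        Num.min (K * h ^+ 2) (L * `|h| ^+ 3)) ->
  measurable_fun setT xi ->
  P.-integrable setT (EFin \o (fun w => xi w ^+ 2)) ->
  \int[P]_w xi w = 0 -> \int[P]_w (xi w ^+ 2) = v ->
  `|\int[P]_w g (x + xi w) - (g x + g2 x * v)| <= taylor2_err P K L xi.
Proof.
move=> mg gC tg mxi i2 e0 ev.
have mgx : measurable_fun setT (fun w => g (x + xi w)).
  by apply: measurableT_comp => //; exact: measurable_funD.
have ig : P.-integrable setT (EFin \o (fun w => g (x + xi w))).
  exact: bounded_integrable (fun w => gC _).
have iq := integrable_quadratic (g x) (g1 x) (g2 x) mxi i2.
have -> : g x + g2 x * v = \int[P]_w (g x + g1 x * xi w + g2 x * xi w ^+ 2).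
  by rewrite Rintegral_quadratic// e0 ev mulr0 addr0.
rewrite -RintegralB//.
have iB := integrableB measurableT ig iq.
apply: le_trans (le_normr_Rintegral _ iB) _ => //.
apply: le_Rintegral => //; last exact: integrable_taylor2_err.
by have := integrable_norm iB.
Qed.

End taylor2.

(** * Gaussian averages *)

(** The heat semigroup parametrized by the standard deviation. Integrating against the standard law
    keeps it meaningful at [s = 0], where it is the identity. *)
Definition gauss_avg (R : realType) (s : R) (g : R -> R) (x : R) : R :=
  \int[@normal_prob R 0 1]_z g (x + s * z).

Section gauss_avg.
Context (R : realType).
Implicit Types (g : R -> R) (s x : R).
Notation N := (@normal_prob R 0 1).

Lemma integrable_gauss_avg s x g C : measurable_fun setT g ->
  (forall y, `|g y| <= C) ->
  N.-integrable setT (EFin \o (fun z => g (x + s * z))).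
Proof.
move=> mg gC; apply: (@bounded_integrable _ _ _ N _ C) => //.
apply: (measurableT_comp mg); exact: measurable_fun_affine.
Qed.

Lemma gauss_avg_le s g C x : measurable_fun setT g ->
  (forall y, `|g y| <= C) -> `|gauss_avg s g x| <= C.
Proof.
move=> mg gC; apply: (@le_normr_Rintegral_bound _ _ _ N) => //.
apply: (measurableT_comp mg); exact: measurable_fun_affine.
Qed.

Lemma EFin_gauss_avg s g C x : measurable_fun setT g -> (forall y, `|g y| <= C) ->
  (gauss_avg s g x)%:E = (\int[N]_z (g (x + s * z))%:E)%E.
Proof.
move=> mg gC; rewrite fineK//.
exact: integrable_fin_num (integrable_gauss_avg s x mg gC).
Qed.

Lemma gauss_avgDr s g C c x : measurable_fun setT g -> (forall y, `|g y| <= C) ->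
  gauss_avg s (fun y => g y + c) x = gauss_avg s g x + c.
Proof.
move=> mg gC; rewrite /gauss_avg RintegralD//.
- by congr +%R; exact: (@Rintegral_cst_prob _ _ _ N).
- exact: integrable_gauss_avg mg gC.
- exact: (finite_measure_integrable_cst N c measurableT).
Qed.

Lemma measurable_gauss_avg s g C : measurable_fun setT g ->
  (forall y, `|g y| <= C) -> measurable_fun setT (gauss_avg s g).
Proof.
move=> mg gC; apply: (@measurable_shift_avg _ _ _ N (fun z => s * z) g C) => //.
exact: measurable_funM.
Qed.

Lemma gauss_avg0 g x : gauss_avg 0 g x = g x.
Proof.
rewrite -[RHS](@Rintegral_cst_prob _ _ _ N); apply: eq_Rintegral => z _.
by rewrite mul0r addr0.
Qed.

(** Adding [C] makes [g] nonnegative and reduces the claim to [ge0_normal_semigroup]; the degenerate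
    deviations, which have no density, are settled by [gauss_avg0]. *)
Lemma gauss_avg_semigroup s s' g C x : 0 <= s -> 0 <= s' -> continuous g ->
  (forall y, `|g y| <= C) ->
  gauss_avg s (gauss_avg s' g) x = gauss_avg (Num.sqrt (s ^+ 2 + s' ^+ 2)) g x.
Proof.
move=> s0 s'0 cg gC.
have mg : measurable_fun setT g by exact: continuous_measurable_fun.
have [<-|sN0] := eqVneq 0 s.
  by rewrite gauss_avg0 expr0n/= add0r sqrtr_sqr ger0_norm.
have [<-|s'N0] := eqVneq 0 s'.
  rewrite expr0n/= addr0 sqrtr_sqr ger0_norm//.
  by apply: eq_Rintegral => z _; rewrite gauss_avg0.
have gC0 y : 0 <= g y + C by have := gC y; rewrite ler_norml; lra.
have mgC : measurable_fun setT (fun y => g y + C) by exact: measurable_funD.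
have gCC y : `|g y + C| <= C + C.
  by rewrite (le_trans (ler_normD _ _))// lerD// ger0_norm// (le_trans (normr_ge0 (g 0))).
have mgs : measurable_fun setT (gauss_avg s' g) := measurable_gauss_avg s' mg gC.
have gsC y : `|gauss_avg s' g y| <= C := gauss_avg_le s' y mg gC.
apply: (addIr C); rewrite -(gauss_avgDr _ _ _ mg gC) -(gauss_avgDr _ _ _ mgs gsC).
have mgsC : measurable_fun setT (fun y => gauss_avg s' g y + C) by exact: measurable_funD.
have gsCC y : `|gauss_avg s' g y + C| <= C + C.
  by rewrite (le_trans (ler_normD _ _))// lerD// ger0_norm// (le_trans (normr_ge0 (g 0))).
apply: EFin_inj; rewrite (EFin_gauss_avg _ _ mgC gCC) (EFin_gauss_avg _ _ mgsC gsCC).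
have sp : 0 < s by rewrite lt0r eq_sym sN0.
have s'p : 0 < s' by rewrite lt0r eq_sym s'N0.
apply: etrans (@ge0_normal_semigroup _ s s' x (fun y => g y + C) sp s'p _ gC0); last first.
  by move=> y; apply: cvgD; [exact: cg|exact: cvg_cst].
apply: eq_integral => z _.
by rewrite -(gauss_avgDr _ _ _ mg gC) (EFin_gauss_avg _ _ mgC gCC).
Qed.

(** The remainder bound is uniform in the base point, so averaging over base points keeps the same
    [K] and [L]; the constants do not deteriorate along the exchange of summands. *)
Lemma taylor2_class_gauss_avg (K L C : R) s g : measurable_fun setT g ->
  (forall y, `|g y| <= C) -> taylor2_class K L g ->
  taylor2_class K L (gauss_avg s g).
Proof.
move=> mg gC [M [g1 [g2 [m1 m2 b1 b2 tg]]]].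
exists M, (gauss_avg s g1), (gauss_avg s g2); split.
- exact: measurable_gauss_avg b1.
- exact: measurable_gauss_avg b2.
- by move=> x; exact: gauss_avg_le.
- by move=> x; exact: gauss_avg_le.
move=> x h.
have i0 y := integrable_gauss_avg s y mg gC.
have i1 := integrable_gauss_avg s x m1 b1.
have i2 := integrable_gauss_avg s x m2 b2.
have i12 := integrable_lin h (h ^+ 2) i1 i2.
have i012 := integrable_lin 1 1 (i0 x) i12.
have iA := integrable_lin 1 (-1) (i0 (x + h)) i012.
have -> : gauss_avg s g (x + h) - (gauss_avg s g x + gauss_avg s g1 x * h +
    gauss_avg s g2 x * h ^+ 2) = \int[N]_z (1 * g (x + h + s * z) +
      -1 * (1 * g (x + s * z) + 1 * (h * g1 (x + s * z) + h ^+ 2 * g2 (x + s * z)))).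
  rewrite (Rintegral_lin 1 (-1) (i0 (x + h)) i012) (Rintegral_lin 1 1 (i0 x) i12).
  by rewrite (Rintegral_lin h (h ^+ 2) i1 i2) /gauss_avg; ring.
apply: (@le_normr_Rintegral_bound _ _ _ N).
  by case/integrableP : iA => /measurable_EFinP.
move=> z; have := tg (x + s * z) h.
rewrite (_ : x + s * z + h = x + h + s * z); last by ring.
by rewrite !mul1r mulN1r (mulrC h) (mulrC (h ^+ 2)) !addrA.
Qed.

Lemma scaled_normal_moments s : [/\ measurable_fun setT (fun z : R => s * z),
  N.-integrable setT (EFin \o (fun z : R => (s * z) ^+ 2)),
  \int[N]_z (s * z) = 0 & \int[N]_z ((s * z) ^+ 2) = s ^+ 2].
Proof.
split; first exact: measurable_funM.
- have := integrableZl measurableT (s ^+ 2) (@integrable_sqr_normal R).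
  by apply: eq_integrable => // z _; rewrite /= exprMn.
- rewrite RintegralZl//; last exact: integrable_id_normal.
  by rewrite /Rintegral integral_id_normal mulr0.
under eq_Rintegral do rewrite exprMn.
rewrite RintegralZl//; last exact: integrable_sqr_normal.
by rewrite /Rintegral integral_sqr_normal mulr1.
Qed.

Lemma taylor2_compare d (T : measurableType d) (P : probability T R)
    (K L C s x : R) (xi : T -> R) g : 0 <= K -> 0 <= L ->
  measurable_fun setT g -> (forall y, `|g y| <= C) -> taylor2_class K L g ->
  measurable_fun setT xi ->
  P.-integrable setT (EFin \o (fun w => xi w ^+ 2)) ->
  \int[P]_w xi w = 0 -> \int[P]_w (xi w ^+ 2) = s ^+ 2 ->
  `|\int[P]_w g (x + xi w) - gauss_avg s g x| <=
    taylor2_err P K L xi + taylor2_err N K L (fun z => s * z).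
Proof.
move=> K0 L0 mg gC [M [g1 [g2 [m1 m2 b1 b2 tg]]]] mxi i2 e0 e2.
have t1 := taylor2_step K0 L0 mg gC (tg x) mxi i2 e0 e2.
have [ms is2 es0 es2] := scaled_normal_moments s.
have t2 := @taylor2_step _ _ _ K0 L0 _ _ N _ _ _ _ _ _ _ mg gC (tg x) ms is2 es0 es2.
rewrite -[X in `|X - _|](subrK (g x + g2 x * s ^+ 2)) -addrA.
apply: le_trans (ler_normD _ _) _; apply: lerD => //.
by rewrite distrC.
Qed.

End gauss_avg.

(** * Independence *)

Section independence.
Context d (T : measurableType d) (R : realType) (P : probability T R).
Implicit Types (A B : set T) (G H : set (set T)).

Lemma indep_dynkin B : measurable B ->
  dynkin [set A | measurable A /\ P (A `&` B) = (P A * P B)%E].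
Proof.
move=> mB; split.
- by split; [exact: measurableT|rewrite setTI probability_setT mul1e].
- move=> A [mA AB]; split; first exact: measurableC.
  rewrite setIC -setDE measureD//=; last by rewrite (le_lt_trans (probability_le1 _ _))// ltry.
  rewrite setIC AB probability_setC//=.
  by rewrite muleBl ?mul1e//; exact: fin_num_measure.
- move=> F tF mF; split; first by apply: bigcup_measurable => k _; case: (mF k).
  rewrite setI_bigcupl measure_bigcup//=; last 2 first.
  + by move=> k _; apply: measurableI => //; case: (mF k).
  + exact: trivIset_setIr.
  rewrite measure_bigcup//=; last by move=> k _; case: (mF k).
  rewrite muleC -(fineK (fin_num_measure P B mB)) -nneseriesZl; last first.
    by move=> k _; exact: measure_ge0.
  by apply: eq_eseriesr => k _; case: (mF k) => _ ->; rewrite muleC fineK ?fin_num_measure.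
Qed.

(** The pi-lambda theorem, applied to one factor at a time. *)
Lemma indep_g_sigma G H : setI_closed G -> setI_closed H ->
  G `<=` measurable -> H `<=` measurable ->
  (forall A B, G A -> H B -> P (A `&` B) = (P A * P B)%E) ->
  forall A B, <<s G >> A -> <<s H >> B -> P (A `&` B) = (P A * P B)%E.
Proof.
move=> IG IH mG mH GH A B sA sB.
have step G' B' : setI_closed G' -> G' `<=` measurable -> measurable B' ->
    (forall A', G' A' -> P (A' `&` B') = (P A' * P B')%E) ->
    forall A', <<s G' >> A' -> P (A' `&` B') = (P A' * P B')%E.
  move=> IG' mG' mB' h A'; rewrite -setI_closed_g_dynkin_g_sigma_algebra//.
  have := @smallest_sub _ dynkin G' _ (indep_dynkin mB').
  move=> /(_ _)/[swap] sA'; have: G' `<=` [set A0 | measurable A0 /\ P (A0 `&` B') = (P A0 * P B')%E].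
    by move=> A0 GA0; split; [exact: mG'|exact: h].
  by move=> sub /(_ sub A' sA') [].
have msub G' : G' `<=` measurable -> <<s G' >> `<=` measurable.
  by move=> mG'; apply: smallest_sub => //; exact: sigma_algebra_measurable.
apply: (step G B) => //; first exact: (msub H mH).
move=> A' GA'; rewrite setIC muleC; apply: (step H A') => //; first exact: mG.
by move=> B' HB'; rewrite setIC muleC; exact: GH.
Qed.

End independence.

Definition indep2 d (T : measurableType d) (R : realType) (P : probability T R)
    (X Y : T -> R) : Prop :=
  forall A B : set R, measurable A -> measurable B ->
    P (X @^-1` A `&` Y @^-1` B) = (P (X @^-1` A) * P (Y @^-1` B))%E.

Section integral_distribution.
Context d (T : measurableType d) (R : realType) (P : probability T R).

Lemma integral_distributionT (X : {mfun T >-> R}) (h : R -> \bar R) :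
  measurable_fun setT h ->
  (\int[distribution P X]_y h y = \int[P]_w h (X w))%E.
Proof.
move=> mh; rewrite integralE [RHS]integralE.
congr (_ - _)%E.
- rewrite ge0_integral_distribution; first by apply: eq_integral => w _; rewrite /= !funeposE.
    exact: measurable_funepos.
  by move=> y; exact: funepos_ge0.
- rewrite ge0_integral_distribution; first by apply: eq_integral => w _; rewrite /= !funenegE.
    exact: measurable_funeneg.
  by move=> y; exact: funeneg_ge0.
Qed.

End integral_distribution.

Section indep2.
Context d (T : measurableType d) (R : realType) (P : probability T R).
Variables X Y : T -> R.
Hypotheses (mX : measurable_fun setT X) (mY : measurable_fun setT Y).
Hypothesis XY : indep2 P X Y.

Let X' : {mfun T >-> R} := mfun_Sub (mem_set mX).
Let Y' : {mfun T >-> R} := mfun_Sub (mem_set mY).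

(** Independence identifies the law of the pair with the product of the marginal laws, by uniqueness
    of the product measure; Fubini does the rest. *)
Lemma indep2_integral (f : R * R -> R) : measurable_fun setT f ->
  P.-integrable setT (EFin \o (fun w => f (X w, Y w))) ->
  (\int[P]_w (f (X w, Y w))%:E = \int[P]_w \int[P]_w' (f (X w, Y w'))%:E)%E.
Proof.
move=> mf intf.
pose Z w := (X w, Y w).
have mZ : measurable_fun setT Z by exact/measurable_fun_pair.
pose muX := distribution P X'; pose muY := distribution P Y'.
have muE E : measurable E -> (muX \x muY)%E E = pushforward P Z E.
  apply: product_measure_unique => A B mA mB.
  by rewrite /pushforward /= -XY.
have mEf : measurable_fun setT (EFin \o f) by exact/measurable_EFinP.
have i1 : (pushforward P Z).-integrable setT (EFin \o f).
  by apply: integrable_pushforward => //; rewrite preimage_setT.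
have i2 : (muX \x muY)%E.-integrable setT (EFin \o f).
  apply/integrableP; split=> //.
  rewrite (eq_measure_integral (pushforward P Z)); last by move=> E mE _; exact: muE.
  by case/integrableP : i1.
transitivity (\int[pushforward P Z]_z (f z)%:E)%E.
  by rewrite (integral_pushforward mZ)// preimage_setT.
rewrite -(eq_measure_integral _ (fun E mE _ => muE E mE)).
rewrite -integral12_prod_meas1// /fubini_F.
have mfx x : measurable_fun setT (fun y => (f (x, y))%:E).
  by apply: (measurableT_comp mEf); exact: measurable_pair1.
have inner x : (\int[muY]_y (f (x, y))%:E = \int[P]_w' (f (x, Y w'))%:E)%E.
  by rewrite /muY integral_distributionT//; exact: mfx.
under eq_integral do rewrite inner.
rewrite integral_distributionT//.
apply: (eq_measurable_fun (fubini_F muY (EFin \o f))).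
  by move=> x _; exact: inner.
  exact: measurable_fubini_F i2.
exact: mZ.
Qed.

Lemma indep2_expectation_prod :
  P.-integrable setT (EFin \o (fun w => X w ^+ 2)) ->
  P.-integrable setT (EFin \o (fun w => Y w ^+ 2)) ->
  P.-integrable setT (EFin \o (fun w => X w * Y w)) /\
  \int[P]_w (X w * Y w) = (\int[P]_w X w) * (\int[P]_w Y w).
Proof.
move=> X2 Y2.
have iXY : P.-integrable setT (EFin \o (fun w => X w * Y w)).
  apply: le_integrable (integrableD measurableT X2 Y2) => //.
    exact/measurable_EFinP/measurable_funM.
  move=> w _; rewrite lee_fin normrM.
  apply: le_trans (ler_norm _); rewrite -(real_normK (num_real (X w))).
  rewrite -(real_normK (num_real (Y w))).
  have := sqr_ge0 (`|X w| - `|Y w|); have := sqr_ge0 (`|X w| + `|Y w|); nra.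
split=> //; have iX := integrable_sqrW mX X2; have iY := integrable_sqrW mY Y2.
rewrite /Rintegral (@indep2_integral (fun xy => xy.1 * xy.2))//=; last first.
  by apply: measurable_funM; [exact: measurable_fst|exact: measurable_snd].
rewrite -[RHS](RintegralZr (fine (\int[P]_w (Y w)%:E)) measurableT iX).
congr fine; apply: eq_integral => w _.
under eq_integral do rewrite EFinM.
rewrite integralZl// EFinM fineK//.
exact: integrable_fin_num iY.
Qed.

End indep2.

(** * Independence of disjoint groups of variables *)

Section cyl.
Context d (T : measurableType d) (R : realType) (P : probability T R).
Context (L : choiceType) (S : set L) (xi : L -> T -> R).

(** Finite-dimensional rectangles in the coordinates from [D]: a pi-system generating the
    sigma-algebra of the variables indexed by [D]. *)
Definition cyl (D : set L) : set (set T) := [set E | exists F : {fset L},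
  [set` F] `<=` D /\ exists A : L -> set R, (forall l, measurable (A l)) /\
  E = \bigcap_(l in [set` F]) xi l @^-1` A l].

Definition scalar_indep := forall F : {fset L}, [set` F] `<=` S ->
  forall A : L -> set R, (forall l, measurable (A l)) ->
  P (\bigcap_(l in [set` F]) xi l @^-1` A l) = (\prod_(l <- F) P (xi l @^-1` A l))%E.

Hypothesis mxi : forall l, measurable_fun setT (xi l).

Lemma cyl_measurable D : cyl D `<=` measurable.
Proof.
move=> E [F [_ [A [mA ->]]]]; apply: fin_bigcap_measurable => //.
by move=> l _; rewrite -[X in measurable X]setTI; exact: mxi.
Qed.

Lemma cyl_bigcap (F1 F2 : {fset L}) (A1 A2 : L -> set R) :
  \bigcap_(l in [set` F1]) xi l @^-1` A1 l `&` \bigcap_(l in [set` F2]) xi l @^-1` A2 l =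
  \bigcap_(l in [set` (F1 `|` F2)%fset]) xi l @^-1`
    ((if l \in F1 then A1 l else setT) `&` (if l \in F2 then A2 l else setT)).
Proof.
apply/seteqP; split => w /=.
  move=> [h1 h2] l /=; rewrite in_fsetU => lF.
  by split; case: ifPn => // lFi; [exact: h1|exact: h2].
move=> h; split => l /= lF.
- have := h l; rewrite /= in_fsetU lF/= => /(_ isT) []; exact.
- have := h l; rewrite /= in_fsetU lF/= orbT => /(_ isT) [_]; exact.
Qed.

Let measurable_ifT (F1 F2 : {fset L}) (A1 A2 : L -> set R) l :
  (forall l, measurable (A1 l)) -> (forall l, measurable (A2 l)) ->
  measurable ((if l \in F1 then A1 l else setT) `&` (if l \in F2 then A2 l else setT)).
Proof. by move=> m1 m2; apply: measurableI; case: ifP. Qed.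

Lemma cyl_setI_closed D : setI_closed (cyl D).
Proof.
move=> E1 E2 [F1 [FD1 [A1 [mA1 ->]]]] [F2 [FD2 [A2 [mA2 ->]]]].
exists (F1 `|` F2)%fset; split.
  by move=> l /=; rewrite in_fsetU => /orP[] h; [exact: FD1|exact: FD2].
by rewrite cyl_bigcap; eexists; split; [|reflexivity] => l; exact: measurable_ifT.
Qed.

(** Over disjoint index sets two rectangles intersect in a rectangle whose probability splits as a
    product; [indep_g_sigma] extends this from the pi-systems. *)
Lemma indep_cyl (D1 D2 : set L) : scalar_indep -> D1 `<=` S -> D2 `<=` S ->
  D1 `&` D2 = set0 ->
  forall A B, <<s cyl D1 >> A -> <<s cyl D2 >> B -> P (A `&` B) = (P A * P B)%E.
Proof.
move=> ind D1S D2S D12; apply: indep_g_sigma.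
- exact: cyl_setI_closed.
- exact: cyl_setI_closed.
- exact: cyl_measurable.
- exact: cyl_measurable.
move=> A B [F1 [FD1 [A1 [mA1 ->]]]] [F2 [FD2 [A2 [mA2 ->]]]].
have F12 l : l \in F1 -> l \in F2 -> False.
  move=> l1 l2; have : (D1 `&` D2) l by split; [exact: FD1|exact: FD2].
  by rewrite D12.
rewrite cyl_bigcap ind; last 2 first.
- by move=> l /=; rewrite in_fsetU => /orP[] h; [exact/D1S/FD1|exact/D2S/FD2].
- by move=> l; exact: measurable_ifT.
have F12E : perm_eq (F1 `|` F2)%fset (F1 ++ F2).
  apply: uniq_perm => [||l]; first exact: fset_uniq.
    rewrite cat_uniq !fset_uniq andbT/=; apply/hasPn => l l2.
    by apply/negP => l1; exact: (F12 l).
  by rewrite mem_cat in_fsetU.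
rewrite (perm_big _ F12E) big_cat/=.
rewrite ind//; last by apply: subset_trans FD1 _.
rewrite ind//; last by apply: subset_trans FD2 _.
congr (_ * _)%E; rewrite big_seq [RHS]big_seq; apply: eq_bigr => l lF.
- have lF1 : l \in F1 by [].
  rewrite lF1; case: ifPn => [lF2|_]; last by rewrite setIT.
  by have := F12 _ lF1 lF2.
- have lF2 : l \in F2 by [].
  rewrite lF2; case: ifPn => [lF1|_]; last by rewrite setTI.
  by have := F12 _ lF1 lF2.
Qed.

Notation sigT D := (g_sigma_algebraType (cyl D)).

Lemma cyl_measurable_fun D l : D l ->
  measurable_fun (setT : set (sigT D)) (xi l).
Proof.
move=> Dl _ A mA; rewrite setTI; apply: sub_sigma_algebra.
exists [fset l]%fset; split.
  by move=> l' /=; rewrite in_fset1 => /eqP ->.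
exists (fun=> A); split => //.
by apply/seteqP; split => w /= h; [move=> l' /=; rewrite in_fset1 => /eqP ->|
  by apply: (h l); rewrite /= in_fset1].
Qed.

Lemma indep2_cyl (D1 D2 : set L) (X Y : T -> R) : scalar_indep ->
  D1 `<=` S -> D2 `<=` S -> D1 `&` D2 = set0 ->
  measurable_fun (setT : set (sigT D1)) X ->
  measurable_fun (setT : set (sigT D2)) Y -> indep2 P X Y.
Proof.
move=> ind D1S D2S D12 mX mY A B mA mB.
apply: (indep_cyl ind D1S D2S D12).
  by rewrite -[X in <<s _ >> X]setTI; exact: mX.
by rewrite -[X in <<s _ >> X]setTI; exact: mY.
Qed.

End cyl.

(** * Sums of independent variables *)

Section indep_sums.
Context d (T : measurableType d) (R : realType) (P : probability T R).
Context (L : choiceType) (S : set L) (xi : L -> T -> R) (v : L -> R).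
Hypothesis mxi : forall l, measurable_fun setT (xi l).
Hypothesis ind : scalar_indep P S xi.
Hypothesis xi2 : forall l, S l -> P.-integrable setT (EFin \o (fun w => xi l w ^+ 2)).
Hypothesis xi_mean : forall l, S l -> \int[P]_w xi l w = 0.
Hypothesis xi_var : forall l, S l -> \int[P]_w (xi l w ^+ 2) = v l.

Notation sigT D := (g_sigma_algebraType (cyl xi D)).

Definition sumxi (r : seq L) (w : T) : R := \sum_(l <- r) xi l w.

Lemma sumxi_cyl_measurable (D : set L) (r : seq L) : {in r, forall l, D l} ->
  measurable_fun (setT : set (sigT D)) (sumxi r).
Proof.
elim: r => [|l r IH] rD.
  by rewrite (_ : sumxi [::] = cst 0)//; apply/funext => w; rewrite /sumxi big_nil.
rewrite (_ : sumxi (l :: r) = (fun w => xi l w + sumxi r w)); last first.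
  by apply/funext => w; rewrite /sumxi big_cons.
apply: measurable_funD.
  by apply: cyl_measurable_fun => //; apply: rD; rewrite mem_head.
by apply: IH => l' l'r; apply: rD; rewrite in_cons l'r orbT.
Qed.

Lemma measurable_sumxi (r : seq L) : measurable_fun setT (sumxi r).
Proof. by apply: measurable_sum. Qed.

Let mem_set_disj (r1 r2 : seq L) : uniq (r1 ++ r2) ->
  [set` r1] `&` [set` r2] = set0.
Proof.
rewrite cat_uniq => /and3P[_ /hasPn r12 _].
by apply/seteqP; split => // l [/= l1 l2]; have := r12 _ l2; rewrite /= l1.
Qed.

Lemma indep2_sumxi (r1 r2 : seq L) : {in r1 ++ r2, forall l, S l} ->
  uniq (r1 ++ r2) -> indep2 P (sumxi r1) (sumxi r2).
Proof.
move=> rS u; apply: (indep2_cyl mxi ind _ _ (mem_set_disj u)).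
- by move=> l /= lr; apply: rS; rewrite mem_cat lr.
- by move=> l /= lr; apply: rS; rewrite mem_cat lr orbT.
- exact: sumxi_cyl_measurable.
- exact: sumxi_cyl_measurable.
Qed.

Lemma sumxi1 l : sumxi [:: l] = xi l.
Proof. by apply/funext => w; rewrite /sumxi big_seq1. Qed.

Lemma sumxi_cons l r w : sumxi (l :: r) w = xi l w + sumxi r w.
Proof. by rewrite /sumxi big_cons. Qed.

Lemma sumxi_moments (r : seq L) : {in r, forall l, S l} -> uniq r ->
  [/\ P.-integrable setT (EFin \o (fun w => sumxi r w ^+ 2)),
      \int[P]_w sumxi r w = 0 &
      \int[P]_w (sumxi r w ^+ 2) = \sum_(l <- r) v l].
Proof.
elim: r => [|l r IH] rS u.
  have s0 : sumxi [::] = cst 0 by apply/funext => w; rewrite /sumxi big_nil.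
  rewrite big_nil; split.
  - have := finite_measure_integrable_cst P (0 : R) measurableT.
    by apply: eq_integrable => // w _; rewrite s0 /= expr0n.
  - by rewrite s0 Rintegral_cst_prob.
  - by under eq_Rintegral do rewrite s0 expr0n; rewrite Rintegral_cst_prob.
have rS' : {in r, forall l, S l} by move=> l' l'r; apply: rS; rewrite in_cons l'r orbT.
have lS : S l by apply: rS; rewrite mem_head.
have [i2 e1 e2] : [/\ P.-integrable setT (EFin \o (fun w => sumxi r w ^+ 2)),
      \int[P]_w sumxi r w = 0 & \int[P]_w (sumxi r w ^+ 2) = \sum_(l <- r) v l].
  by apply: IH => //; case/andP: u.
have ilr : indep2 P (xi l) (sumxi r) by rewrite -sumxi1; exact: indep2_sumxi.
have [ip ep] := indep2_expectation_prod (mxi l) (measurable_sumxi r) ilr (xi2 lS) i2.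
rewrite xi_mean// mul0r in ep.
have iA := integrable_lin 1 1 (xi2 lS) (integrable_lin 2 1 ip i2).
have E w : sumxi (l :: r) w ^+ 2 =
  1 * xi l w ^+ 2 + 1 * (2 * (xi l w * sumxi r w) + 1 * sumxi r w ^+ 2).
  by rewrite sumxi_cons; ring.
have ixl := integrable_sqrW (mxi l) (xi2 lS).
have isr := integrable_sqrW (measurable_sumxi r) i2.
split.
- by apply: eq_integrable iA => // w _ /=; rewrite E.
- under eq_Rintegral do rewrite sumxi_cons.
  by rewrite RintegralD// xi_mean// e1 addr0.
- under eq_Rintegral do rewrite E.
  rewrite (Rintegral_lin 1 1 (xi2 lS) (integrable_lin 2 1 ip i2)).
  rewrite (Rintegral_lin 2 1 ip i2) xi_var// ep e2 big_cons; ring.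
Qed.

Lemma measurable_norm_gt d0 (T0 : measurableType d0) (f : T0 -> R) (x : R) :
  measurable_fun setT f -> measurable [set w | x < `|f w|].
Proof.
move=> mf; have mn : measurable_fun setT (fun w => `|f w|) by exact: measurableT_comp.
rewrite (_ : [set w | _] = (fun w => `|f w|) @^-1` `]x, +oo[%classic); last first.
  by apply/seteqP; split => w /=; rewrite in_itv/= andbT.
by rewrite -[X in measurable X]setTI; apply: mn => //; exact: measurable_itv.
Qed.

Lemma chebyshev_second_moment (f : T -> R) (x : R) : 0 < x -> measurable_fun setT f ->
  P.-integrable setT (EFin \o (fun w => f w ^+ 2)) ->
  (P [set w | (x < `|f w|)%R] <= ((\int[P]_w (f w ^+ 2)) / x ^+ 2)%:E)%E.
Proof.
move=> x0 mf i2.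
have mE : measurable [set w | x < `|f w|] by exact: measurable_norm_gt.
rewrite -[leLHS]mul1e -integral_cst// integral_mkcond.
rewrite mulrC EFinM fineK; last exact: integrable_fin_num i2.
rewrite -integralZl//; apply: ge0_le_integral => //.
- by move=> w wT; apply: erestrict_ge0.
- apply/measurable_restrict => //.
- by apply: emeasurable_funM => //; case/integrableP : i2.
move=> w _; rewrite patchE -EFinM; case: ifPn => [/set_mem /= xw|_]; rewrite lee_fin.
  rewrite mulrC ler_pdivlMr ?exprn_gt0// mul1r -(real_normK (num_real (f w))).
  by rewrite ler_sqr ?nnegrE ?(ltW x0) ?(ltW xw).
by rewrite mulr_ge0 ?invr_ge0 ?sqr_ge0.
Qed.

(* The semigroup property of gauss_avg allows exchanging one summand at a time
   for a centred Gaussian of the same variance. *)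
Lemma sumxi_lindeberg (K K' C x : R) (s : L -> R) (g : R -> R) (r : seq L) :
  0 <= K -> 0 <= K' -> continuous g -> (forall y, `|g y| <= C) ->
  taylor2_class K K' g -> {in r, forall l, S l} -> uniq r ->
  (forall l, 0 <= s l) -> (forall l, S l -> v l = s l ^+ 2) ->
  `|\int[P]_w g (x + sumxi r w) -
     gauss_avg (Num.sqrt (\sum_(l <- r) s l ^+ 2)) g x| <=
  \sum_(l <- r) (taylor2_err P K K' (xi l) +
                 taylor2_err (@normal_prob R 0 1) K K' (fun z => s l * z)).
Proof.
move=> K0 K'0 cg gC tg + + s0 vs.
have mg : measurable_fun setT g by exact: continuous_measurable_fun.
elim: r x => [|l r IH] x rS u.
  rewrite !big_nil sqrtr0 gauss_avg0.
  under eq_Rintegral do rewrite /sumxi big_nil addr0.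
  by rewrite Rintegral_cst_prob subrr normr0.
have rS' : {in r, forall l, S l} by move=> l' l'r; apply: rS; rewrite in_cons l'r orbT.
have lS : S l by apply: rS; rewrite mem_head.
have ur : uniq r by case/andP: u.
set sr := Num.sqrt (\sum_(l <- r) s l ^+ 2).
have sr0 : 0 <= sr by exact: sqrtr_ge0.
have sr2 : sr ^+ 2 = \sum_(l <- r) s l ^+ 2.
  by rewrite sqr_sqrtr// sumr_ge0// => i _; exact: sqr_ge0.
rewrite !big_cons -sr2 -(gauss_avg_semigroup x (s0 l) sr0 cg gC).
pose A y := \int[P]_w g (y + sumxi r w).
have mA : measurable_fun setT A.
  exact: (measurable_shift_avg P (measurable_sumxi r) mg gC).
have mgy y : measurable_fun setT (fun w => g (y + sumxi r w)).
  by apply: (measurableT_comp mg); apply: measurable_funD => //; exact: measurable_sumxi.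
have AC y : `|A y| <= C.
  exact: (le_normr_Rintegral_bound P (mgy y) (fun w => gC (y + sumxi r w))).
have ilr : indep2 P (xi l) (sumxi r) by rewrite -sumxi1; exact: indep2_sumxi.
have LE : \int[P]_w g (x + sumxi (l :: r) w) = \int[P]_w A (x + xi l w).
  congr fine.
  transitivity (\int[P]_w (g (x + xi l w + sumxi r w))%:E)%E.
    by apply: eq_integral => w _; rewrite sumxi_cons addrA.
  rewrite (@indep2_integral _ _ _ P _ _ (mxi l) (measurable_sumxi r) ilr
    (fun ab => g (x + ab.1 + ab.2))).
  - apply: eq_integral => w _; rewrite fineK//.
    exact: integrable_fin_num (bounded_integrable P (mgy _) (fun w' => gC _)).
  - apply: (measurableT_comp mg); apply: measurable_funD; last exact: measurable_snd.
    by apply: measurable_funD => //; exact: measurable_fst.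
  - apply: (@bounded_integrable _ _ _ P _ C) => //.
    apply: (measurableT_comp mg); apply: measurable_funD; last exact: measurable_sumxi.
    by apply: measurable_funD => //; exact: mxi.
rewrite {}LE.
set B := gauss_avg sr g.
have mB : measurable_fun setT B := measurable_gauss_avg sr mg gC.
have BC y : `|B y| <= C := gauss_avg_le sr y mg gC.
have tB : taylor2_class K K' B := taylor2_class_gauss_avg sr mg gC tg.
have mx : measurable_fun setT (fun w => x + xi l w).
  by apply: measurable_funD => //; exact: mxi.
have iAx : P.-integrable setT (EFin \o (fun w => A (x + xi l w))).
  by apply: (bounded_integrable P _ (fun w => AC _)); exact: (measurableT_comp mA).
have iBx : P.-integrable setT (EFin \o (fun w => B (x + xi l w))).
  by apply: (bounded_integrable P _ (fun w => BC _)); exact: (measurableT_comp mB).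
(* The difference of [A] and [B] is the induction hypothesis at the shifted base point, whence the
   generality in [x]; what remains is one exchange for the test function [B]. *)
apply: le_trans (ler_distD (\int[P]_w B (x + xi l w)) _ _) _.
rewrite [leRHS]addrC; apply: lerD.
  rewrite -RintegralB//.
  apply: le_normr_Rintegral_bound => [|w]; last exact: IH.
  by apply: measurable_funB; [exact: (measurableT_comp mA)|exact: (measurableT_comp mB)].
apply: (taylor2_compare x K0 K'0 mB BC tB) => //; first exact: xi2.
  exact: xi_mean.
by rewrite xi_var// vs.
Qed.

(* On the first passage of the partial sums above 2x, the remaining sum is
   independent of the past and at most x with probability at least 1/2. *)
Lemma ottaviani (r : seq L) (x : R) : 0 < x -> {in r, forall l, S l} -> uniq r ->
  \sum_(l <- r) v l <= x ^+ 2 / 2 ->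
  measurable [set w | exists k, 2 * x < `|sumxi (take k r) w|] /\
  (P [set w | exists k, (2 * x < `|sumxi (take k r) w|)%R] <=
   (2 * ((\sum_(l <- r) v l) / x ^+ 2))%:E)%E.
Proof.
move=> x0 rS u vx.
pose E k := [set w | 2 * x < `|sumxi (take k r) w|].
(* The disjoint pieces [A k] are the first-passage events; for [k] beyond the length of [r] the sums
   are constant and [A k] is empty. *)
pose A := seqDU E.
pose D k : set L := [set` take k r].
pose B k := [set w | `|sumxi (drop k r) w| <= x].
have BE k : B k = ~` [set w | x < `|sumxi (drop k r) w|].
  by apply/seteqP; split => w /=; rewrite /B/= leNgt => /negP.
have tS k : {in take k r, forall l, S l} by move=> l /mem_take; exact: rS.
have dS k : {in drop k r, forall l, S l} by move=> l /mem_drop; exact: rS.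
have mEs k i : (i <= k)%N -> measurable (E i : set (sigT (D k))).
  move=> ik; apply: measurable_norm_gt; apply: sumxi_cyl_measurable => l.
  by rewrite /D /= -(take_takel _ ik) => /mem_take.
(* First passage at [k] is decided by the first [k] summands, which makes it independent of
   [B k]. *)
have mAs k : measurable (A k : set (sigT (D k))).
  apply: measurableD; first exact: mEs.
  by apply: bigsetU_measurable => i _; apply: mEs; exact/ltnW.
have mBs k : measurable (B k : set (sigT [set` drop k r])).
  rewrite BE; apply: measurableC; apply: measurable_norm_gt.
  exact: sumxi_cyl_measurable.
have mE k : measurable (E k) by apply: measurable_norm_gt; exact: measurable_sumxi.
have mB k : measurable (B k).
  by rewrite BE; apply: measurableC; apply: measurable_norm_gt; exact: measurable_sumxi.
have mA k : measurable (A k).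
  by apply: measurableD => //; apply: bigsetU_measurable.
have AE : [set w | exists k, 2 * x < `|sumxi (take k r) w|] = \bigcup_k A k.
  rewrite -seqDU_bigcup_eq; apply/seteqP; split => w /=.
    by move=> [k h]; exists k.
  by move=> [k _ h]; exists k.
have v0 l : S l -> 0 <= v l.
  by move=> Sl; rewrite -xi_var//; apply: Rintegral_ge0 => w _; exact: sqr_ge0.
have dv k : \sum_(l <- drop k r) v l <= \sum_(l <- r) v l.
  rewrite -[X in _ <= \sum_(l <- X) _](cat_take_drop k r) big_cat/= lerDr.
  by rewrite big_seq; apply: sumr_ge0 => l lr; apply: v0; exact: (tS k).
have PB k : ((2^-1)%:E <= P (B k))%E.
  rewrite BE probability_setC; last by apply: measurable_norm_gt; exact: measurable_sumxi.
  have [i2 _ e2] := sumxi_moments (dS k) (drop_uniq k u).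
  have := chebyshev_second_moment x0 (measurable_sumxi _) i2; rewrite e2 => h.
  have {}h : (P [set w | (x < `|sumxi (drop k r) w|)%R] <= (2^-1)%:E)%E.
    apply: (le_trans h); rewrite lee_fin ler_pdivrMr ?exprn_gt0//.
    by rewrite (le_trans (dv k))// mulrC.
  rewrite (_ : (2^-1)%:E = 1 - (2^-1)%:E)%E; first exact: leeB.
  by rewrite -EFinB; congr EFin; field.
have AB k : P (A k `&` B k) = (P (A k) * P (B k))%E.
  apply: (indep_cyl mxi ind (D1 := D k) (D2 := [set` drop k r])) => //.
  - by move=> l; exact: tS.
  - by move=> l; exact: dS.
  - by apply: mem_set_disj; rewrite cat_take_drop.
  - exact: mAs.
  - exact: mBs.
have [i2 _ e2] := sumxi_moments rS u.
have cheb := chebyshev_second_moment x0 (measurable_sumxi r) i2; rewrite e2 in cheb.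
rewrite AE; split; first exact: bigcup_measurable.
have tA : trivIset setT A by exact: trivIset_seqDU.
have bigE (F : (set T)^nat) : (forall k, measurable (F k)) -> trivIset setT F ->
    P (\bigcup_k F k) = (\sum_(0 <= k <oo) P (F k))%E.
  move=> mF tF; rewrite measure_bigcup//=.
  by apply: eq_eseriesl => k; rewrite in_setT.
(* Since [P (B k)] is at least 1/2, passing to the intersection with [B k] costs a factor 2. On each
   intersection the full sum exceeds [2 * x - x], so Chebyshev's bound for the full sum applies to
   the union. *)
rewrite bigE//; apply: (@le_trans _ _ (\sum_(0 <= k <oo) (2%:E * P (A k `&` B k))))%E.
  apply: lee_nneseries => [k _|k _]; first by [].
  rewrite AB muleCA -[leLHS]mule1; apply: lee_pmul => //.
  rewrite (_ : 1%E = 2%:E * (2^-1)%:E)%E; last by rewrite -EFinM divff.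
  by apply: lee_pmul => //; rewrite lee_fin.
rewrite nneseriesZl//.
rewrite -bigE; last 2 first.
- by move=> k; exact: measurableI.
- exact: trivIset_setIr.
rewrite EFinM; apply: lee_pmul => //.
apply: le_trans cheb; apply: le_measure.
- by apply/mem_set; apply: bigcup_measurable => k _; exact: measurableI.
- by apply/mem_set; apply: measurable_norm_gt; exact: measurable_sumxi.
move=> w [k _ [[Ek _] Bk]] /=.
move: Ek Bk; rewrite /E /B /= => Ek Bk.
have -> : sumxi r w = sumxi (take k r) w + sumxi (drop k r) w.
  by rewrite /sumxi -big_cat/= cat_take_drop.
have := lerB_normD (sumxi (take k r) w) (sumxi (drop k r) w).
lra.
Qed.

End indep_sums.

(** * Mollification *)

Section mollify.
Variable R : realType.
Notation mu := (@lebesgue_measure R).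
Implicit Types (f F g : R -> R) (x h : R).

Lemma is_derive_continuous F f : (forall x : R, is_derive x 1 F (f x)) ->
  continuous F.
Proof.
move=> dF x; apply/differentiable_continuous/derivable1_diffP; exact: ex_derive.
Qed.

(** Both signs of [h] are covered. The bound on [c - x] serves Taylor remainders; the one-sided
    location of [c] serves the mollification. *)
Lemma is_derive_mean_value F f x h : (forall x : R, is_derive x 1 F (f x)) ->
  exists c, [/\ F (x + h) - F x = f c * h, `|c - x| <= `|h| &
    0 <= h -> x <= c <= x + h].
Proof.
move=> dF; have cF := is_derive_continuous dF.
have mvt a b : a <= b -> exists c, [/\ F b - F a = f c * (b - a) & a <= c <= b].
  move=> ab; have [c cab e] := MVT_segment ab (fun x _ => dF x) (continuous_subspaceT cF).
  by exists c; split=> //; move: cab; rewrite in_itv.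
have [h0|h0] := leP 0 h.
- have [|c [e /andP[c1 c2]]] := mvt x (x + h); first by rewrite lerDl.
  exists c; split.
  + by rewrite e addrAC subrr add0r.
  + by rewrite !ger0_norm ?subr_ge0// lerBlDl.
  + by rewrite c1.
- have [|c [e /andP[c1 c2]]] := mvt (x + h) x; first by rewrite gerDl ltW.
  exists c; split.
  + by rewrite -opprB e; ring.
  + by rewrite ler0_norm ?subr_le0// ltr0_norm// lerN2 lerBrDl.
  + by [].
Qed.

(** The integrals from [- n], normalised to vanish at 0, agree for all [n] with [|x| <= n];
    [Num.bound] picks one such [n], and the local primitives glue. *)
Lemma continuous_primitive f : continuous f ->
  exists F, forall x : R, is_derive x 1 F (f x).
Proof.
move=> cf.
have intf (a b : R) : mu.-integrable `[a, b] (EFin \o f).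
  apply: continuous_compact_integrable; first exact: segment_compact.
  exact: continuous_subspaceT.
pose G (n : nat) (x : R) := \int[mu]_(t in `[- n%:R, x]) f t.
have GE (n m : nat) x : (n <= m)%N -> - n%:R <= x -> G m x = G m (- n%:R) + G n x.
  move=> nm nx; rewrite /G -[LHS](subrKC (\int[mu]_(t in `[- m%:R, - n%:R]) f t)).
  congr +%R; rewrite Rintegral_itvB//; last first.
    by rewrite bnd_simp lerN2 ler_nat.
  rewrite Rintegral_itv_obnd_cbnd//.
  by apply: integrableS (intf (- n%:R) x) => //; exact: subset_itv_oc_cc.
pose F x := G (Num.bound `|x|) x - G (Num.bound `|x|) 0.
have FE n x : `|x| <= n%:R -> F x = G n x - G n 0.
  move=> xn; rewrite /F.
  have H k l : (k <= l)%N -> `|x| <= k%:R -> G l x - G l 0 = G k x - G k 0.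
    move=> kl; rewrite ler_norml => /andP[kx _].
    rewrite (GE _ _ _ kl kx) (GE _ _ 0 kl) ?oppr_le0//; ring.
  have [nb|bn] := leqP n (Num.bound `|x|); first exact: H.
  by apply/esym/H; [exact/ltnW|exact/ltW/archi_boundP].
exists F => x.
pose n := (Num.bound `|x|).+1.
have xn : `|x| < n%:R by rewrite (lt_trans (archi_boundP _))// ltr_nat.
have [nx xn'] : - n%:R < x /\ x < n%:R by move: xn; rewrite ltr_norml => /andP[].
have [dG GE'] := continuous_FTC1_closed xn' (intf (- n%:R) n%:R) nx (cf x).
have dGn : is_derive x 1 (G n) (f x).
  by apply: DeriveDef; [exact: dG|rewrite -derive1E; exact: GE'].
apply: (@near_eq_is_derive _ _ _ (fun y => G n y - G n 0)).
  near=> y; apply/esym/FE; rewrite ltW//; near: y.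
  exact: (@cvgr_norm_lt _ _ _ _ _ id x).
have : is_derive x 1 (G n - cst (G n 0)) (f x - 0) by apply: is_deriveB.
by rewrite subr0.
Unshelve. all: by end_near. Qed.

Definition fdiff h f x : R := f (x + h) - f x.

Lemma is_derive_fdiff h F f : (forall x : R, is_derive x 1 F (f x)) ->
  forall x : R, is_derive x 1 (fdiff h F) (fdiff h f x).
Proof.
move=> dF x; apply: is_deriveB.
have d1 : is_derive x 1 (fun y : R => y + h) 1.
  have : is_derive x 1 ((@id R) + cst h) (1 + 0) by apply: is_deriveD.
  by rewrite addr0.
have := @is_derive1_comp _ F (fun y : R => y + h) x _ _ (dF (x + h)) d1.
by rewrite mulr1.
Qed.

Lemma fdiff_le h f M : (forall x, `|f x| <= M) -> forall x, `|fdiff h f x| <= 2 * M.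
Proof.
move=> fM x; rewrite (le_trans (ler_normB _ _))// mulrDl mul1r.
exact: lerD.
Qed.

(** The mean value theorem is applied to the remainder [phi], then to [g1]. The bound on [g2] gives
    the quadratic estimate, and one more application, to [g2], gives the cubic one. *)
Lemma taylor2_class_derive g g1 g2 g3 A B : continuous g3 ->
  (forall x : R, is_derive x 1 g (g1 x)) ->
  (forall x : R, is_derive x 1 g1 (g2 x)) ->
  (forall x : R, is_derive x 1 g2 (g3 x)) ->
  (forall x, `|g1 x| <= A) -> (forall x, `|g2 x| <= A) ->
  (forall x, `|g3 x| <= B) -> taylor2_class (2 * A) B g.
Proof.
move=> c3 d1 d2 d3 b1 b2 b3.
have A0 : 0 <= A by rewrite (le_trans _ (b1 0)).
exists A, g1, (fun x => 2^-1 * g2 x); split => //.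
- by apply: continuous_measurable_fun; exact: is_derive_continuous d2.
- apply: measurable_funM => //.
  by apply: continuous_measurable_fun; exact: is_derive_continuous d3.
- move=> x; rewrite normrM (le_trans _ (b2 x))// ler_piMl// ger0_norm ?invr_ge0//.
  by rewrite invf_le1// ler1n.
move=> x h.
pose phi y := g (x + y) - g x - g1 x * y - 2^-1 * g2 x * y ^+ 2.
have dphi (y : R) : is_derive y 1 phi (g1 (x + y) - g1 x - g2 x * y).
  have dg : is_derive y 1 (fun y : R => g (x + y)) (g1 (x + y)).
    have d0 : is_derive y 1 (fun y : R => x + y) 1.
      have : is_derive y 1 (cst x + (@id R)) (0 + 1) by apply: is_deriveD.
      by rewrite add0r.
    have := @is_derive1_comp _ g (fun y : R => x + y) y _ _ (d1 (x + y)) d0.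
    by rewrite mulr1.
  have dl : is_derive y 1 (g1 x \*: (@id R)) (g1 x *: 1) by exact: is_deriveZ.
  have dq : is_derive y 1 ((2^-1 * g2 x) \*: ((@id R) ^+ 2))
      ((2^-1 * g2 x) *: ((2%:R * y ^+ 1) *: 1)).
    by apply: is_deriveZ; exact: is_deriveX.
  have : is_derive y 1 ((fun y : R => g (x + y)) - cst (g x) - (g1 x \*: (@id R))
      - ((2^-1 * g2 x) \*: ((@id R) ^+ 2)))
      (g1 (x + y) - 0 - g1 x *: 1 - (2^-1 * g2 x) *: ((2%:R * y ^+ 1) *: 1)).
    by apply: is_deriveB; apply: is_deriveB; apply: is_deriveB.
  apply: is_derive_ext => [z|]; last by rewrite /GRing.scale/=; field.
  by rewrite /phi /GRing.scale/= !fctE.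
have phib y : `|g1 (x + y) - g1 x - g2 x * y| <= Num.min (2 * A * `|y|) (B * `|y| ^+ 2).
  have [c [-> cx _]] := is_derive_mean_value x y d2.
  rewrite -mulrBl normrM le_min; apply/andP; split.
    rewrite ler_wpM2r// (le_trans (ler_normB _ _))// mulrDl mul1r.
    exact: lerD.
  have [e [-> _ _]] : exists e, [/\ g2 c - g2 x = g3 e * (c - x), True & True].
    have := is_derive_mean_value x (c - x) d3.
    by rewrite (addrC x) subrK => -[e [-> _ _]]; exists e.
  rewrite normrM expr2 mulrA ler_wpM2r//.
  by apply: ler_pM.
have [c [e cx _]] := is_derive_mean_value 0 h dphi.
rewrite add0r subr0 in e cx.
have phi0 : phi 0 = 0 by rewrite /phi addr0 expr0n /=; ring.
have -> : g (x + h) - (g x + g1 x * h + 2^-1 * g2 x * h ^+ 2) = phi h - phi 0.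
  by rewrite phi0 /phi; ring.
have B0 : 0 <= B by rewrite (le_trans _ (b3 0)).
rewrite e normrM; have := phib c; rewrite !le_min => /andP[p1 p2].
apply/andP; split.
  rewrite -(real_normK (num_real h)) expr2 mulrA ler_wpM2r// (le_trans p1)//.
  by rewrite ler_wpM2l// mulr_ge0.
rewrite exprSr mulrA ler_wpM2r// (le_trans p2)//.
by rewrite ler_wpM2l// lerXn2r// nnegrE.
Qed.

(* g is h^-3 times the third difference, with step h, of a third primitive of f. *)
Lemma mollify f M h : continuous f -> (forall x, `|f x| <= M) -> 0 < h ->
  exists g K L, [/\ 0 <= K, 0 <= L, continuous g, taylor2_class K L g &
    forall x, exists y, [/\ x <= y, y <= x + h *+ 3 & g x = f y]].
Proof.
move=> cf fM h0.
have [F1 dF1] := continuous_primitive cf.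
have [F2 dF2] := continuous_primitive (is_derive_continuous dF1).
have [F3 dF3] := continuous_primitive (is_derive_continuous dF2).
have scale F F' (a : R) : (forall x : R, is_derive x 1 F (F' x)) ->
    forall x : R, is_derive x 1 (fun y => a * F y) (a * F' x).
  move=> dF x; have : is_derive x 1 (a \*: F) (a *: F' x) by exact: is_deriveZ.
  exact: is_derive_ext.
have mv F F' x : (forall x : R, is_derive x 1 F (F' x)) ->
    exists c, [/\ fdiff h F x = F' c * h, x <= c & c <= x + h].
  move=> dF; have [c [e _]] := is_derive_mean_value x h dF.
  by move=> /(_ (ltW h0)) /andP[c1 c2]; exists c.
have d1 F F' (dF : forall x : R, is_derive x 1 F (F' x)) := is_derive_fdiff h dF.
have D2F1 x : exists c, fdiff h (fdiff h (fdiff h F1)) x = fdiff h (fdiff h f) c * h.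
  by have [c [-> _ _]] := mv _ _ x (d1 _ _ (d1 _ _ dF1)); exists c.
have D2F2 x : exists c, fdiff h (fdiff h (fdiff h F2)) x = fdiff h f c * h * h.
  have [c [-> _ _]] := mv _ _ x (d1 _ _ (d1 _ _ dF2)).
  by have [c' [-> _ _]] := mv _ _ c (d1 _ _ dF1); exists c'.
pose D3 F := fdiff h (fdiff h (fdiff h F)).
have dD3 F F' (dF : forall x : R, is_derive x 1 F (F' x)) :
  forall x : R, is_derive x 1 (fun y => h ^- 3 * D3 F y) (h ^- 3 * D3 F' x).
  by apply: scale; apply: d1; apply: d1; apply: d1.
have M0 : 0 <= M by rewrite (le_trans _ (fM 0)).
(* A common bound for the first two derivatives of [g]: a third difference of [F1] is [h] times a
   second difference of [f], at most [4 * M], and one of [F2] is [h ^ 2] times a first difference,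
   at most [2 * M]. *)
pose A := h ^- 3 * (4 * M * h) + h ^- 3 * (2 * M * h * h).
have hi3 : 0 <= h ^- 3 by rewrite invr_ge0 exprn_ge0// ltW.
have t1 : 0 <= h ^- 3 * (4 * M * h) by rewrite !mulr_ge0// ltW.
have t2 : 0 <= h ^- 3 * (2 * M * h * h) by rewrite !mulr_ge0// ltW.
have A0 : 0 <= A by rewrite addr_ge0.
exists (fun y => h ^- 3 * D3 F3 y), (2 * A), (h ^- 3 * (8 * M)); split.
- by rewrite mulr_ge0.
- by rewrite !mulr_ge0.
- exact: is_derive_continuous (dD3 _ _ dF3).
- apply: (taylor2_class_derive _ (dD3 _ _ dF3) (dD3 _ _ dF2) (dD3 _ _ dF1)).
  + have cfd F : continuous F -> continuous (fdiff h F).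
      move=> cF y; apply: cvgB; last exact: cF.
      apply: (@continuous_comp _ _ _ (fun y => y + h) F); last exact: cF.
      by apply: cvgD; [exact: cvg_id|exact: cvg_cst].
    move=> y; apply: cvgM; first exact: cvg_cst.
    by apply: (cfd _ (cfd _ (cfd _ cf))).
  + move=> x; have [c] := D2F2 x; rewrite /D3 => ->.
    rewrite normrM ger0_norm// (@le_trans _ _ (h ^- 3 * (2 * M * h * h)))//; last first.
      by rewrite /A lerDr.
    rewrite ler_wpM2l// !normrM (ger0_norm (ltW h0)) !ler_wpM2r ?(ltW h0)//.
    exact: fdiff_le.
  + move=> x; have [c] := D2F1 x; rewrite /D3 => ->.
    rewrite normrM ger0_norm// (@le_trans _ _ (h ^- 3 * (4 * M * h)))//; last first.
      by rewrite /A lerDl.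
    rewrite ler_wpM2l// !normrM (ger0_norm (ltW h0)) ler_wpM2r ?(ltW h0)//.
    rewrite (_ : 4 * M = 2 * (2 * M)); last by ring.
    by apply: fdiff_le; exact: fdiff_le.
  + move=> x; rewrite normrM ger0_norm// ler_wpM2l// /D3.
    rewrite (_ : 8 * M = 2 * (2 * (2 * M))); last by ring.
    by apply: fdiff_le; apply: fdiff_le; exact: fdiff_le.
move=> x.
(* Each difference is traded for [h] times a derivative at a point at most [h] further to the right,
   so the three of them end within [3 * h] of [x]. *)
have [c1 [e1 l1 u1]] := mv _ _ x (d1 _ _ (d1 _ _ dF3)).
have [c2 [e2 l2 u2]] := mv _ _ c1 (d1 _ _ dF2).
have [c3 [e3 l3 u3]] := mv _ _ c2 dF1.
exists c3; split.
- by rewrite (le_trans l1)// (le_trans l2).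
- by rewrite !mulrS mulr0n addr0; move: u1 u2 u3; lra.
- by rewrite /D3 e1 e2 e3; field; rewrite gt_eqF.
Qed.

End mollify.

(** * Quadratic forms and duality *)

Section quadratic_forms.
Variable R : realType.

Definition dotv n (u v : 'cV[R]_n) : R := (u^T *m v) 0 0.

Definition sqnorm n (v : 'cV[R]_n) : R := \sum_i v i 0 ^+ 2.

Lemma dotvE n (u v : 'cV[R]_n) : dotv u v = \sum_i u i 0 * v i 0.
Proof. by rewrite /dotv mxE; apply: eq_bigr => i _; rewrite mxE. Qed.

Lemma dotvC n (u v : 'cV[R]_n) : dotv u v = dotv v u.
Proof. by rewrite !dotvE; apply: eq_bigr => i _; rewrite mulrC. Qed.

Lemma dotvDl n (u u' v : 'cV[R]_n) : dotv (u + u') v = dotv u v + dotv u' v.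
Proof. by rewrite /dotv linearD/= mulmxDl mxE. Qed.

Lemma dotvDr n (u v v' : 'cV[R]_n) : dotv u (v + v') = dotv u v + dotv u v'.
Proof. by rewrite /dotv mulmxDr mxE. Qed.

Lemma dotvZl n c (u v : 'cV[R]_n) : dotv (c *: u) v = c * dotv u v.
Proof. by rewrite /dotv linearZ/= -scalemxAl mxE. Qed.

Lemma dotvZr n c (u v : 'cV[R]_n) : dotv u (c *: v) = c * dotv u v.
Proof. by rewrite /dotv -scalemxAr mxE. Qed.

Lemma dotvNr n (u v : 'cV[R]_n) : dotv u (- v) = - dotv u v.
Proof. by rewrite -scaleN1r dotvZr mulN1r. Qed.

Lemma dotv_mull m n (A : 'M[R]_(m, n)) u v : dotv (A *m u) v = dotv u (A^T *m v).
Proof. by rewrite /dotv trmx_mul mulmxA. Qed.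

Lemma dotv_suml n (I : finType) (p : pred I) (F : I -> 'cV[R]_n) v :
  dotv (\sum_(i | p i) F i) v = \sum_(i | p i) dotv (F i) v.
Proof. by rewrite /dotv linear_sum/= mulmx_suml summxE. Qed.

Lemma dotvv n (v : 'cV[R]_n) : dotv v v = sqnorm v.
Proof. by rewrite dotvE. Qed.

Lemma sqnorm_ge0 n (v : 'cV[R]_n) : 0 <= sqnorm v.
Proof. by apply: sumr_ge0 => i _; exact: sqr_ge0. Qed.

Lemma sqnorm_entry n (v : 'cV[R]_n) i : v i 0 ^+ 2 <= sqnorm v.
Proof.
by rewrite /sqnorm (bigD1 i)//= lerDl; apply: sumr_ge0 => j _; exact: sqr_ge0.
Qed.

Lemma sqnorm_eq0 n (v : 'cV[R]_n) : sqnorm v = 0 -> v = 0.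
Proof.
move=> v0; apply/matrixP => i j; rewrite ord1 mxE; apply/eqP.
by rewrite -sqrf_eq0 eq_le sqr_ge0 andbT -v0 sqnorm_entry.
Qed.

Lemma quadfE n (A : 'M[R]_n) v : quadf A v = dotv v (A *m v).
Proof. by rewrite /quadf /dotv mulmxA. Qed.

Lemma quadfZ n (A : 'M[R]_n) c v : quadf A (c *: v) = c ^+ 2 * quadf A v.
Proof. by rewrite !quadfE -scalemxAr dotvZl dotvZr mulrA. Qed.

Lemma quadf0 n (A : 'M[R]_n) : quadf A 0 = 0.
Proof. by rewrite quadfE mulmx0 /dotv mulmx0 mxE. Qed.

Lemma quadfD n (A : 'M[R]_n) u v : A^T = A ->
  quadf A (u + v) = quadf A u + 2 * dotv u (A *m v) + quadf A v.
Proof.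
move=> As; rewrite !quadfE mulmxDr !dotvDl !dotvDr.
have -> : dotv v (A *m u) = dotv u (A *m v) by rewrite dotvC dotv_mull As.
ring.
Qed.

Lemma posdef_ge0 n (A : 'M[R]_n) v : posdef A -> 0 <= quadf A v.
Proof.
move=> [_ Ap]; have [->|v0] := eqVneq v 0; first by rewrite quadf0.
exact/ltW/Ap.
Qed.

Lemma posdef_unitmx n (A : 'M[R]_n) : posdef A -> A \in unitmx.
Proof.
move=> [As Ap]; rewrite unitmxE unitfE; apply/negP => /det0P[v v0 vA].
have : 0 < quadf A v^T by apply: Ap; rewrite trmx_eq0.
by rewrite /quadf trmxK vA mul0mx mxE ltxx.
Qed.

Lemma posdef_invmx n (A : 'M[R]_n) : posdef A -> posdef (invmx A).
Proof.
move=> Ap; have Au := posdef_unitmx Ap; have [As _] := Ap.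
split=> [|v v0]; first by rewrite trmx_inv As.
have -> : quadf (invmx A) v = quadf A (invmx A *m v).
  by rewrite !quadfE mulmxA mulmxV// mul1mx dotvC.
apply: Ap.2; apply: contra_neq v0 => v0.
by rewrite -(mul1mx v) -(mulmxV Au) -mulmxA v0 mulmx0.
Qed.

Lemma cauchy_schwarz_quadf n (A : 'M[R]_n) u v : A^T = A ->
  (forall x, 0 <= quadf A x) ->
  dotv u (A *m v) ^+ 2 <= quadf A u * quadf A v.
Proof.
move=> As Ap; set b := dotv u (A *m v).
have H t : 0 <= quadf A u + 2 * t * b + t ^+ 2 * quadf A v.
  have := Ap (u + t *: v); rewrite quadfD// quadfZ -scalemxAr dotvZr -/b.
  by rewrite mulrA.
(* The form may be degenerate. If it vanishes at [v], the expression in [H] is affine in [t], and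
   nonnegativity forces its slope to be 0. *)
have [v0|v0] := eqVneq (quadf A v) 0.
  have b0 : b = 0.
    apply/eqP/negPn/negP => b0.
    have := H (- (quadf A u + 1) / (2 * b)); rewrite v0.
    have -> : 2 * (- (quadf A u + 1) / (2 * b)) * b = - (quadf A u + 1) by field.
    lra.
  by rewrite b0 v0 expr0n mulr0.
have vp : 0 < quadf A v by rewrite lt0r v0 Ap.
have := H (- b / quadf A v).
have -> : quadf A u + 2 * (- b / quadf A v) * b + (- b / quadf A v) ^+ 2 * quadf A v
   = quadf A u - b ^+ 2 / quadf A v by field.
by rewrite subr_ge0 ler_pdivrMr.
Qed.

Definition sumabs n (A : 'M[R]_n) : R := \sum_i \sum_j `|A i j|.

Lemma sumabs_ge0 n (A : 'M[R]_n) : 0 <= sumabs A.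
Proof. by apply: sumr_ge0 => i _; exact: sumr_ge0. Qed.

Lemma quadf_sumabs n (A : 'M[R]_n) v : `|quadf A v| <= sumabs A * sqnorm v.
Proof.
rewrite quadfE dotvE (le_trans (ler_norm_sum _ _ _))// mulr_suml.
apply: ler_sum => i _; rewrite mxE mulr_sumr (le_trans (ler_norm_sum _ _ _))//.
rewrite mulr_suml; apply: ler_sum => j _.
rewrite mulrCA !normrM ler_wpM2l// -normrM.
have := sqnorm_entry v i; have := sqnorm_entry v j.
have := sqr_ge0 (v i 0 - v j 0); have := sqr_ge0 (v i 0 + v j 0).
have := sqnorm_ge0 v; rewrite ler_norml; nra.
Qed.

(** Cauchy-Schwarz at [v] and [invmx A *m v] gives [sqnorm v ^ 2 <= quadf A v * quadf (invmx A) v],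
    and the last factor is at most [sumabs (invmx A) * sqnorm v]. The added 1 keeps the constant
    meaningful in dimension 0. *)
Lemma posdef_lower n (A : 'M[R]_n) : posdef A ->
  exists2 c, 0 < c & forall v, c * sqnorm v <= quadf A v.
Proof.
move=> Ap; have Au := posdef_unitmx Ap; have Aip := posdef_invmx Ap.
exists (sumabs (invmx A) + 1)^-1.
  by rewrite invr_gt0 ltr_wpDl ?sumabs_ge0.
move=> v; have s0 : 0 < sumabs (invmx A) + 1 by rewrite ltr_wpDl ?sumabs_ge0.
rewrite mulrC ler_pdivrMr//.
have [v0|v0] := eqVneq (sqnorm v) 0.
  by rewrite v0 mulr_ge0 ?posdef_ge0// ltW.
have vp : 0 < sqnorm v by rewrite lt0r v0 sqnorm_ge0.
have cs := @cauchy_schwarz_quadf _ A v (invmx A *m v) Ap.1 (fun x => posdef_ge0 x Ap).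
rewrite mulmxA mulmxV// mul1mx dotvv in cs.
have e : quadf A (invmx A *m v) = quadf (invmx A) v.
  by rewrite !quadfE mulmxA mulmxV// mul1mx dotvC.
have := quadf_sumabs (invmx A) v; rewrite e in cs.
rewrite ger0_norm ?posdef_ge0// => h.
have qA := posdef_ge0 v Ap.
rewrite -(ler_pM2l vp) -expr2 (le_trans cs)// mulrCA ler_wpM2l//.
by rewrite (le_trans h)// mulrC mulrDr mulr1 lerDl ltW.
Qed.

Lemma row_free_gram_unit m n (B : 'M[R]_(m, n)) : row_free B ->
  B *m B^T \in unitmx.
Proof.
move=> fB; rewrite unitmxE unitfE; apply/negP => /det0P[v v0 vB].
have : sqnorm (v *m B)^T = 0.
  rewrite -dotvv /dotv trmxK trmx_mul mulmxA -(mulmxA v) vB mul0mx mxE//.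
move=> /sqnorm_eq0/(congr1 trmx); rewrite trmxK trmx0 => vB0.
by move/eqP: vB0; rewrite mulmx_free_eq0// (negPf v0).
Qed.

(** Full-rank factorisation [A = C B]; the pseudo-inverse is then [B^T (B B^T)^-1 (C^T C)^-1 C^T],
    with invertible Gram matrices. *)
Lemma MP_inverse_exists n (A : 'M[R]_n) : exists G, is_MP_inverse A G.
Proof.
have [r [C [B [AE fC fB]]]] : exists r (C : 'M[R]_(n, r)) (B : 'M[R]_(r, n)),
    [/\ A = C *m B, row_free C^T & row_free B].
  exists (\rank A), (col_base A), (row_base A); split.
  - by rewrite mulmx_base.
  - by rewrite /row_free mxrank_tr; exact: col_base_full.
  - exact: row_base_free.
have Bu : B *m B^T \in unitmx by exact: row_free_gram_unit.
have Cu : C^T *m C \in unitmx by rewrite -{2}(trmxK C); exact: row_free_gram_unit.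
pose iB := invmx (B *m B^T); pose iC := invmx (C^T *m C).
have iBs : iB^T = iB by rewrite trmx_inv trmx_mul trmxK.
have iCs : iC^T = iC by rewrite trmx_inv trmx_mul trmxK.
have BB : B *m B^T *m iB = 1%:M by exact: mulmxV.
have CC : iC *m (C^T *m C) = 1%:M by exact: mulVmx.
pose G := B^T *m iB *m iC *m C^T.
have AG : A *m G = C *m iC *m C^T.
  rewrite AE /G !mulmxA -(mulmxA C B) -(mulmxA C (B *m B^T)) BB.
  by rewrite mulmx1.
have GA : G *m A = B^T *m iB *m B.
  rewrite AE /G !mulmxA -(mulmxA _ C^T) -(mulmxA _ iC) CC.
  by rewrite mulmx1.
exists G; split.
- by rewrite AG AE !mulmxA -(mulmxA _ C^T) -(mulmxA _ iC) CC mulmx1.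
- by rewrite GA /G !mulmxA -(mulmxA _ B) -(mulmxA _ (B *m _)) BB mulmx1.
- by rewrite AG !trmx_mul trmxK iCs mulmxA.
- by rewrite GA !trmx_mul trmxK iBs mulmxA.
Qed.

(** For [a = M w] the identity [M M^+ M = M] collapses [w^T M M^+ M w] to [w^T M w]. The
    pseudo-inverse is thereby replaced by any solution [w] of the linear system. *)
Lemma quadf_pinv n (M : 'M[R]_n) (w a : 'cV[R]_n) : M^T = M -> M *m w = a ->
  quadf (Defs.pinv M) a = dotv a w.
Proof.
move=> Ms <-; have [MGM _ _ _] : is_MP_inverse M (Defs.pinv M).
  by have [G hG] := MP_inverse_exists M; exact: (xgetPex 0 (ex_intro _ G hG)).
by rewrite quadfE dotv_mull Ms !mulmxA MGM dotv_mull Ms.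
Qed.

End quadratic_forms.

(** * Coordinate projections and principal submatrices *)

Section projections.
Variables (R : realType) (k : nat).
Implicit Types (I : {set 'I_k}) (w : 'cV[R]_k) (A : 'M[R]_k).

Lemma projI_mulmxE I w i : (projI R I *m w) i 0 = w (enum_val i) 0.
Proof.
rewrite mxE (bigD1 (enum_val i))//= mxE eqxx mul1r big1 ?addr0// => j ji.
by rewrite mxE (negPf ji) mul0r.
Qed.

Lemma trmx_projI_mulmxE I (v : 'cV[R]_#|I|) (i : 'I_#|I|) :
  ((projI R I)^T *m v) (enum_val i) 0 = v i 0.
Proof.
rewrite mxE (bigD1 i)//= !mxE eqxx mul1r big1 ?addr0// => j ji.
rewrite !mxE (_ : (_ == _) = false) ?mul0r//.
by apply/negbTE; apply: contra_neq ji => /enum_val_inj.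
Qed.

Lemma trmx_projI_mulmx_out I (v : 'cV[R]_#|I|) j : j \notin I ->
  ((projI R I)^T *m v) j 0 = 0.
Proof.
move=> jI; rewrite mxE big1// => i _; rewrite !mxE.
rewrite (_ : (_ == _) = false) ?mul0r//.
by apply/negbTE; apply: contraNneq jI => ->; exact: enum_valP.
Qed.

Lemma projI_trmx I : projI R I *m (projI R I)^T = 1%:M.
Proof.
apply/matrixP => i j; rewrite mxE (bigD1 (enum_val i))//= !mxE eqxx mul1r.
rewrite (inj_eq enum_val_inj) big1 ?addr0// => l li.
by rewrite !mxE (negPf li) mul0r.
Qed.

Lemma sqnorm_trmx_projI I (v : 'cV[R]_#|I|) :
  sqnorm ((projI R I)^T *m v) = sqnorm v.
Proof. by rewrite -!dotvv dotv_mull trmxK mulmxA projI_trmx mul1mx. Qed.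

Lemma sqnorm_projI_le I w : sqnorm (projI R I *m w) <= sqnorm w.
Proof.
rewrite /sqnorm; under eq_bigr do rewrite projI_mulmxE.
rewrite -(big_enum_val (fun j => w j 0 ^+ 2)).
rewrite [leRHS](bigID (mem I))/= lerDl.
by apply: sumr_ge0 => j _; exact: sqr_ge0.
Qed.

Lemma quadf_subM A I (v : 'cV[R]_#|I|) :
  quadf (subM A I) v = quadf A ((projI R I)^T *m v).
Proof. by rewrite !quadfE dotv_mull trmxK /subM !mulmxA. Qed.

Lemma posdef_subM A I : posdef A -> posdef (subM A I).
Proof.
move=> [As Ap]; split.
  by rewrite /subM !trmx_mul trmxK As mulmxA.
move=> v v0; rewrite quadf_subM; apply: Ap; apply: contra_neq v0 => v0.
by apply: sqnorm_eq0; rewrite -sqnorm_trmx_projI v0 -dotvv /dotv mulmx0 mxE.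
Qed.

End projections.

(** * Duality between weights and dual vectors *)

Section duality.
Variables (R : realType) (k : nat) (Sigma : 'M[R]_k) (calI : {set {set 'I_k}}).
Variable a : 'cV[R]_k.
Hypothesis Sp : posdef Sigma.
Implicit Types (nu : {set 'I_k} -> R) (w : 'cV[R]_k) (I : {set 'I_k})
  (lam : forall I : {set 'I_k}, 'cV[R]_#|I|).

Definition iquad (S : 'M[R]_k) I w : R := quadf (invmx (subM S I)) (projI R I *m w).

Definition real_obj (S : 'M[R]_k) nu lam : R :=
  \sum_(I in calI | 0 < nu I) ((nu I)^-1 * quadf (subM S I) (lam I)).

Definition unbiased nu lam : Prop :=
  \sum_(I in calI | 0 < nu I) ((projI R I)^T *m lam I) = a.

Definition covering nu : Prop :=
  forall i, a i 0 != 0 -> exists2 I, I \in calI & 0 < nu I /\ i \in I.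

(** Affine in [nu] for fixed [w], hence continuous in [nu] even where the variance objective jumps
    because a coordinate ceases to be covered. *)
Definition dual_obj nu w : R :=
  2 * dotv a w - \sum_(I in calI) nu I * iquad Sigma I w.

Let SI I := posdef_subM I Sp.
Let SIu I : subM Sigma I \in unitmx := posdef_unitmx (SI I).
Let SIi I := posdef_invmx (SI I).

Lemma iquad_ge0 I w : 0 <= iquad Sigma I w.
Proof. exact: posdef_ge0. Qed.

Lemma trmx_info_mx nu : (info_mx Sigma calI nu)^T = info_mx Sigma calI nu.
Proof.
rewrite /info_mx linear_sum/=; apply: eq_bigr => I _.
by rewrite linearZ/= !trmx_mul trmxK (SIi I).1 mulmxA.
Qed.

Lemma info_mx_mulmx nu w : info_mx Sigma calI nu *m w =
  \sum_(I in calI) nu I *: ((projI R I)^T *m (invmx (subM Sigma I) *m (projI R I *m w))).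
Proof.
by rewrite /info_mx mulmx_suml; apply: eq_bigr => I _; rewrite -scalemxAl !mulmxA.
Qed.

Lemma quadf_info_mx nu w :
  quadf (info_mx Sigma calI nu) w = \sum_(I in calI) nu I * iquad Sigma I w.
Proof.
rewrite quadfE dotvC info_mx_mulmx dotv_suml; apply: eq_bigr => I _.
by rewrite dotvZl dotv_mull trmxK /iquad quadfE dotvC.
Qed.

Lemma invmx_posdef_supp I w i : i \in I -> iquad Sigma I w = 0 -> w i 0 = 0.
Proof.
move=> iI q0; have [p0|p0] := eqVneq (projI R I *m w) 0; last first.
  by have := (SIi I).2 _ p0; rewrite -/(iquad Sigma I w) q0 ltxx.
by rewrite -(enum_rankK_in iI iI) -projI_mulmxE p0 mxE.
Qed.

Lemma unbiased_covering nu lam : unbiased nu lam -> covering nu.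
Proof.
move=> ub i; rewrite -ub summxE => ai.
have [I /andP[IC nuI] h] : exists2 I, (I \in calI) && (0 < nu I) &
    ((projI R I)^T *m lam I) i 0 != 0.
  apply/exists_inP; apply: contra_neqT ai; rewrite negb_exists_in => /forall_inP h.
  by rewrite big1// => I hI; apply/eqP; rewrite -[_ == _]negbK h.
exists I => //; split=> //; apply: contra_neqT h => iI.
exact: trmx_projI_mulmx_out.
Qed.

(* A vector in the kernel of the information matrix vanishes on every I with
   nu I > 0, hence on the support of a. *)
Lemma info_mx_solve nu : (forall I, 0 <= nu I) -> covering nu ->
  exists w, info_mx Sigma calI nu *m w = a.
Proof.
move=> nu0 cov; set M := info_mx Sigma calI nu.
have Ms : M^T = M := trmx_info_mx nu.
have ker (v : 'cV[R]_k) : M *m v = 0 -> dotv a v = 0.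
  move=> Mv; rewrite dotvE big1// => i _.
  have [->|ai] := eqVneq (a i 0) 0; first by rewrite mul0r.
  have [I IC [nuI iI]] := cov i ai.
  suff -> : v i 0 = 0 by rewrite mulr0.
  apply: (invmx_posdef_supp iI); apply/eqP.
  have : quadf M v = 0 by rewrite quadfE Mv /dotv mulmx0 mxE.
  rewrite quadf_info_mx => /eqP; rewrite psumr_eq0; last first.
    by move=> J _; rewrite mulr_ge0 ?iquad_ge0.
  by move=> /allP/(_ I); rewrite mem_index_enum IC mulf_eq0 gt_eqF//; exact.
(* The columns of [cokermx M] lie in the kernel of [M], so orthogonality of [a] to the kernel puts
   [a^T] into the row space, and symmetry turns this into solvability. *)
have /submxP[D aE] : (a^T <= M)%MS.
  rewrite submxE; apply/eqP; move: (cokermx M) (mulmx_coker M) => K MK.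
  apply/matrixP => i j; rewrite !mxE.
  have : M *m col j K = 0.
    apply/matrixP => i' j'; have /matrixP/(_ i' j) := MK.
    rewrite !mxE => MK'.
    by rewrite -[RHS]MK'; apply: eq_bigr => l _; rewrite mxE.
  move=> /ker; rewrite dotvE => e; rewrite -[RHS]e; apply: eq_bigr => l _.
  by rewrite !mxE (ord1 i).
exists D^T; apply: trmx_inj; rewrite trmx_mul trmxK Ms -aE//.
Qed.

(** Completing the square in each [lam I] expresses the duality gap exactly as a sum of squares, for
    every [w]. This yields weak duality, uniqueness of the optimal weights, and a quantitative bound
    on near-optimal ones. *)
Lemma real_obj_identity nu lam w : (forall I, 0 <= nu I) -> unbiased nu lam ->
  real_obj Sigma nu lam = dual_obj nu w +
    \sum_(I in calI | 0 < nu I) nu I * quadf (subM Sigma I)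
      ((nu I)^-1 *: lam I - invmx (subM Sigma I) *m (projI R I *m w)).
Proof.
move=> nu0 ub.
have -> : dual_obj nu w = \sum_(I in calI | 0 < nu I)
    (2 * dotv (lam I) (projI R I *m w) - nu I * iquad Sigma I w).
  rewrite /dual_obj -{1}ub dotv_suml mulr_sumr sumrB; congr (_ - _).
    by apply: eq_bigr => I _; rewrite dotv_mull trmxK.
  rewrite (bigID (fun I => 0 < nu I))/= [X in _ + X]big1 ?addr0// => I /andP[_].
  rewrite -leNgt => nuI; have -> : nu I = 0 by apply/eqP; rewrite eq_le nuI nu0.
  by rewrite mul0r.
rewrite -big_split/=; apply: eq_bigr => I /andP[_ nuI].
set S := subM Sigma I; set y := projI R I *m w; set l := lam I.
rewrite quadfD ?(SI I).1// quadfZ.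
have -> : quadf S (- (invmx S *m y)) = iquad Sigma I w.
  rewrite -scaleN1r quadfZ sqrrN expr1n mul1r /iquad !quadfE.
  by rewrite (mulmxA S) mulmxV ?SIu// mul1mx dotvC.
rewrite mulmxN (mulmxA S) mulmxV ?SIu// mul1mx dotvZl dotvNr.
by field; rewrite gt_eqF.
Qed.

Lemma weak_duality nu lam w : (forall I, 0 <= nu I) -> unbiased nu lam ->
  dual_obj nu w <= real_obj Sigma nu lam.
Proof.
move=> nu0 ub; rewrite (real_obj_identity w nu0 ub) lerDl.
by apply: sumr_ge0 => I /andP[_ nuI]; rewrite mulr_ge0 ?(ltW nuI)// posdef_ge0.
Qed.

Definition opt_weight (S : 'M[R]_k) nu w I : 'cV[R]_#|I| :=
  nu I *: (invmx (subM S I) *m (projI R I *m w)).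

Lemma opt_weight_unbiased nu w : (forall I, 0 <= nu I) ->
  info_mx Sigma calI nu *m w = a -> unbiased nu (opt_weight Sigma nu w).
Proof.
rewrite /unbiased => nu0 <-; rewrite info_mx_mulmx [RHS](bigID (fun I => 0 < nu I))/=.
rewrite [X in _ + X]big1 ?addr0; last first.
  move=> I /andP[_]; rewrite -leNgt => nuI.
  have -> : nu I = 0 by apply/eqP; rewrite eq_le nuI nu0.
  by rewrite scale0r.
by apply: eq_bigr => I _; rewrite /opt_weight -scalemxAr.
Qed.

Lemma dual_obj_solution nu w : info_mx Sigma calI nu *m w = a ->
  dual_obj nu w = dotv a w.
Proof.
move=> Mw; rewrite /dual_obj -quadf_info_mx quadfE Mw (dotvC w); ring.
Qed.

Lemma var_obj_solution nu w : info_mx Sigma calI nu *m w = a ->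
  var_obj Sigma calI a nu = dotv a w.
Proof. by move=> Mw; apply: quadf_pinv => //; exact: trmx_info_mx. Qed.

Lemma real_obj_opt_weight nu w : (forall I, 0 <= nu I) ->
  info_mx Sigma calI nu *m w = a ->
  real_obj Sigma nu (opt_weight Sigma nu w) = dotv a w.
Proof.
move=> nu0 Mw; have ub := opt_weight_unbiased nu0 Mw.
rewrite (real_obj_identity w nu0 ub) (dual_obj_solution Mw) big1 ?addr0//.
move=> I /andP[_ nuI]; rewrite /opt_weight scalerA mulVf ?gt_eqF// scale1r subrr.
by rewrite quadf0 mulr0.
Qed.

Lemma dual_obj_le_var_obj nu w : (forall I, 0 <= nu I) -> covering nu ->
  dual_obj nu w <= var_obj Sigma calI a nu.
Proof.
move=> nu0 cov; have [w0 Mw] := info_mx_solve nu0 cov.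
rewrite (var_obj_solution Mw) -(real_obj_opt_weight nu0 Mw).
by apply: weak_duality => //; exact: opt_weight_unbiased.
Qed.

Lemma var_obj_le_real_obj nu lam : (forall I, 0 <= nu I) -> unbiased nu lam ->
  var_obj Sigma calI a nu <= real_obj Sigma nu lam.
Proof.
move=> nu0 ub; have [w0 Mw] := info_mx_solve nu0 (unbiased_covering ub).
by rewrite (var_obj_solution Mw) -(dual_obj_solution Mw); exact: weak_duality.
Qed.

(** A vanishing gap forces every square in [real_obj_identity] to vanish. *)
Lemma real_obj_min_opt_weight nu lam w : (forall I, 0 <= nu I) ->
  unbiased nu lam -> info_mx Sigma calI nu *m w = a ->
  real_obj Sigma nu lam <= dotv a w ->
  forall I, I \in calI -> 0 < nu I -> lam I = opt_weight Sigma nu w I.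
Proof.
move=> nu0 ub Mw; rewrite (real_obj_identity w nu0 ub) (dual_obj_solution Mw).
rewrite gerDl => s0 I IC nuI.
have ge0 J : (J \in calI) && (0 < nu J) -> 0 <= nu J * quadf (subM Sigma J)
      ((nu J)^-1 *: lam J - invmx (subM Sigma J) *m (projI R J *m w)).
  by move=> /andP[_ nuJ]; rewrite mulr_ge0 ?(ltW nuJ)// posdef_ge0.
have /eqP : \sum_(I in calI | 0 < nu I) nu I * quadf (subM Sigma I)
      ((nu I)^-1 *: lam I - invmx (subM Sigma I) *m (projI R I *m w)) = 0.
  by apply/eqP; rewrite eq_le s0 sumr_ge0.
rewrite psumr_eq0// => /allP/(_ I); rewrite mem_index_enum IC nuI/= => /(_ isT).
rewrite mulf_eq0 gt_eqF//= => /eqP q0.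
have [e|ne] := eqVneq ((nu I)^-1 *: lam I - invmx (subM Sigma I) *m (projI R I *m w)) 0.
  move/eqP: e; rewrite subr_eq0 => /eqP e.
  by rewrite /opt_weight -e scalerA divff ?gt_eqF// scale1r.
by have := (SI I).2 _ ne; rewrite q0 ltxx.
Qed.

End duality.

(** * Stability of the optimal design *)

Section inverse_bounds.
Variables (R : realType) (n : nat) (A : 'M[R]_n) (cl cu : R).
Hypotheses (Ap : posdef A) (cl0 : 0 < cl).
Hypothesis lower : forall v, cl * sqnorm v <= quadf A v.
Hypothesis upper : forall v, quadf A v <= cu * sqnorm v.

Lemma dotv_sqr_le (u v : 'cV[R]_n) : dotv u v ^+ 2 <= sqnorm u * sqnorm v.
Proof.
have q1 (x : 'cV[R]_n) : quadf 1%:M x = sqnorm x by rewrite quadfE mul1mx dotvv.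
have := @cauchy_schwarz_quadf _ _ 1%:M u v (trmx1 _ _).
by rewrite mul1mx !q1; apply => x; rewrite q1 sqnorm_ge0.
Qed.

Lemma quadf_invmx (y : 'cV[R]_n) : quadf (invmx A) y = quadf A (invmx A *m y).
Proof.
by rewrite !quadfE (mulmxA A) mulmxV ?posdef_unitmx// mul1mx dotvC.
Qed.

Lemma sqnorm_invmx_le (y : 'cV[R]_n) : cl ^+ 2 * sqnorm (invmx A *m y) <= sqnorm y.
Proof.
set u := invmx A *m y.
have l := lower u; rewrite -quadf_invmx quadfE -/u dotvC in l.
have cs := dotv_sqr_le u y; have u0 := sqnorm_ge0 u; have y0 := sqnorm_ge0 y.
have [->|uN0] := eqVneq (sqnorm u) 0; first by rewrite mulr0.
have up : 0 < sqnorm u by rewrite lt0r uN0.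
rewrite -(ler_pM2l up); apply: le_trans cs.
have : (cl * sqnorm u) ^+ 2 <= dotv u y ^+ 2.
  by rewrite lerXn2r// nnegrE ?(le_trans _ l)// mulr_ge0// ltW.
by apply: le_trans; rewrite exprMn (expr2 (sqnorm u)) mulrCA mulrA.
Qed.

Lemma quadf_invmx_le (y : 'cV[R]_n) : cl * quadf (invmx A) y <= sqnorm y.
Proof.
set u := invmx A *m y.
have e : quadf (invmx A) y = dotv u y by rewrite quadfE -/u dotvC.
have q0 : 0 <= quadf (invmx A) y by apply: posdef_ge0; exact: posdef_invmx.
have cs := dotv_sqr_le u y; rewrite -e in cs.
have l := lower u; rewrite -quadf_invmx in l.
have [->|qN0] := eqVneq (quadf (invmx A) y) 0; first by rewrite mulr0 sqnorm_ge0.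
have qp : 0 < quadf (invmx A) y by rewrite lt0r qN0.
rewrite -(ler_pM2l qp); have := ler_wpM2r (sqnorm_ge0 y) l.
by have := ler_wpM2l (ltW cl0) cs; nra.
Qed.

Lemma quadf_invmx_ge (y : 'cV[R]_n) : sqnorm y <= cu * quadf (invmx A) y.
Proof.
have cs := @cauchy_schwarz_quadf _ _ A y (invmx A *m y) Ap.1 (fun x => posdef_ge0 x Ap).
rewrite (mulmxA A) mulmxV ?posdef_unitmx// mul1mx dotvv -quadf_invmx in cs.
have q0 : 0 <= quadf (invmx A) y by apply: posdef_ge0; exact: posdef_invmx.
have [y0|yN0] := eqVneq (sqnorm y) 0.
  rewrite y0; have/sqnorm_eq0 -> := y0; by rewrite quadf0 mulr0.
have yp : 0 < sqnorm y by rewrite lt0r yN0 sqnorm_ge0.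
rewrite -(ler_pM2l yp) -expr2 (le_trans cs)// mulrA ler_wpM2r//.
by rewrite mulrC upper.
Qed.

End inverse_bounds.

(** * A bound on the dual solution of a nearly degenerate design *)

Section peeling.
Variables (R : realType) (k : nat) (S : 'M[R]_k) (calI : {set {set 'I_k}}).
Variables (a w : 'cV[R]_k) (nu : {set 'I_k} -> R) (cl cu : R).
Hypotheses (Sp : posdef S) (cl0 : 0 < cl).
Hypothesis lower : forall v, cl * sqnorm v <= quadf S v.
Hypothesis upper : forall v, quadf S v <= cu * sqnorm v.
Hypothesis nu0 : forall I, 0 <= nu I.
Hypothesis Mw : info_mx S calI nu *m w = a.

(** The growth factor of one round: [cu / cl] bounds the condition number of [S], and the rest
    counts sets and coordinates. It does not depend on [nu], so the bound survives weights tending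
    to 0 at different rates. *)
Let K : R := cu / cl * (#|calI|%:R * k%:R) + 1.

(* Among the sets not inside A take one with the largest weight: replacing w by
   0 outside A does not decrease the information quadratic form, so w is
   controlled on that set by its values on A. *)
Lemma peeling_bound (A : {set 'I_k}) (b : R) : 0 <= cu -> 0 <= b ->
  (forall i, a i 0 != 0 -> i \in A) -> (forall i, i \in A -> w i 0 ^+ 2 <= b) ->
  forall I, I \in calI -> 0 < nu I -> forall i, i \in I ->
    w i 0 ^+ 2 <= K ^+ k * b.
Proof.
move=> cu0 b0 aA wA.
have K1 : 1 <= K by rewrite /K lerDr !mulr_ge0 ?invr_ge0 ?(ltW cl0).
have K0 : 0 <= K by rewrite (le_trans ler01).
have lowI I v : cl * sqnorm v <= quadf (subM S I) v.
  by rewrite quadf_subM -(sqnorm_trmx_projI v) lower.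
have uppI I v : quadf (subM S I) v <= cu * sqnorm v.
  by rewrite quadf_subM -(sqnorm_trmx_projI v) upper.
(* Induction on the number of coordinates outside [A']; every round adds at least one of them, so at
   most [k] factors [K] accumulate. *)
suff main N (A' : {set 'I_k}) (b' : R) : (#|~: A'| <= N)%N -> 0 <= b' ->
    (forall i, a i 0 != 0 -> i \in A') -> (forall i, i \in A' -> w i 0 ^+ 2 <= b') ->
    forall I, I \in calI -> 0 < nu I -> forall i, i \in I -> w i 0 ^+ 2 <= K ^+ N * b'.
  move=> I IC nuI i iI; apply: (main k A b _ b0 aA wA I IC nuI i iI).
  by rewrite -[X in (_ <= X)%N]card_ord max_card.
elim: N A' b' => [|N IH] A' b' cA b'0 aA' wA' I IC nuI i iI.
  rewrite expr0 mul1r; apply: wA'; move: cA.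
  by rewrite leqn0 cards_eq0 => /eqP/finset.setP/(_ i); rewrite !inE => /negbFE.
have [sub|/forall_inPn[I1 I1C I1A]] := boolP [forall I in calI, (0 < nu I) ==> (I \subset A')].
  have iA : i \in A' by move: sub => /forall_inP/(_ I IC)/implyP/(_ nuI)/fintype.subsetP; exact.
  rewrite (le_trans (wA' i iA))// ler_peMl// exprn_ege1//.
have I1P : (I1 \in calI) && ~~ (I1 \subset A').
  by rewrite I1C; move: I1A; rewrite negb_imply => /andP[].
case: (@arg_maxP _ _ _ I1 (fun J => (J \in calI) && ~~ (J \subset A')) nu I1P).
move=> J /andP[JC JA] Jmax.
have nuJ : 0 < nu J.
  apply: lt_le_trans (Jmax I1 I1P); move: I1A; by rewrite negb_imply => /andP[].
pose w' : 'cV[R]_k := \col_i (if i \in A' then w i 0 else 0).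
have aw : dotv a w' = dotv a w.
  rewrite !dotvE; apply: eq_bigr => l _; rewrite mxE.
  case: ifPn => // lA; have [->|al] := eqVneq (a l 0) 0; first by rewrite !mul0r.
  by rewrite aA' in lA.
have cov : covering calI a nu.
  by apply: (@unbiased_covering _ _ calI a nu (opt_weight S nu w)); exact: opt_weight_unbiased.
(* [w] maximises the dual objective at [nu], and [w'] has the same linear term because [a] is
   supported in [A']. *)
have Q : \sum_(I in calI) nu I * iquad S I w <= \sum_(I in calI) nu I * iquad S I w'.
  have := dual_obj_le_var_obj Sp w' nu0 cov.
  rewrite (var_obj_solution Sp Mw) -(dual_obj_solution Mw) /dual_obj aw.
  by rewrite lerD2l lerN2.
have same (I' : {set 'I_k}) : I' \subset A' -> iquad S I' w = iquad S I' w'.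
  move=> IA; rewrite /iquad; congr quadf; apply/matrixP => x y.
  rewrite (ord1 y) !projI_mulmxE mxE (fintype.subsetP IA)//; exact: enum_valP.
have {}Q : \sum_(I in calI | ~~ (I \subset A')) nu I * iquad S I w <=
    \sum_(I in calI | ~~ (I \subset A')) nu I * iquad S I w'.
  move: Q; rewrite (bigID (fun I : {set 'I_k} => I \subset A'))/= [leRHS](bigID (fun I : {set 'I_k} => I \subset A'))/=.
  rewrite (eq_bigr (fun I => nu I * iquad S I w')); first by rewrite lerD2l.
  by move=> I' /andP[_ IA]; rewrite same.
have w'b I' : iquad S I' w' <= k%:R * b' / cl.
  rewrite ler_pdivlMr// mulrC; apply: le_trans (quadf_invmx_le (posdef_subM I' Sp) cl0 (lowI I') _) _.
  apply: le_trans (sqnorm_projI_le _ _) _.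
  rewrite -[X in X%:R * _]card_ord -sum1_card natr_sum mulr_suml.
  apply: ler_sum => l _; rewrite mul1r mxE; case: ifPn => [/wA'//|_].
  by rewrite expr0n.
(* [nu J] is the largest weight among the sets not inside [A'], so it dominates those in the sum for
   [w'] and cancels from both sides. *)
have Jw : sqnorm (projI R J *m w) <= cu / cl * (#|calI|%:R * k%:R) * b'.
  apply: le_trans (quadf_invmx_ge (posdef_subM J Sp) (uppI J) _) _.
  rewrite -!mulrA ler_wpM2l// mulrCA -(ler_pM2l nuJ).
  have JP : (J \in calI) && ~~ (J \subset A') by rewrite JC.
  apply: (@le_trans _ _ (\sum_(I in calI | ~~ (I \subset A')) nu I * iquad S I w)).
    rewrite (bigD1 J)//= lerDl; apply: sumr_ge0 => I' _.
    by rewrite mulr_ge0 ?iquad_ge0.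
  apply: (le_trans Q).
  apply: (@le_trans _ _ (\sum_(I in calI | ~~ (I \subset A')) nu J * (k%:R * b' / cl))).
    apply: ler_sum => I' I'P; apply: ler_pM => //; last exact: Jmax.
    exact: iquad_ge0.
  rewrite -mulr_sumr ler_wpM2l ?(ltW nuJ)//.
  apply: (@le_trans _ _ (\sum_(I in calI) (k%:R * b' / cl))).
    rewrite [leRHS](bigID (fun I : {set 'I_k} => I \subset A'))/= lerDr.
    by apply: sumr_ge0 => I' _; rewrite !mulr_ge0// invr_ge0 ltW.
  by rewrite sumr_const -mulr_natl le_eqVlt; apply/orP; left; apply/eqP; ring.
rewrite [K ^+ _]exprSr -mulrA; apply: (IH (A' :|: J) (K * b') _ _ _ _ I IC nuI i iI).
- rewrite -ltnS; apply: leq_trans cA; apply: proper_card.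
  rewrite finset.setCU; apply/properP; split; first exact: finset.subsetIl.
  have /fintype.subsetPn[l lJ lA] := JA; exists l; rewrite !inE//.
  by rewrite lJ andbF.
- by rewrite mulr_ge0.
- by move=> l al; rewrite inE aA'.
move=> l; rewrite inE => /orP[lA|lJ].
  by rewrite (le_trans (wA' l lA))// ler_peMl.
rewrite /K mulrDl mul1r; apply: ler_wpDr => //; apply: le_trans Jw.
rewrite -(enum_rankK_in lJ lJ) -projI_mulmxE; exact: sqnorm_entry.
Qed.

End peeling.

(** * Compactness and near-optimal allocations *)

Section separation.
Variables (R : realType) (k m : nat) (Sigma : 'M[R]_k) (calI : {set {set 'I_k}}).
Variables (c : {set 'I_k} -> 'I_m -> R) (B0 : 'I_m -> R) (a : 'cV[R]_k).
Variable nustar : {set 'I_k} -> R.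
Implicit Types (nu : {set 'I_k} -> R) (w : 'cV[R]_k) (I : {set 'I_k}).
Hypotheses (Sp : posdef Sigma) (c0 : forall I r, 0 <= c I r).
Hypothesis B0_gt0 : forall r, 0 < B0 r.
Hypothesis nustar_feasible : cont_feasible calI c B0 a nustar.

Local Notation Vstar := (var_obj Sigma calI a nustar).

Hypothesis nustar_min : forall nu, cont_feasible calI c B0 a nu ->
  Vstar <= var_obj Sigma calI a nu.
Hypothesis nustar_unique : forall nu, cont_feasible calI c B0 a nu ->
  var_obj Sigma calI a nu = Vstar -> nu = nustar.

(* An index of zero cost could receive more weight without increasing the
   variance, contradicting uniqueness. *)
Lemma unique_cost_gt0 I : I \in calI -> exists r, 0 < c I r.
Proof.
move=> IC; apply: contrapT => /forallNP h.
have cI r : c I r = 0 by apply/eqP; rewrite eq_le c0 andbT leNgt; apply/negP/h.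
have [n0 nge nB ncov] := nustar_feasible.
pose nu J := nustar J + (J == I)%:R.
have nuge J : nustar J <= nu J by rewrite lerDl.
have fnu : cont_feasible calI c B0 a nu.
  split.
  - move=> J JC; rewrite /nu n0// (_ : J == I = false) ?addr0//.
    by apply: contraNF JC => /eqP ->.
  - by move=> J; exact: le_trans (nuge J).
  - move=> r; rewrite (eq_bigr (fun J => nustar J * c J r)) => [|J _]; first exact: nB.
    by rewrite /nu mulrDl; have [->|_] := eqVneq J I; rewrite ?cI ?mulr0 ?mul0r ?addr0.
  - move=> i /ncov[J JC [nuJ iJ]]; exists J => //; split=> //.
    exact: lt_le_trans (nuge J).
have [_ nu0 _ nucov] := fnu.
have [w Mw] := info_mx_solve Sp nu0 nucov.
have le : var_obj Sigma calI a nu <= Vstar.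
  rewrite (var_obj_solution Sp Mw) -(dual_obj_solution Mw).
  apply: le_trans (dual_obj_le_var_obj Sp w nge ncov).
  rewrite lerD2l lerN2; apply: ler_sum => J _; rewrite ler_wpM2r//.
  exact: iquad_ge0.
have e : nu = nustar.
  by apply: nustar_unique => //; apply/eqP; rewrite eq_le le nustar_min.
have := congr1 (fun f => f I) e; rewrite /nu eqxx => /eqP.
by rewrite -subr_eq0 addrAC subrr add0r oner_eq0.
Qed.

(** A crude common bound: for each [I] the sum contains a budget line with positive cost, while a
    zero cost contributes 0 because division by 0 yields 0. *)
Definition budget_bound : R := \sum_I \sum_r `|B0 r / c I r|.

Lemma budget_bounded nu (t : R) : 0 <= t -> (forall I, 0 <= nu I) ->
  (forall r, \sum_(I in calI) nu I * c I r <= t * B0 r) ->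
  forall I, I \in calI -> nu I <= t * budget_bound.
Proof.
move=> t0 nu0 nuB I IC; have [r cr] := unique_cost_gt0 IC.
apply: (@le_trans _ _ (t * `|B0 r / c I r|)).
  rewrite ger0_norm ?divr_ge0 ?(ltW cr) ?(ltW (B0_gt0 r))// mulrA ler_pdivlMr//.
  apply: le_trans (nuB r); rewrite (bigD1 I)//= lerDl.
  by apply: sumr_ge0 => J _; rewrite mulr_ge0.
rewrite ler_wpM2l// /budget_bound (bigD1 I)//= (bigD1 r)//= -addrA lerDl.
by apply: addr_ge0; apply: sumr_ge0 => // J _; exact: sumr_ge0.
Qed.

Let N := #|{set 'I_k}|.
(** Coding allocations as row vectors makes a product of segments compact. *)
Let vec nu : 'rV[R]_N := \row_j nu (enum_val j).
Let unvec (v : 'rV[R]_N) I : R := v 0 (enum_rank I).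

Let vecK nu : unvec (vec nu) = nu.
Proof. by apply/funext => I; rewrite /unvec mxE enum_rankK. Qed.

Let continuous_unvec I : continuous (fun v : 'rV[R]_N => unvec v I).
Proof. exact: coord_continuous. Qed.

Let continuous_unvec_sum (f : {set 'I_k} -> R -> R) :
  (forall I, continuous (f I)) ->
  continuous (fun v : 'rV[R]_N => \sum_(I in calI) f I (unvec v I)).
Proof.
move=> cf; apply: continuous_big => [|I _].
  by move=> x; apply: cvgD; [exact: cvg_fst|exact: cvg_snd].
move=> v; apply: (@continuous_comp _ _ _ (fun v : 'rV[R]_N => unvec v I) (f I)).
  exact: coord_continuous.
exact: cf.
Qed.

(** For each [e > 0] the closed set where [f <= b + e] contains the tail of the sequence, hence its
    cluster points; no convergent subsequence is extracted. *)
Let cluster_le (v_ : nat -> 'rV[R]_N) p (f : 'rV[R]_N -> R) b :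
  cluster (v_ @ \oo) p -> continuous f -> (forall n, f (v_ n) <= b + n.+1%:R^-1) ->
  f p <= b.
Proof.
move=> cl cf fb; apply/ler_addgt0Pr => e e0.
have closedC : closed (f @^-1` [set x | x <= b + e]).
  by apply: preimage_closed; [move=> x _; exact: cf|exact: closed_le].
apply: closedC => B nB; apply: cl => //.
change (\forall n \near \oo, f (v_ n) <= b + e).
near=> n; rewrite (le_trans (fb n))// lerD2l; apply: ltW.
near: n; exact: near_infty_natSinv_lt (PosNum e0).
Unshelve. all: by end_near. Qed.

(* At a cluster point of allocations violating the claim the dual objective is
   at most Vstar for every w, which forces that point to cover supp a. *)
Lemma near_optimal_close (e : R) : 0 < e -> exists2 g, 0 < g &
  forall nu, cont_feasible calI c B0 a nu ->
    var_obj Sigma calI a nu <= Vstar + g ->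
    forall I, I \in calI -> `|nu I - nustar I| <= e.
Proof.
move=> e0; apply: contrapT => H.
(* The violated deviation is enlarged to the sum of all deviations, a continuous function, so that
   the lower bound [e] persists at a cluster point. *)
have {H} H (n : nat) : exists nu, [/\ cont_feasible calI c B0 a nu,
    var_obj Sigma calI a nu <= Vstar + n.+1%:R^-1 &
    e <= \sum_(I in calI) `|nu I - nustar I|].
  apply: contrapT => Hn; apply: H; exists n.+1%:R^-1 => // nu fnu vnu I IC.
  rewrite leNgt; apply/negP => eI; apply: Hn; exists nu; split => //.
  rewrite (bigD1 I)//= (le_trans (ltW eI))// lerDl.
  by apply: sumr_ge0.
have [nu_ nu_P] := choice H.
pose v_ n := vec (nu_ n).
have v_nu n : unvec (v_ n) = nu_ n by exact: vecK.
pose K := [set v : 'rV[R]_N | forall i, `[0, budget_bound]%classic (v ord0 i)].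
have cK : compact K.
  have c1 := @segment_compact R 0 budget_bound.
  by have := @rV_compact R N (fun=> `[0, budget_bound]%classic) (fun=> c1).
have bb0 : 0 <= budget_bound by apply: sumr_ge0 => I _; exact: sumr_ge0.
have v_K n : K (v_ n).
  move=> i; rewrite /v_ mxE /= in_itv/=; have [[nC n0 nB _] _ _] := nu_P n.
  rewrite n0/=; have [IC|/nC ->//] := boolP (enum_val i \in calI).
  have := @budget_bounded (nu_ n) 1 ler01 n0; rewrite mul1r; apply => // r.
  by rewrite mul1r.
have [|p [_ clp]] := cK (v_ @ \oo) _.
  by change (\forall n \near \oo, K (v_ n)); near=> n; exact: v_K.
pose nu := unvec p.
have nu0 I : 0 <= nu I.
  rewrite -oppr_le0; apply: (@cluster_le v_ p (fun v => - unvec v I) 0 clp).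
    move=> v; apply: (@continuous_comp _ _ _ (fun v => unvec v I) -%R).
      exact: continuous_unvec.
    exact: opp_continuous.
  by move=> n; rewrite v_nu add0r (@le_trans _ _ 0)// oppr_le0; have [[]] := nu_P n.
have nuC I : I \notin calI -> nu I = 0.
  move=> IC; apply/eqP; rewrite eq_le nu0 andbT.
  apply: (@cluster_le v_ p (fun v => unvec v I) 0 clp).
    exact: continuous_unvec.
  by move=> n; rewrite v_nu add0r; have [[->//]] := nu_P n.
have nuB r : \sum_(I in calI) nu I * c I r <= B0 r.
  apply: (@cluster_le v_ p (fun v => \sum_(I in calI) unvec v I * c I r) _ clp).
    apply: (continuous_unvec_sum (f := fun I x => x * c I r)) => I x.
    by apply: cvgM; [exact: cvg_id|exact: cvg_cst].
  by move=> n; rewrite v_nu ler_wpDr//; have [[_ _ +]] := nu_P n; exact.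
have nuV w : dual_obj Sigma calI a nu w <= Vstar.
  apply: (@cluster_le v_ p (fun v => dual_obj Sigma calI a (unvec v) w) _ clp).
    move=> v; apply: (@continuous_comp _ _ _
        (fun v => \sum_(I in calI) unvec v I * iquad Sigma I w)
        (fun y => 2 * dotv a w - y)).
      apply: (continuous_unvec_sum (f := fun I x => x * iquad Sigma I w)) => I x.
      by apply: cvgM; [exact: cvg_id|exact: cvg_cst].
    by apply: cvgB; [exact: cvg_cst|exact: cvg_id].
  move=> n; rewrite v_nu; have [[_ n0 _ cov] + _] := nu_P n.
  by apply: le_trans; exact: dual_obj_le_var_obj.
have nue : e <= \sum_(I in calI) `|nu I - nustar I|.
  rewrite -lerN2.
  apply: (@cluster_le v_ p (fun v => - \sum_(I in calI) `|unvec v I - nustar I|) _ clp).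
    move=> v; apply: (@continuous_comp _ _ _
        (fun v => \sum_(I in calI) `|unvec v I - nustar I|) -%R); last exact: opp_continuous.
    apply: (continuous_unvec_sum (f := fun I x => `|x - nustar I|)) => I x.
    by apply: cvg_norm; apply: cvgB; [exact: cvg_id|exact: cvg_cst].
  by move=> n; rewrite v_nu ler_wpDr// lerN2; have [] := nu_P n.
have cov : covering calI a nu.
  move=> i ai; apply: contrapT => Hi.
  (* Along an uncovered coordinate the quadratic term vanishes, so this multiple of the unit vector
     has dual value exactly [Vstar + 1]. *)
  pose w : 'cV[R]_k := ((Vstar + 1) / (2 * a i 0)) *: delta_mx i 0.
  have := nuV w; rewrite /dual_obj big1 => [|I IC]; last first.
    have [iI|iI] := boolP (i \in I).
      suff -> : nu I = 0 by rewrite mul0r.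
      apply/eqP; rewrite eq_le nu0 andbT leNgt; apply/negP => nuI.
      by apply: Hi; exists I.
    have Pw0 : projI R I *m w = 0.
      apply/matrixP => x y; rewrite (ord1 y) projI_mulmxE /w !mxE andbT.
      rewrite (_ : _ == _ = false) ?mulr0//.
      by apply: contraNF iI => /eqP <-; exact: enum_valP.
    by rewrite /iquad Pw0 quadf0 mulr0.
  rewrite subr0 /w dotvZr dotvE (bigD1 i)//= big1; last first.
    by move=> j ji; rewrite mxE (negPf ji) mulr0.
  rewrite mxE !eqxx mulr1 addr0.
  have -> : 2 * ((Vstar + 1) / (2 * a i 0) * a i 0) = Vstar + 1 by field.
  by rewrite gerDl lt_geF.
have fnu : cont_feasible calI c B0 a nu by split.
have [w Mw] := info_mx_solve Sp nu0 cov.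
have le : var_obj Sigma calI a nu <= Vstar.
  by rewrite (var_obj_solution Sp Mw) -(dual_obj_solution Mw).
have eq : nu = nustar.
  by apply: nustar_unique => //; apply/eqP; rewrite eq_le le nustar_min.
move: nue; rewrite eq big1 ?leNgt ?e0// => I _.
by rewrite subrr normr0.
Unshelve. all: by end_near. Qed.

End separation.

(** * Perturbation of the covariance matrix *)

Section perturbation.
Variables (R : realType) (k : nat) (Sigma : 'M[R]_k).
Hypothesis Sp : posdef Sigma.

(** The error is measured relative to [Sigma], so it passes with the same [rho] to every principal
    submatrix and to [real_obj] for every allocation. *)
Lemma quadf_perturbation (rho : R) : 0 < rho -> exists2 delta, 0 < delta &
  forall S : 'M[R]_k, (forall i j, `|S i j - Sigma i j| <= delta) ->
  forall v, `|quadf S v - quadf Sigma v| <= rho * quadf Sigma v.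
Proof.
move=> rho0; have [cl cl0 lower] := posdef_lower Sp.
(* The number of entries; the added 1 keeps the divisor positive when [k = 0]. *)
pose K : R := k%:R * k%:R + 1.
have K0 : 0 < K by rewrite ltr_wpDl// mulr_ge0.
exists (rho * cl / K); first by rewrite divr_gt0// mulr_gt0.
move=> S SS v.
have -> : quadf S v - quadf Sigma v = quadf (S - Sigma) v.
  by rewrite !quadfE mulmxBl dotvDr dotvNr.
apply: le_trans (quadf_sumabs _ _) _.
apply: (@le_trans _ _ (rho * (cl * sqnorm v))); last by rewrite ler_wpM2l// ltW.
rewrite mulrA ler_wpM2r ?sqnorm_ge0//.
apply: (@le_trans _ _ (\sum_(i < k) \sum_(j < k) (rho * cl / K))).
  by apply: ler_sum => i _; apply: ler_sum => j _; have := SS i j; rewrite !mxE.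
under eq_bigr do rewrite sumr_const card_ord.
rewrite sumr_const card_ord -mulrnA -[leLHS]mulr_natr natrM.
rewrite mulrAC ler_pdivrMr// ler_wpM2l ?mulr_ge0 ?(ltW rho0) ?(ltW cl0)//.
by rewrite lerDl.
Qed.

Lemma quadf_perturbation_posdef (rho : R) (S : 'M[R]_k) : rho < 1 -> S^T = S ->
  (forall v, `|quadf S v - quadf Sigma v| <= rho * quadf Sigma v) -> posdef S.
Proof.
move=> rho1 Ss SS; split=> // v v0; have := SS v; have := Sp.2 v v0.
rewrite ler_norml => q0 /andP[l _].
have : 0 < (1 - rho) * quadf Sigma v by rewrite mulr_gt0// subr_gt0.
lra.
Qed.

End perturbation.

Section real_obj_compare.
Variables (R : realType) (k : nat) (calI : {set {set 'I_k}}).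

Lemma real_obj_le (S S' : 'M[R]_k) (r : R) nu lam :
  (forall v, quadf S v <= r * quadf S' v) ->
  real_obj calI S nu lam <= r * real_obj calI S' nu lam.
Proof.
move=> SS; rewrite /real_obj mulr_sumr; apply: ler_sum => I /andP[_ nuI].
by rewrite mulrCA ler_wpM2l ?invr_ge0 ?(ltW nuI)// !quadf_subM.
Qed.

(** Passing to the proportions [n I / t] turns the integer problem with budget [t * B0] into an
    instance of the continuous one with budget [B0], the objective being multiplied by [t]. *)
Lemma est_objE (S : 'M[R]_k) (n : {set 'I_k} -> nat) lam (t : R) : 0 < t ->
  t * est_obj S calI n lam = real_obj calI S (fun I => (n I)%:R / t) lam.
Proof.
move=> t0; rewrite /est_obj /real_obj mulr_sumr; apply: eq_big => [I|I /andP[_ nI]].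
  by rewrite pmulr_lgt0 ?invr_gt0// ltr0n.
have n0 : (n I)%:R != 0 :> R by rewrite pnatr_eq0 -lt0n.
by field; rewrite n0 gt_eqF.
Qed.

Lemma est_feasibleE (m : nat) (c : {set 'I_k} -> 'I_m -> R) (B0 : 'I_m -> R)
    (a : 'cV[R]_k) (n : {set 'I_k} -> nat) lam (t : R) : 0 < t ->
  est_feasible calI c (fun r => t * B0 r) a n lam <->
  [/\ (forall I, I \notin calI -> n I = 0%N),
      (forall r, \sum_(I in calI) ((n I)%:R / t) * c I r <= B0 r) &
      unbiased calI a (fun I => (n I)%:R / t) lam].
Proof.
move=> t0.
have sumE r : \sum_(I in calI) ((n I)%:R / t) * c I r =
    (\sum_(I in calI) (n I)%:R * c I r) / t.
  by rewrite mulr_suml; apply: eq_bigr => I _; rewrite mulrAC.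
have unbE : (\sum_(I in calI | (0 < n I)%N) (projI R I)^T *m lam I = a) <->
    unbiased calI a (fun I => (n I)%:R / t) lam.
  rewrite /unbiased; split=> <-; apply: eq_bigl => I; rewrite pmulr_lgt0 ?invr_gt0// ltr0n//.
split=> -[h1 h2 h3]; split=> //; try exact/unbE.
  by move=> r; rewrite sumE ler_pdivrMr// mulrC; exact: h2.
by move=> r; have := h2 r; rewrite sumE ler_pdivrMr// mulrC.
Qed.

End real_obj_compare.

(** * Convergence of the estimated design *)

Section allocation.
Variables (R : realType) (k m : nat) (Sigma : 'M[R]_k) (calI : {set {set 'I_k}}).
Variables (c : {set 'I_k} -> 'I_m -> R) (B0 : 'I_m -> R) (a : 'cV[R]_k).
Variable nustar : {set 'I_k} -> R.
Hypotheses (Sp : posdef Sigma) (c0 : forall I r, 0 <= c I r).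
Hypothesis B0_gt0 : forall r, 0 < B0 r.
Hypothesis nustar_feasible : cont_feasible calI c B0 a nustar.

Local Notation Vstar := (var_obj Sigma calI a nustar).

Hypothesis nustar_min : forall nu, cont_feasible calI c B0 a nu ->
  Vstar <= var_obj Sigma calI a nu.
Hypothesis nustar_unique : forall nu, cont_feasible calI c B0 a nu ->
  var_obj Sigma calI a nu = Vstar -> nu = nustar.

Let nustar_ge0 I : 0 <= nustar I.
Proof. by have [_ + _ _] := nustar_feasible; exact. Qed.

Let nustar_cov : covering calI a nustar.
Proof. by have [_ _ _] := nustar_feasible. Qed.

Let bounded := budget_bounded Sp c0 B0_gt0 nustar_feasible nustar_min nustar_unique.

(** Positive costs leave finitely many integer allocations, and for each of them duality gives the
    best weights explicitly. Existence matters because the selected design is only assumed to be a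
    minimizer when there is one. *)
Lemma est_minimizer_exists (S : 'M[R]_k) (t : R) : posdef S -> 0 < t ->
  (exists n lam, est_feasible calI c (fun r => t * B0 r) a n lam) ->
  exists n lam, est_minimizer S calI c (fun r => t * B0 r) a n lam.
Proof.
move=> SP t0 [n0 [lam0 f0]].
pose M := Num.truncn (t * budget_bound c B0).
have nM (n : {set 'I_k} -> nat) lam I :
    est_feasible calI c (fun r => t * B0 r) a n lam -> (n I < M.+1)%N.
  case=> nC nB _; have [IC|/nC -> //] := boolP (I \in calI).
  have b : (n I)%:R <= t * budget_bound c B0.
    by apply: (bounded (nu := fun I => (n I)%:R)) => //; exact: ltW.
  by rewrite ltnS truncn_ge_nat// (le_trans _ b).
pose T := {ffun {set 'I_k} -> 'I_M.+1}.
pose f2n (f : T) I : nat := f I.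
pose P (f : T) := `[< exists lam, est_feasible calI c (fun r => t * B0 r) a (f2n f) lam >].
pose F (f : T) := var_obj S calI a (fun I => (f2n f I)%:R / t).
have n2f n lam : est_feasible calI c (fun r => t * B0 r) a n lam ->
    exists f : T, f2n f = n.
  move=> fn; exists [ffun I => inord (n I)]; apply/funext => I.
  by rewrite /f2n ffunE inordK//; exact: nM fn.
have [f0' f0E] := n2f _ _ f0.
have Pf0 : P f0' by apply/asboolP; exists lam0; rewrite f0E.
case: (arg_minP F Pf0) => f /asboolP[lam fl] fmin.
have [fC fB fU] := (est_feasibleE calI c B0 a (f2n f) lam t0).1 fl.
pose nu I := (f2n f I)%:R / t.
have nu0 I : 0 <= nu I by rewrite divr_ge0// ltW.
have [w Mw] := info_mx_solve SP nu0 (unbiased_covering fU).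
exists (f2n f), (opt_weight S nu w); split.
  apply/(est_feasibleE calI c B0 a (f2n f) _ t0); split=> //.
  exact: opt_weight_unbiased.
move=> n' lam' f'; rewrite -(ler_pM2l t0) !est_objE//.
rewrite (real_obj_opt_weight SP nu0 Mw) -(var_obj_solution SP Mw).
have [f'' f''E] := n2f _ _ f'.
have [_ _ f'U] := (est_feasibleE calI c B0 a n' lam' t0).1 f'.
have nu'0 I : 0 <= (n' I)%:R / t by rewrite divr_ge0// ltW.
apply: le_trans (var_obj_le_real_obj SP nu'0 f'U).
have : F f <= F f'' by apply: fmin; apply/asboolP; exists lam'; rewrite f''E.
by rewrite /F f''E.
Qed.

Definition floor_alloc (t : R) (I : {set 'I_k}) : nat := Num.truncn (t * nustar I).

Lemma floor_alloc_le (t : R) I : 0 < t -> (floor_alloc t I)%:R / t <= nustar I.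
Proof.
by move=> t0; rewrite ler_pdivrMr// mulrC truncn_le mulr_ge0// ltW.
Qed.

Lemma floor_alloc_gt (t : R) I : 0 < t -> nustar I - t^-1 < (floor_alloc t I)%:R / t.
Proof.
move=> t0; rewrite ltr_pdivlMr// mulrBl mulVf ?gt_eqF// ltrBlDr mulrC natr1.
by have /andP[] := truncn_itv (mulr_ge0 (ltW t0) (nustar_ge0 I)).
Qed.

Lemma floor_alloc_ge (rho : R) : 0 < rho -> exists2 T0, 0 < T0 &
  forall t, T0 <= t -> forall I, (1 - rho) * nustar I <= (floor_alloc t I)%:R / t.
Proof.
(* Beyond [(rho * nustar I)^-1] the rounding error [1 / t] is at most [rho * nustar I]. A set with
   [nustar I = 0] contributes 0 to the sum, as the inverse of 0 is 0. *)
move=> rho0; exists (1 + \sum_I (rho * nustar I)^-1).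
  by rewrite ltr_wpDr// sumr_ge0// => I _; rewrite invr_ge0 mulr_ge0// ltW.
move=> t tT I; have Ti : (rho * nustar I)^-1 < t.
  apply: lt_le_trans tT; rewrite (bigD1 I)//= addrCA ltrDl ltr_wpDr//.
  by apply: sumr_ge0 => J _; rewrite invr_ge0 mulr_ge0// ltW.
have t0 : 0 < t by apply: le_lt_trans Ti; rewrite invr_ge0 mulr_ge0// ltW.
have [n0|n0] := eqVneq (nustar I) 0.
  by rewrite n0 mulr0 divr_ge0// ltW.
have np : 0 < nustar I by rewrite lt0r n0 nustar_ge0.
apply: le_trans (ltW (floor_alloc_gt I t0)).
rewrite mulrBl mul1r lerD2l lerN2 -[leRHS]invrK lef_pV2 ?posrE ?invr_gt0 ?mulr_gt0//.
exact: ltW.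
Qed.

(** Rounding down respects the budget, and for large [t] it keeps the support of [nustar]; the
    weights optimal for [nustar] thus stay unbiased, and each term of the objective grows by a
    factor of at most [1 / (1 - rho)]. *)
Lemma floor_alloc_feasible (t rho : R) w : 0 < t -> rho < 1 ->
  info_mx Sigma calI nustar *m w = a ->
  (forall I, (1 - rho) * nustar I <= (floor_alloc t I)%:R / t) ->
  let nu I := (floor_alloc t I)%:R / t in
  [/\ est_feasible calI c (fun r => t * B0 r) a (floor_alloc t)
        (opt_weight Sigma nustar w),
      unbiased calI a nu (opt_weight Sigma nustar w) &
      (1 - rho) * real_obj calI Sigma nu (opt_weight Sigma nustar w) <= Vstar].
Proof.
move=> t0 rho1 Mw fl nu; set lam := opt_weight Sigma nustar w.
have r0 : 0 < 1 - rho by rewrite subr_gt0.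
have pos I : (0 < nu I) = (0 < nustar I).
  apply/idP/idP => [h|h]; first exact: lt_le_trans (floor_alloc_le I t0).
  by apply: lt_le_trans (fl I); rewrite mulr_gt0.
have ub : unbiased calI a nu lam.
  apply: etrans (opt_weight_unbiased nustar_ge0 Mw); apply: eq_bigl => I.
  by rewrite pos.
split=> //.
  apply/(est_feasibleE calI c B0 a _ _ t0); have [nC _ nB _] := nustar_feasible.
  split=> //; first by move=> I IC; rewrite /floor_alloc nC// mulr0 truncn0.
  move=> r; apply: le_trans (nB r); apply: ler_sum => I _.
  by rewrite ler_wpM2r// floor_alloc_le.
rewrite (var_obj_solution Sp Mw) -(real_obj_opt_weight Sp nustar_ge0 Mw).
rewrite /real_obj mulr_sumr (eq_bigl _ _ (fun I => congr1 (andb _) (pos I))).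
apply: ler_sum => I /andP[_ nuI]; rewrite mulrA ler_wpM2r//.
  by apply: posdef_ge0; exact: posdef_subM.
by rewrite ler_pdivrMr ?pos// [leRHS]mulrC ler_pdivlMr//; exact: fl.
Qed.

Let Vstar_ge0 : 0 <= Vstar.
Proof.
have [w Mw] := info_mx_solve Sp nustar_ge0 nustar_cov.
rewrite (var_obj_solution Sp Mw) -(real_obj_opt_weight Sp nustar_ge0 Mw).
apply: sumr_ge0 => I /andP[_ nuI]; apply: mulr_ge0; first by rewrite invr_ge0 ltW.
by apply: posdef_ge0; exact: posdef_subM.
Qed.

(** The minimizer is compared with the rounded optimal design. Passing from [Sigma] to [S] and back
    costs [1 / (1 - rho)] and [1 + rho], and rounding costs another [1 / (1 - rho)]. *)
Lemma minimizer_near_optimal (g : R) : 0 < g ->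
  exists delta T0 : R, [/\ 0 < delta, 0 < T0 & forall t S, T0 <= t -> S^T = S ->
    (forall i j, `|S i j - Sigma i j| <= delta) ->
    [/\ posdef S,
      (forall v, 2^-1 * quadf Sigma v <= quadf S v /\ quadf S v <= 2 * quadf Sigma v),
      (exists n lam, est_feasible calI c (fun r => t * B0 r) a n lam) &
      forall n lam, est_minimizer S calI c (fun r => t * B0 r) a n lam ->
      real_obj calI Sigma (fun I => (n I)%:R / t) lam <= Vstar + g]].
Proof.
move=> g0.
(* The 12 comes from [(1 + rho) / (1 - rho) ^ 2 <= 1 + 12 * rho], valid for [rho <= 1 / 2]. *)
pose rho := Num.min 2^-1 (g / (12 * (Vstar + 1))).
have V1 : 0 < 12 * (Vstar + 1) by rewrite mulr_gt0// ltr_wpDl.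
have rho0 : 0 < rho by rewrite lt_min invr_gt0 ltr0n divr_gt0.
have rho2 : rho <= 2^-1 by rewrite ge_min lexx.
have rhog : rho * (12 * (Vstar + 1)) <= g by rewrite -ler_pdivlMr// ge_min lexx orbT.
have rho1 : rho < 1 by lra.
have [delta d0 hd] := quadf_perturbation Sp rho0.
have [T0 T0p hT] := floor_alloc_ge rho0.
exists delta, T0; split => // t S tT Ss SS.
have t0 : 0 < t by exact: lt_le_trans tT.
have SP := quadf_perturbation_posdef Sp rho1 Ss (hd S SS).
have bnd v : (1 - rho) * quadf Sigma v <= quadf S v /\ quadf S v <= (1 + rho) * quadf Sigma v.
  by have := hd S SS v; rewrite ler_norml => /andP[l u]; split; lra.
have q0 v : 0 <= quadf Sigma v by exact: posdef_ge0.
have [w Mw] := info_mx_solve Sp nustar_ge0 nustar_cov.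
have [ff ub fV] := floor_alloc_feasible t0 rho1 Mw (hT t tT).
split => //.
- by move=> v; have [l u] := bnd v; have := q0 v; split; nra.
- by exists (floor_alloc t), (opt_weight Sigma nustar w).
move=> n lam [fn /(_ _ _ ff)]; rewrite -(ler_pM2l t0) !est_objE// => h.
have h1 := real_obj_le calI (fun I => (floor_alloc t I)%:R / t)
  (opt_weight Sigma nustar w) (fun v => (bnd v).2).
have r1 : 0 < 1 - rho by rewrite subr_gt0.
have lower v : quadf Sigma v <= (1 - rho)^-1 * quadf S v.
  by rewrite mulrC ler_pdivlMr// mulrC; exact: (bnd v).1.
have h2 := real_obj_le calI (fun I => (n I)%:R / t) lam lower.
rewrite mulrC ler_pdivlMr// in h2.
set X := real_obj calI Sigma _ lam in h2 *; set Y := real_obj calI S _ lam in h h2.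
set Z := real_obj calI S _ _ in h h1; set W := real_obj calI Sigma _ _ in h1 fV.
have key : X * (1 - rho) * (1 - rho) <= (1 + rho) * Vstar.
  apply: (@le_trans _ _ ((1 + rho) * W * (1 - rho))).
    by rewrite ler_pM2r// (le_trans h2)// (le_trans h).
  by rewrite -mulrA (mulrC W) ler_wpM2l// addr_ge0// ltW.
have r2 : 0 < (1 - rho) * (1 - rho) by rewrite mulr_gt0.
rewrite -(ler_pM2r r2) mulrA (le_trans key)//.
have V0 := Vstar_ge0.
have : (1 + rho) * Vstar <= (Vstar + rho * (12 * Vstar)) * ((1 - rho) * (1 - rho)).
  have -> : (Vstar + rho * (12 * Vstar)) * ((1 - rho) * (1 - rho)) =
    Vstar * ((1 + 12 * rho) * ((1 - rho) * (1 - rho))) by ring.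
  rewrite (mulrC (1 + rho)) ler_wpM2l//.
  have : 0 <= rho * (9 - 23 * rho + 12 * rho ^+ 2).
    apply: mulr_ge0; first exact: ltW.
    have := sqr_ge0 (rho - 2^-1); nra.
  lra.
move=> /le_trans; apply; rewrite ler_wpM2r ?(ltW r2)// lerD2l (le_trans _ rhog)//.
by rewrite ler_wpM2l ?(ltW rho0)// ler_wpM2l// lerDl.
Qed.

(** Its weights compete with the optimal ones for the same allocation, whose value attains the dual
    bound, so the duality gap of a minimizer is zero. *)
Lemma minimizer_weightE (t : R) (S : 'M[R]_k) n lam : 0 < t -> posdef S ->
  est_minimizer S calI c (fun r => t * B0 r) a n lam ->
  exists2 w, info_mx S calI (fun I => (n I)%:R / t) *m w = a &
  forall I, I \in calI -> (0 < n I)%N ->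
    t / (n I)%:R *: lam I = invmx (subM S I) *m (projI R I *m w).
Proof.
move=> t0 SP [fn mn]; have [nC nB ub] := (est_feasibleE calI c B0 a n lam t0).1 fn.
pose nu I := (n I)%:R / t.
have nu0 I : 0 <= nu I by rewrite divr_ge0// ltW.
have [w Mw] := info_mx_solve SP nu0 (unbiased_covering ub).
have fopt : est_feasible calI c (fun r => t * B0 r) a n (opt_weight S nu w).
  apply/(est_feasibleE calI c B0 a n _ t0); split=> //.
  exact: opt_weight_unbiased.
have := mn _ _ fopt; rewrite -(ler_pM2l t0) !est_objE//.
rewrite (real_obj_opt_weight SP nu0 Mw) => le.
exists w => // I IC nI.
have nuI : 0 < nu I by rewrite divr_gt0// ltr0n.
rewrite (real_obj_min_opt_weight SP nu0 ub Mw le IC nuI) /opt_weight scalerA.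
rewrite (_ : _ * _ = 1) ?scale1r// /nu.
by field; rewrite gt_eqF//= pnatr_eq0 -lt0n.
Qed.

(** The limiting dual solution [w] is inserted into the exact gap at [nu]. The dual objective
    changes by at most [g * Q] between [nustar] and [nu], so the gap is at most [g * (1 + Q)]; it
    dominates each square, whose weight [nu I] is bounded below. *)
Lemma near_optimal_weight (w : 'cV[R]_k) (e : R) : 0 < e ->
  info_mx Sigma calI nustar *m w = a ->
  exists2 g : R, 0 < g & forall (nu : {set 'I_k} -> R)
      (lam : forall I : {set 'I_k}, 'cV[R]_#|I|), (forall I, 0 <= nu I) -> unbiased calI a nu lam ->
    (forall I, I \in calI -> `|nu I - nustar I| <= g) ->
    real_obj calI Sigma nu lam <= Vstar + g ->
    forall I, I \in calI -> 0 < nustar I -> 0 < nu I /\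
      sqnorm ((nu I)^-1 *: lam I - invmx (subM Sigma I) *m (projI R I *m w)) <= e.
Proof.
move=> e0 Mw; have [cl cl0 lower] := posdef_lower Sp.
pose Q := \sum_(I in calI) iquad Sigma I w.
have Q0 : 0 <= Q by apply: sumr_ge0 => I _; exact: iquad_ge0.
(* A lower bound for all positive [nustar I] at once; those equal to 0 add nothing to the sum of
   inverses. *)
have [nm nm0 nmP] : exists2 nm, 0 < nm & forall I, 0 < nustar I -> nm <= nustar I.
  exists (1 + \sum_I (nustar I)^-1)^-1.
    by rewrite invr_gt0 ltr_wpDr// sumr_ge0// => I _; rewrite invr_ge0.
  move=> I nI; rewrite -[leRHS]invrK lef_pV2 ?posrE ?invr_gt0//; last first.
    by rewrite ltr_wpDr// sumr_ge0// => J _; rewrite invr_ge0.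
  rewrite (bigD1 I)//= addrCA lerDl addr_ge0// sumr_ge0// => J _.
  by rewrite invr_ge0.
pose g := Num.min (nm / 2) (e * cl * (nm / 2) / (1 + Q)).
have nm2 : 0 < nm / 2 by rewrite divr_gt0.
have Q1 : 0 < 1 + Q by rewrite ltr_wpDr.
have g0 : 0 < g by rewrite lt_min nm2 divr_gt0// !mulr_gt0.
have g1 : g <= nm / 2 by rewrite ge_min lexx.
have g2 : g * (1 + Q) <= e * cl * (nm / 2).
  by rewrite -ler_pdivlMr// ge_min lexx orbT.
exists g => // nu lam nu0 ub nus obj I IC nI.
have nuI : nm / 2 <= nu I.
  have := nus I IC; have := nmP I nI; rewrite ler_norml => h /andP[l _]; lra.
have nuI0 : 0 < nu I by exact: lt_le_trans nuI.
split=> //.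
have idn := real_obj_identity Sp w nu0 ub.
have VE : Vstar = dual_obj Sigma calI a nustar w.
  by rewrite (var_obj_solution Sp Mw) (dual_obj_solution Mw).
have dual : dual_obj Sigma calI a nustar w - dual_obj Sigma calI a nu w <= g * Q.
  rewrite /dual_obj opprB addrC addrA subrK -sumrB mulr_sumr.
  apply: ler_sum => J JC; rewrite -mulrBl ler_wpM2r ?iquad_ge0//.
  by rewrite (le_trans (ler_norm _))// nus.
set x := _ - _.
have tm : nu I * quadf (subM Sigma I) x <= g * (1 + Q).
  have : nu I * quadf (subM Sigma I) x <= real_obj calI Sigma nu lam - dual_obj Sigma calI a nu w.
    rewrite idn addrAC subrr add0r (bigD1 I) /=; last by rewrite IC.
    rewrite lerDl; apply: sumr_ge0 => J /andP[/andP[_ nuJ] _].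
    by rewrite mulr_ge0// posdef_ge0//; exact: posdef_subM.
  by move: obj dual; rewrite -VE; lra.
have qx : cl * sqnorm x <= quadf (subM Sigma I) x.
  by rewrite quadf_subM -(sqnorm_trmx_projI x).
have nc : 0 < cl * (nm / 2) by rewrite mulr_gt0.
rewrite -(ler_pM2l nc) [leRHS]mulrC [leRHS]mulrA.
apply: le_trans g2; apply: le_trans tm.
rewrite (mulrC cl) -mulrA; apply: ler_pM => //; first exact: ltW.
by rewrite mulr_ge0 ?sqnorm_ge0// ltW.
Qed.

(** On coordinates covered by [nustar], the dual solution [wh] for the estimated covariance is
    bounded because the weights there are close to their limits. [peeling_bound] carries this to
    every set in use, including those with [nustar I = 0]. All constants come from [Sigma] and [w],
    so [C] precedes [e]. *)
Lemma design_asymptotics (w : 'cV[R]_k) : info_mx Sigma calI nustar *m w = a ->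
  exists C : R, forall e : R, 0 < e ->
  exists delta T0 : R, [/\ 0 < delta, 0 < T0 & forall t S, T0 <= t -> S^T = S ->
    (forall i j, `|S i j - Sigma i j| <= delta) ->
    (exists n lam, est_minimizer S calI c (fun r => t * B0 r) a n lam) /\
    forall n lam, est_minimizer S calI c (fun r => t * B0 r) a n lam ->
    [/\ (forall I, I \in calI -> `|(n I)%:R / t - nustar I| <= e),
        (forall I i, I \in calI -> 0 < nustar I -> (0 < n I)%N /\
           `|t / (n I)%:R * lam I i 0 -
             (invmx (subM Sigma I) *m (projI R I *m w)) i 0| <= e) &
        (forall I i, I \in calI -> (0 < n I)%N ->
           `|t / (n I)%:R * lam I i 0| <= C)]].
Proof.
move=> Mw; have [cl0 cl00 lower0] := posdef_lower Sp.
pose cl := 2^-1 * cl0; have clp : 0 < cl by rewrite mulr_gt0// invr_gt0.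
pose cu := 2 * sumabs Sigma; have cu0 : 0 <= cu by rewrite mulr_ge0// sumabs_ge0.
pose ustar I := invmx (subM Sigma I) *m (projI R I *m w).
(* Bounds [sqnorm (P_J wh)] when [nustar J > 0]: it is at most [cu ^ 2 * sqnorm u] for the rescaled
   weight [u], which is within squared distance 1 of [ustar J]. *)
pose b := cu * (cu * (2 * \sum_I sqnorm (ustar I) + 2)).
have b0 : 0 <= b.
  apply: mulr_ge0 => //; apply: mulr_ge0 => //; apply: addr_ge0 => //.
  by apply: mulr_ge0 => //; apply: sumr_ge0 => I _; exact: sqnorm_ge0.
pose K : R := cu / cl * (#|calI|%:R * k%:R) + 1.
have K0 : 0 <= K.
  apply: addr_ge0 => //; apply: mulr_ge0; last exact: mulr_ge0.
  by apply: divr_ge0 => //; exact: ltW.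
pose C := (k%:R * (K ^+ k * b)) / cl ^+ 2 + 1.
exists C => e e0.
(* [e ^ 2] turns the bound on a squared norm into the bound [e] on entries; 1 makes [b] independent
   of [e]. *)
pose e1 := Num.min e (Num.min 1 (e ^+ 2)).
have e10 : 0 < e1 by rewrite !lt_min e0 ltr01 exprn_gt0.
have [g g0 gP] := near_optimal_weight e10 Mw.
have m0 : 0 < Num.min g e by rewrite lt_min g0.
have [g' g'0 g'P] := near_optimal_close Sp c0 B0_gt0 nustar_feasible nustar_min
  nustar_unique m0.
have mg0 : 0 < Num.min g g' by rewrite lt_min g0.
have [delta [T0 [d0 T00 H]]] := minimizer_near_optimal mg0.
exists delta, T0; split=> // t S tT Ss SS.
have t0 : 0 < t by exact: lt_le_trans tT.
have [SP Sb Sf near] := H t S tT Ss SS.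
split; first exact: est_minimizer_exists.
move=> n lam mn; have obj := near n lam mn.
have [nC nB ub] := (est_feasibleE calI c B0 a n lam t0).1 mn.1.
pose nu I := (n I)%:R / t.
have nu0 I : 0 <= nu I by rewrite divr_ge0// ltW.
have fnu : cont_feasible calI c B0 a nu.
  split=> //; first by move=> I IC; rewrite /nu nC// mul0r.
  exact: unbiased_covering ub.
have cls : forall I, I \in calI -> `|nu I - nustar I| <= Num.min g e.
  apply: g'P => //; apply: le_trans (var_obj_le_real_obj Sp nu0 ub) _.
  by rewrite (le_trans obj)// lerD2l ge_min lexx orbT.
have cls1 I : I \in calI -> `|nu I - nustar I| <= g.
  by move=> IC; rewrite (le_trans (cls I IC))// ge_min lexx.
have wgt : forall I, I \in calI -> 0 < nustar I -> 0 < nu I /\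
      sqnorm ((nu I)^-1 *: lam I - ustar I) <= e1.
  apply: gP => //; rewrite (le_trans obj)// lerD2l ge_min lexx//.
have nuV I : (nu I)^-1 = t / (n I)%:R by rewrite /nu invf_div.
have nuE I : (0 < nu I) = (0 < n I)%N by rewrite /nu pmulr_lgt0 ?invr_gt0// ltr0n.
split.
- by move=> I IC; rewrite (le_trans (cls I IC))// ge_min lexx orbT.
- move=> I i IC nI; have [nuI sq] := wgt I IC nI; split; first by rewrite -nuE.
  rewrite nuV in sq; have := sqnorm_entry ((t / (n I)%:R) *: lam I - ustar I) i.
  rewrite mxE [X in X + _]mxE [X in _ + X]mxE => /le_trans/(_ sq) h.
  rewrite -(ler_pXn2r (ltn0Sn 1)) ?nnegrE ?(ltW e0)// real_normK ?num_real//.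
  by rewrite (le_trans h)// !ge_min lexx !orbT.
move=> I i IC nI.
have [wh Mwh lamE] := minimizer_weightE t0 SP mn.
have lowS v : cl * sqnorm v <= quadf S v.
  apply: le_trans (Sb v).1; rewrite -mulrA ler_wpM2l ?invr_ge0//.
have uppS v : quadf S v <= cu * sqnorm v.
  apply: le_trans (Sb v).2 _; rewrite -mulrA ler_wpM2l//.
  by rewrite (le_trans (ler_norm _))// quadf_sumabs.
have lowI J v : cl * sqnorm v <= quadf (subM S J) v.
  by rewrite quadf_subM -(sqnorm_trmx_projI v).
have uppI J v : quadf (subM S J) v <= cu * sqnorm v.
  by rewrite quadf_subM -(sqnorm_trmx_projI v).
pose A := [set j : 'I_k | [exists J in calI, (0 < nustar J) && (j \in J)]]%SET.
have aA j : a j 0 != 0 -> j \in A.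
  move=> /nustar_cov[J JC [nJ jJ]]; rewrite inE; apply/exists_inP; exists J => //.
  by rewrite nJ.
have wA j : j \in A -> wh j 0 ^+ 2 <= b.
  rewrite inE => /exists_inP[J JC /andP[nJ jJ]].
  have [nuJ sq] := wgt J JC nJ.
  have uE : (nu J)^-1 *: lam J = invmx (subM S J) *m (projI R J *m wh).
    by rewrite nuV lamE// -nuE.
  set u := (nu J)^-1 *: lam J in uE sq.
  have yb : sqnorm (projI R J *m wh) <= cu * (cu * sqnorm u).
    apply: le_trans (quadf_invmx_ge (posdef_subM J SP) (uppI J) _) _.
    by rewrite ler_wpM2l// quadf_invmx -?uE//; exact: posdef_subM.
  apply: (@le_trans _ _ (sqnorm (projI R J *m wh))).
    by rewrite -(enum_rankK_in jJ jJ) -projI_mulmxE; exact: sqnorm_entry.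
  apply: (le_trans yb); rewrite /b !ler_wpM2l//.
  have s1 : sqnorm (u - ustar J) <= 1 by rewrite (le_trans sq)// !ge_min lexx !orbT.
  have s2 : sqnorm (ustar J) <= \sum_I sqnorm (ustar I).
    by rewrite (bigD1 J)//= lerDl sumr_ge0// => I' _; exact: sqnorm_ge0.
  have : sqnorm u <= 2 * sqnorm (ustar J) + 2 * sqnorm (u - ustar J).
    rewrite /sqnorm !mulr_sumr -big_split/=; apply: ler_sum => l _.
    have -> : (u - ustar J) l 0 = u l 0 - ustar J l 0 by rewrite mxE [X in _ + X]mxE.
    have := sqr_ge0 (u l 0 - 2 * ustar J l 0); nra.
  lra.
have pb := peeling_bound SP clp lowS uppS nu0 Mwh cu0 b0 aA wA IC.
rewrite nuE in pb; have {}pb := pb nI.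
have uE := lamE I IC nI.
have := sqnorm_invmx_le (posdef_subM I SP) clp (lowI I) (projI R I *m wh).
rewrite -uE => h.
have yb : sqnorm (projI R I *m wh) <= k%:R * (K ^+ k * b).
  rewrite /sqnorm.
  under eq_bigr do rewrite projI_mulmxE.
  rewrite -(big_enum_val (fun j => wh j 0 ^+ 2)).
  apply: (@le_trans _ _ (\sum_(j in I) (K ^+ k * b))); first exact: ler_sum.
  rewrite sumr_const -[leLHS]mulr_natl ler_wpM2r//.
    by rewrite mulr_ge0// exprn_ge0.
  by rewrite ler_nat -[X in (_ <= X)%N]card_ord max_card.
have c2 : 0 < cl ^+ 2 by rewrite exprn_gt0.
have : (t / (n I)%:R * lam I i 0) ^+ 2 <= (k%:R * (K ^+ k * b)) / cl ^+ 2.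
  rewrite ler_pdivlMr// mulrC (le_trans _ yb)// (le_trans _ h)// ler_wpM2l ?(ltW c2)//.
  by have := sqnorm_entry (t / (n I)%:R *: lam I) i; rewrite mxE.
rewrite /C; set y := t / _ * _; set z := _ / _.
rewrite -(real_normK (num_real y)) => yz.
have := sqr_ge0 (`|y| - 1); nra.
Qed.

End allocation.

(** * Convergence in distribution by approximation *)

(** Heine's theorem by compact covering, with only [x] confined to the segment: the perturbed point
    [y] may leave it. *)
Lemma uniformly_continuous_segment (R : realType) (f : R -> R) (a b e : R) :
  continuous f -> 0 < e ->
  exists2 dl, 0 < dl & forall x y, a <= x <= b -> `|x - y| <= dl -> `|f x - f y| <= e.
Proof.
move=> cf e0; have := @segment_compact R a b.
move/compact_near_coveringP => /(_ _ (nbhs (0:R)^'+)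
  (fun dl x => forall y, `|x - y| <= dl -> `|f x - f y| <= e) _) cov.
have e20 : 0 < e / 2 by rewrite divr_gt0.
suff : \forall dl \near (0:R)^'+, `[a, b]%classic `<=`
    (fun x => forall y, `|x - y| <= dl -> `|f x - f y| <= e).
  move=> h; near (0:R)^'+ => dl; exists dl => //.
  by move=> x y xab; apply: (near h dl) => //=; rewrite in_itv.
apply: cov => x _.
have /cvgrPdist_lt/(_ _ e20) := cf x; case/nbhs_ballP => r /= r0 fr.
have r20 : 0 < r / 2 by rewrite divr_gt0.
exists (ball x (r / 2), [set dl | dl <= r / 2]) => /=.
  by split; [exact: nbhsx_ballx|exact: nbhs_right_le].
move=> [x' dl] /= [xx' dlr] y xy.
have fx' : `|f x - f x'| < e / 2.
  by apply: fr; move: xx'; rewrite /ball/= => /lt_le_trans; apply; lra.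
have fy : `|f x - f y| < e / 2.
  apply: fr; rewrite /ball/=; move: xx'; rewrite /ball/= => xx'.
  rewrite (_ : x - y = (x - x') + (x' - y)); last by ring.
  by rewrite (le_lt_trans (ler_normD _ _))//; lra.
rewrite (_ : f x' - f y = (f x - f y) - (f x - f x')); last by ring.
by rewrite (le_trans (ler_normB _ _))//; lra.
Unshelve. all: by end_near. Qed.

Lemma le_normr_Rintegral_off d (T : measurableType d) (R : realType)
    (P : probability T R) (F G : T -> R) (B : set T) (e M p : R) :
  measurable_fun setT F -> measurable_fun setT G ->
  (forall w, `|F w| <= M) -> (forall w, `|G w| <= M) ->
  measurable B -> (P B <= p%:E)%E -> 0 <= e ->
  (forall w, ~ B w -> `|F w - G w| <= e) ->
  `|\int[P]_w F w - \int[P]_w G w| <= e + 2 * M * p.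
Proof.
move=> mF mG FM GM mB Bp e0 FG.
have M0 : 0 <= M by rewrite (le_trans _ (FM point)).
have iF : P.-integrable setT (EFin \o F) by apply: (bounded_integrable P mF FM).
have iG : P.-integrable setT (EFin \o G) by apply: (bounded_integrable P mG GM).
rewrite -RintegralB//.
have mFG : measurable_fun setT (fun w => F w - G w) by exact: measurable_funB.
rewrite (le_trans (le_normr_Rintegral _ _))//; first by apply: (integrableB _ iF iG).
pose H w : R := e + 2 * M * \1_B w.
have mH : measurable_fun setT H.
  by apply: measurable_funD => //; apply: measurable_funM => //.
have HM w : `|H w| <= e + 2 * M.
  rewrite ger0_norm /H; last by rewrite addr_ge0// !mulr_ge0.
  by rewrite lerD2l ler_piMr ?mulr_ge0// indicE; case: (_ \in _).
have iH : P.-integrable setT (EFin \o H) by apply: (bounded_integrable P mH HM).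
have HE : \int[P]_w H w = e + 2 * M * fine (P B).
  rewrite /H RintegralD//; last 2 first.
  - by apply: (bounded_integrable P (M := e)) => // w; rewrite ger0_norm.
  - apply: (bounded_integrable P (M := 2 * M)); first by apply: measurable_funM.
    move=> w; rewrite ger0_norm ?mulr_ge0//.
    by rewrite ler_piMr ?mulr_ge0// indicE; case: (_ \in _).
  rewrite Rintegral_cst_prob; congr (_ + _).
  rewrite /Rintegral; under eq_integral do rewrite EFinM.
  rewrite ge0_integralZl//=; last 2 first.
  - by apply/measurable_EFinP.
  - by rewrite lee_fin mulr_ge0.
  by rewrite integral_indic// setIT fineM//= fin_num_measure.
apply: (@le_trans _ _ (\int[P]_w H w)).
  apply: le_Rintegral => //.
    by apply: integrable_norm => //; apply: (integrableB _ iF iG).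
  move=> w _; rewrite /H indicE.
  have [_|nB] := boolP (w \in B).
    rewrite mulr1 (le_trans (ler_normB _ _))//.
    by have := FM w; have := GM w; lra.
  by rewrite mulr0 addr0; apply: FG => Bw; move/negP: nB; apply; exact: mem_set.
rewrite HE lerD2l ler_wpM2l ?mulr_ge0// -lee_fin fineK// fin_num_measure//.
Qed.

Lemma integral_normal_gauss_avg (R : realType) (s M : R) (f : R -> R) : 0 < s ->
  continuous f -> (forall x, `|f x| <= M) ->
  (\int[normal_prob 0 s]_x (f x)%:E = (gauss_avg s f 0)%:E)%E.
Proof.
move=> s0 cf fM.
have M0 : 0 <= M by rewrite (le_trans _ (fM 0)).
have mf : measurable_fun setT f by exact: continuous_measurable_fun.
have fM0 x : 0 <= f x + M.
  by have := fM x; rewrite ler_norml => /andP[+ _]; lra.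
have cfM : continuous (fun x => f x + M).
  by move=> x; apply: cvgD; [exact: cf|exact: cvg_cst].
have fM2 x : `|f x + M| <= M + M.
  by rewrite (le_trans (ler_normD _ _))// (ger0_norm M0) lerD2r.
have iN (s' : R) : (normal_prob 0 s').-integrable setT (EFin \o f).
  exact: (bounded_integrable (normal_prob 0 s') mf fM).
have iC (s' : R) : (normal_prob 0 s').-integrable setT (EFin \o cst M).
  apply: (bounded_integrable (normal_prob 0 s') (M := M)) => // x.
  by rewrite ger0_norm.
have split1 : (\int[normal_prob 0 s]_x (f x + M)%:E =
    \int[normal_prob 0 s]_x (f x)%:E + M%:E)%E.
  under eq_integral do rewrite EFinD.
  rewrite integralD//; try exact: iN; try exact: iC.
  by rewrite integral_cst//= probability_setT mule1.
have := ge0_integral_normal_scale s0 cfM fM0; rewrite split1.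
have -> : (\int[normal_prob 0 1]_x (f (s * x) + M)%:E =
    (gauss_avg s (fun x => f x + M) 0)%:E)%E.
  rewrite (EFin_gauss_avg s 0 _ fM2); last exact: continuous_measurable_fun.
  by apply: eq_integral => x _; rewrite add0r.
rewrite (gauss_avgDr s M 0 mf fM) EFinD.
rewrite -[X in (X + _ = _)%E](fineK (x := (gauss_avg s f 0)%:E))//.
by move/(congr1 (fun x => x - M%:E)%E); rewrite !addeK.
Qed.

Lemma chebyshev_gaussian (R : realType) (s x : R) : 0 < x ->
  (normal_prob 0 1 [set z | (x < `|s * z|)%R] <= (s ^+ 2 / x ^+ 2)%:E)%E.
Proof.
move=> x0.
have [ms i2 _ e2] := scaled_normal_moments s.
by have := @chebyshev_second_moment _ _ R (@normal_prob R 0 1) (fun z : R => s * z) x x0 ms i2; rewrite e2.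
Qed.

(* Replacing Y by Z, the test function f by its mollification g, and Z by the
   Gaussian each costs the oscillation of f on a segment plus tail masses. *)
Lemma cvg_dist_normal_approx d (T : measurableType d) (R : realType)
    (P : probability T R) (Y Z : R -> T -> R) (V C : R) : 0 < V ->
  (forall t, measurable_fun setT (Y t)) -> (forall t, measurable_fun setT (Z t)) ->
  (forall x eta, 0 < x -> 0 < eta ->
    \forall t \near +oo, (P [set w | (x < `|Y t w - Z t w|)%R] <= eta%:E)%E) ->
  (\forall t \near +oo, P.-integrable setT (EFin \o (fun w => Z t w ^+ 2)) /\
    \int[P]_w (Z t w ^+ 2) <= C) ->
  (forall (g : R -> R) (K L M : R), 0 <= K -> 0 <= L -> continuous g ->
     (forall x, `|g x| <= M) -> taylor2_class K L g ->
     \int[P]_w g (Z t w) @[t --> +oo] --> gauss_avg (Num.sqrt V) g 0) ->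
  cvg_dist_normal P Y V.
Proof.
move=> V0 mY mZ YZ Z2 Zg f cf [M0 fM0].
have [M M_gt0 fM] : exists2 M, 0 < M & forall x, `|f x| <= M.
  exists (Num.max 1 M0); first by rewrite lt_max ltr01.
  by move=> x; rewrite le_max fM0 orbT.
have mf : measurable_fun setT f by exact: continuous_measurable_fun.
have sV0 : 0 < Num.sqrt V by rewrite sqrtr_gt0.
rewrite (integral_normal_gauss_avg sV0 cf fM).
have EY t : 'E_P[f \o Y t]%E = (\int[P]_w f (Y t w))%:E.
  rewrite unlock /Rintegral fineK//.
  apply: (integrable_fin_num (mu := P)) => //.
  by apply: (bounded_integrable P (M := M)) => //; exact: measurableT_comp.
rewrite (_ : (fun t => _) = (fun t => (\int[P]_w f (Y t w))%:E)); last first.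
  by apply/funext => t; exact: EY.
apply: cvg_EFin; first by near=> t.
apply/cvgrPdist_le => eps eps0.
(* The replacements produce five errors [e] and three tail masses weighted by [2 * M]; the latter
   add up to the sixth [e] by the choice of [A]. *)
pose e := eps / 6.
have e0 : 0 < e by rewrite divr_gt0.
pose C' := Num.max C V.
have C'0 : 0 < C' by rewrite lt_max V0 orbT.
(* [C'] bounds the second moments of both [Z] and the Gaussian. With [A >= 1], hence [A <= A ^ 2],
   Chebyshev's bound can be met without a square root. *)
pose A := Num.max 1 (6 * M * C' / e).
have A0 : 0 < A by rewrite lt_max ltr01.
have A1 : 1 <= A by rewrite le_max lexx.
have C'A : 6 * M * (C' / A ^+ 2) <= e.
  rewrite mulrA ler_pdivrMr ?exprn_gt0//.
  have : 6 * M * C' / e <= A by rewrite le_max lexx orbT.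
  rewrite ler_pdivrMr// => /le_trans; apply.
  by rewrite mulrC ler_wpM2l ?(ltW e0)// expr2 ler_peMl// ltW.
have [dl dl0 fdl] := uniformly_continuous_segment (- A) A cf e0.
(* The mollification with step [h] moves the argument of [f] by at most [3 * h]. *)
have h0 : 0 < dl / 3 by rewrite divr_gt0.
have [g [K [L [K0 L0 cg gKL gf]]]] := mollify cf fM h0.
have gM x : `|g x| <= M by have [y [_ _ ->]] := gf x.
have mg : measurable_fun setT g by exact: continuous_measurable_fun.
have fg x : `|x| <= A -> `|f x - g x| <= e.
  move=> xA; have [y [xy yx ->]] := gf x; apply: fdl; first by rewrite -ler_norml.
  rewrite distrC ger0_norm ?subr_ge0//.
  by move: yx; rewrite -mulrnAr; have -> : (3^-1 : R) *+ 3 = 1 by [field|]; lra.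
have Ngf : `|gauss_avg (Num.sqrt V) g 0 - gauss_avg (Num.sqrt V) f 0| <=
    e + 2 * M * (C' / A ^+ 2).
  apply: (@le_normr_Rintegral_off _ _ _ (normal_prob 0 1) _ _
    [set z | A < `|Num.sqrt V * z|]) => //.
  - by apply: (measurableT_comp mg); exact: measurable_fun_affine.
  - by apply: (measurableT_comp mf); exact: measurable_fun_affine.
  - by apply: measurable_norm_gt; exact: measurable_funM.
  - apply: (le_trans (chebyshev_gaussian _ A0)).
    rewrite lee_fin sqr_sqrtr ?(ltW V0)// ler_wpM2r ?invr_ge0 ?exprn_ge0 ?(ltW A0)//.
    by rewrite le_max lexx orbT.
  - exact: ltW.
  - move=> z /negP; rewrite -leNgt => zA; rewrite distrC add0r; exact: fg.
have eta0 : 0 < e / (2 * M) by rewrite divr_gt0// mulr_gt0.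
have Zg' := (cvgrPdist_le _ _).1 (Zg g K L M K0 L0 cg gM gKL) e e0.
near=> t.
have [i2 E2] : P.-integrable setT (EFin \o (fun w => Z t w ^+ 2)) /\
    \int[P]_w (Z t w ^+ 2) <= C by near: t.
have PZ : (P [set w | (A < `|Z t w|)%R] <= (C' / A ^+ 2)%:E)%E.
  apply: (le_trans (chebyshev_second_moment A0 (mZ t) i2)).
  rewrite lee_fin ler_wpM2r ?invr_ge0 ?exprn_ge0 ?(ltW A0)//.
  by rewrite le_max E2.
have PYZ : (P [set w | (dl < `|Y t w - Z t w|)%R] <= (e / (2 * M))%:E)%E.
  by near: t; exact: YZ.
have mYZ : measurable [set w | dl < `|Y t w - Z t w|].
  by apply: measurable_norm_gt; exact: measurable_funB.
have mZA : measurable [set w | A < `|Z t w|] by exact: measurable_norm_gt.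
have s1 : `|\int[P]_w f (Y t w) - \int[P]_w f (Z t w)| <=
    e + 2 * M * (e / (2 * M) + C' / A ^+ 2).
  apply: (@le_normr_Rintegral_off _ _ _ P _ _
    ([set w | dl < `|Y t w - Z t w|] `|` [set w | A < `|Z t w|])) => //.
  - exact: measurableT_comp.
  - exact: measurableT_comp.
  - exact: measurableU.
  - by rewrite EFinD; apply: (le_trans (measureU2 P mYZ mZA)); exact: leeD.
  - exact: ltW.
  - move=> w /not_orP[/negP + /negP]; rewrite -!leNgt => YZw ZA.
    by rewrite distrC; apply: fdl; rewrite -?ler_norml// distrC.
have s2 : `|\int[P]_w f (Z t w) - \int[P]_w g (Z t w)| <= e + 2 * M * (C' / A ^+ 2).
  apply: (@le_normr_Rintegral_off _ _ _ P _ _ [set w | A < `|Z t w|]) => //.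
  - exact: measurableT_comp.
  - exact: measurableT_comp.
  - exact: ltW.
  - by move=> w /negP; rewrite -leNgt; exact: fg.
have s3 : `|gauss_avg (Num.sqrt V) g 0 - \int[P]_w g (Z t w)| <= e.
  by near: t; exact: Zg'.
have eE : 2 * M * (e / (2 * M)) = e by field; rewrite gt_eqF.
rewrite distrC in s3; rewrite distrC.
have -> : \int[P]_w f (Y t w) - gauss_avg (Num.sqrt V) f 0 =
  (\int[P]_w f (Y t w) - \int[P]_w f (Z t w)) +
  ((\int[P]_w f (Z t w) - \int[P]_w g (Z t w)) +
  ((\int[P]_w g (Z t w) - gauss_avg (Num.sqrt V) g 0) +
   (gauss_avg (Num.sqrt V) g 0 - gauss_avg (Num.sqrt V) f 0))) by ring.
apply: le_trans (ler_normD _ _) _; apply: le_trans (lerD s1 (ler_normD _ _)) _.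
apply: le_trans (lerD (lexx _) (lerD s2 (ler_normD _ _))) _.
apply: le_trans (lerD (lexx _) (lerD (lexx _) (lerD s3 Ngf))) _.
rewrite mulrDr eE.
move: C'A; set q := C' / A ^+ 2 => C'A.
have -> : eps = 6 * e by rewrite /e; field.
have -> : 2 * M * q = 6 * M * q / 3 by field.
lra.
Unshelve. all: by end_near. Qed.

(** * Operator norm and measurability *)

Section operator_norm.
Context (R : realType) (n : nat).
Implicit Types (A : 'M[R]_n) (v : 'cV[R]_n).

Lemma vnorm2_ge0 v : 0 <= vnorm2 v. Proof. exact: sqrtr_ge0. Qed.

Lemma sqr_vnorm2 v : vnorm2 v ^+ 2 = sqnorm v.
Proof. by rewrite sqr_sqrtr// sqnorm_ge0. Qed.

Lemma vnorm2Z (c : R) v : vnorm2 (c *: v) = `|c| * vnorm2 v.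
Proof.
rewrite -sqrtr_sqr -sqrtrM ?sqr_ge0//; congr Num.sqrt.
by rewrite mulr_sumr; apply: eq_bigr => i _; rewrite mxE exprMn.
Qed.

Lemma vnorm20 : vnorm2 (0 : 'cV[R]_n) = 0.
Proof. by rewrite -(scale0r 0) vnorm2Z normr0 mul0r. Qed.

Lemma entry_le_vnorm2 v i : `|v i 0| <= vnorm2 v.
Proof. by rewrite -sqrtr_sqr ler_sqrt ?sqnorm_ge0// sqnorm_entry. Qed.

Lemma opnorm_has_ubound A :
  has_ubound [set vnorm2 (A *m v) | v in [set v | vnorm2 v <= 1]].
Proof.
exists (Num.sqrt (\sum_i (\sum_j `|A i j|) ^+ 2)) => _ [v /= v1 <-].
rewrite ler_sqrt; last by apply: sumr_ge0 => i _; exact: sqr_ge0.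
apply: ler_sum => i _; rewrite -(real_normK (num_real (_ i 0))).
rewrite ler_sqr ?nnegrE ?sumr_ge0// mxE (le_trans (ler_norm_sum _ _ _))//.
apply: ler_sum => j _; rewrite normrM ler_piMr//.
exact: le_trans (entry_le_vnorm2 v j) v1.
Qed.

Lemma vnorm2_mulmx_le A v : vnorm2 (A *m v) <= opnorm A * vnorm2 v.
Proof.
have [v0|v0] := eqVneq (vnorm2 v) 0.
  have -> : v = 0 by apply: sqnorm_eq0; rewrite -sqr_vnorm2 v0 expr0n.
  by rewrite mulmx0 vnorm20 mulr0.
have vp : 0 < vnorm2 v by rewrite lt_neqAle eq_sym v0 vnorm2_ge0.
rewrite -ler_pdivrMr// mulrC.
have -> : (vnorm2 v)^-1 * vnorm2 (A *m v) = vnorm2 (A *m ((vnorm2 v)^-1 *: v)).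
  by rewrite -scalemxAr vnorm2Z ger0_norm// invr_ge0 vnorm2_ge0.
apply: ub_le_sup; first exact: opnorm_has_ubound.
exists ((vnorm2 v)^-1 *: v) => //=.
by rewrite vnorm2Z ger0_norm ?invr_ge0 ?vnorm2_ge0// mulVf.
Qed.

Lemma entry_le_opnorm A i j : `|A i j| <= opnorm A.
Proof.
pose u : 'cV[R]_n := delta_mx j 0; have -> : A i j = (A *m u) i 0.
  rewrite mxE (bigD1 j)//= mxE !eqxx mulr1 big1 ?addr0// => l lj.
  by rewrite mxE (negPf lj) mulr0.
rewrite (le_trans (entry_le_vnorm2 _ _))//.
apply: ub_le_sup; first exact: opnorm_has_ubound.
exists u => //=.
rewrite /vnorm2 (bigD1 j)//= mxE !eqxx expr1n big1 ?addr0 ?sqrtr1// => l lj.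
by rewrite mxE (negPf lj) expr0n.
Qed.

Lemma continuous_sqnorm_mulmx A : continuous (fun v => sqnorm (A *m v)).
Proof.
have cadd : continuous (fun xy : R * R => xy.1 + xy.2).
  by move=> x; apply: cvgD; [exact: cvg_fst|exact: cvg_snd].
apply: (@continuous_big _ _ +%R) => [|i _]; first exact: cadd.
have ci : continuous (fun v : 'cV[R]_n => (A *m v) i 0).
  rewrite (_ : (fun v => _) = (fun v : 'cV[R]_n => \sum_j A i j * v j 0)); last first.
    by apply/funext => v; rewrite mxE.
  apply: (@continuous_big _ _ +%R) => [|j _ v]; first exact: cadd.
  apply: (@continuous_comp _ _ _ (fun v : 'cV[R]_n => v j 0) (fun x => A i j * x)).
    exact: coord_continuous.
  exact: mulrl_continuous.
move=> v; apply: (@continuous_comp _ _ _ (fun v => (A *m v) i 0) (fun x => x ^+ 2)).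
  exact: ci.
exact: exprn_continuous.
Qed.

(* Rational vectors suffice, so the event is a countable union. *)
Lemma lt_opnormP A (e : R) : 0 < e -> e < opnorm A <->
  exists q : 'cV[rat]_n,
    e ^+ 2 * sqnorm (map_mx ratr q) < sqnorm (A *m map_mx ratr q).
Proof.
move=> e0; split.
  move=> /sup_gt[|_ [v /= v1 <-] ev].
    exists (vnorm2 (A *m 0)), 0 => //=.
    by rewrite vnorm20 ler01.
  pose F (v : 'cV[R]_n) := sqnorm (A *m v) - e ^+ 2 * sqnorm (1%:M *m v).
  have cF : continuous F.
    move=> u; apply: (@cvgB _ _ _ (nbhs u) _ (fun v => sqnorm (A *m v))
      (fun v => e ^+ 2 * sqnorm (1%:M *m v))); first exact: continuous_sqnorm_mulmx.
    apply: (@continuous_comp _ _ _ (fun v => sqnorm (1%:M *m v)) (fun x => e ^+ 2 * x)).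
      exact: continuous_sqnorm_mulmx.
    exact: mulrl_continuous.
  have Fv : 0 < F v.
    rewrite subr_gt0 mul1mx -!sqr_vnorm2.
    apply: (@le_lt_trans _ _ (e ^+ 2)).
      by rewrite ler_piMr ?sqr_ge0// expr_le1// vnorm2_ge0.
    by rewrite ltr_pXn2r// nnegrE ?vnorm2_ge0// ltW.
  have /(_ _)/nbhs_ballP[] := cvgr_gt _ (cF v) _ Fv.
  move=> r /= r0 rF.
  have qx (x : R) : exists q : rat, `|x - ratr q| < r.
    have : x - r < x + r by rewrite ltrD2l gtrN.
    move=> /rat_in_itvoo[q]; rewrite in_itv/= => /andP[h1 h2]; exists q.
    by rewrite ltr_norml; apply/andP; split; lra.
  have [q qP] := choice qx.
  exists (\col_i q (v i 0)).
  have : 0 < F (map_mx ratr (\col_i q (v i 0))).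
    apply: rF; split=> // i j; rewrite !mxE ord1 /ball/=; exact: qP.
  by rewrite subr_gt0 mul1mx.
move=> [q]; set v := map_mx _ q; rewrite -!sqr_vnorm2 -exprMn => h.
have {h} h : e * vnorm2 v < vnorm2 (A *m v).
  by move: h; rewrite ltr_pXn2r// nnegrE ?mulr_ge0 ?vnorm2_ge0// ltW.
have := lt_le_trans h (vnorm2_mulmx_le A v).
have [->|v0] := eqVneq (vnorm2 v) 0; first by rewrite !mulr0 ltxx.
by rewrite ltr_pM2r// lt_neqAle eq_sym v0 vnorm2_ge0.
Qed.

Lemma measurable_opnorm_gt d (T : measurableType d) (M : T -> 'M[R]_n) (e : R) :
  0 < e -> (forall i j, measurable_fun setT (fun w => M w i j)) ->
  measurable [set w | e < opnorm (M w)].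
Proof.
move=> e0 mM.
rewrite (_ : [set w | _] = \bigcup_(q : 'cV[rat]_n)
    [set w | e ^+ 2 * sqnorm (map_mx ratr q) < sqnorm (M w *m map_mx ratr q)]);
  last first.
  apply/seteqP; split => w /=.
    by move=> /lt_opnormP -/(_ e0)[q h]; exists q.
  by move=> [q _ h]; apply/lt_opnormP => //; exists q.
apply: countable_bigcupT_measurable; first exact: countableP.
move=> q; set v := map_mx _ _.
have mf : measurable_fun setT (fun w => sqnorm (M w *m v)).
  apply: measurable_sum => i; apply: measurable_funX.
  rewrite (_ : (fun w => _) = (fun w => \sum_j M w i j * v j 0)); last first.
    by apply/funext => w; rewrite mxE.
  by apply: measurable_sum => j; apply: measurable_funM.
rewrite (_ : [set w | _] =
   (fun w => sqnorm (M w *m v)) @^-1` `]e ^+ 2 * sqnorm v, +oo[%classic); last first.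
  by apply/seteqP; split => w /=; rewrite in_itv/= andbT.
by rewrite -[X in measurable X]setTI; apply: mf => //; exact: measurable_itv.
Qed.

End operator_norm.

Lemma cvg_prob_opnorm_entry d (T : measurableType d) (R : realType)
    (P : probability T R) n (Sh : R -> T -> 'M[R]_n) (S : 'M[R]_n) (dl eta : R) :
  (forall t i j, measurable_fun setT (fun w => Sh t w i j)) ->
  cvg_prob_opnorm P Sh S -> 0 < dl -> 0 < eta ->
  \forall t \near +oo, exists B, [/\ measurable B, (P B <= eta%:E)%E &
    forall w, ~ B w -> forall i j, `|Sh t w i j - S i j| <= dl].
Proof.
move=> mSh ShS dl0 eta0; have := ShS dl dl0.
move=> /fine_cvgP[_ /cvgrPdist_le/(_ eta eta0)] h; near=> t.
have mB : measurable [set w | dl < opnorm (Sh t w - S)].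
  apply: measurable_opnorm_gt => // i j.
  rewrite (_ : (fun w => _) = (fun w => Sh t w i j - S i j)); last first.
    by apply/funext => w; rewrite !mxE.
  exact: measurable_funB.
exists [set w | dl < opnorm (Sh t w - S)]; split=> //.
  have : `|0 - fine (P [set w | dl < opnorm (Sh t w - S)])| <= eta.
    by near: t; exact: h.
  by rewrite sub0r normrN ger0_norm ?fine_ge0// -lee_fin fineK// fin_num_measure.
move=> w /negP; rewrite -leNgt => hw i j; apply: le_trans hw.
by have := entry_le_opnorm (Sh t w - S) i j; rewrite !mxE.
Unshelve. all: by end_near. Qed.

(** The estimator has a random number of summands; the preimage is split according to the countably
    many values of [n]. *)
Lemma measurable_nat_switch d (T : measurableType d) (R : realType) (n : T -> nat)
    (G : nat -> T -> R) : measurable_fun setT (fun w => (n w)%:R : R) ->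
  (forall m, measurable_fun setT (G m)) -> measurable_fun setT (fun w => G (n w) w).
Proof.
move=> mn mG _ Y mY; rewrite setTI.
rewrite (_ : _ @^-1` _ = \bigcup_m
    ((fun w => (n w)%:R : R) @^-1` [set m%:R] `&` G m @^-1` Y)); last first.
  apply/seteqP; split => w /=; first by move=> Yw; exists (n w).
  by move=> [m _ [/eqP]]; rewrite eqr_nat => /eqP -> .
apply: bigcupT_measurable => m; apply: measurableI.
  by rewrite -[X in measurable X]setTI; apply: mn => //; exact: measurable_set1.
by rewrite -[X in measurable X]setTI; exact: mG.
Qed.

Lemma measurable_theta_hat d (T : measurableType d) (R : realType) k
    (calI : {set {set 'I_k}}) (n : T -> {set 'I_k} -> nat)
    (lam : T -> forall I : {set 'I_k}, 'cV[R]_#|I|)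
    (Xa : {set 'I_k} -> nat -> 'I_k -> T -> R) :
  (forall I, measurable_fun setT (fun w => (n w I)%:R : R)) ->
  (forall I i, measurable_fun setT (fun w => lam w I i 0)) ->
  (forall I j i, measurable_fun setT (Xa I j i)) ->
  measurable_fun setT (fun w =>
    theta_hat calI (n w) (lam w) (fun I j => rvec (Xa I j) w)).
Proof.
move=> mn mlam mXa; rewrite /theta_hat.
under eq_fun do rewrite big_mkcond.
apply: measurable_sum => I.
apply: (@measurable_nat_switch _ _ _ (fun w => n w I) (fun m w =>
  if (I \in calI) && (0 < m)%N then m%:R^-1 *
    \sum_(j < m) ((lam w I)^T *m (projI R I *m rvec (Xa I j) w)) 0 0 else 0)) => // m.
case: (_ && _) => //; apply: measurable_funM => //; apply: measurable_sum => j.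
under eq_fun do rewrite mxE.
apply: measurable_sum => i; under eq_fun do rewrite mxE projI_mulmxE mxE.
exact: measurable_funM.
Qed.

(** * The sample array *)

Section equality_in_law.
Context d (T : measurableType d) (R : realType) (P : probability T R) (k : nat).
Implicit Types (Y Z : 'I_k -> T -> R) (v b : 'cV[R]_k).

(** The functional [v^T (Y - b)]; with [b] the mean, the scalar summands of the limit theorem all
    have this form. *)
Definition lin_fun v b Y (w : T) : R := \sum_i v i 0 * (Y i w - b i 0).

Lemma measurable_lin_fun v b Y : (forall i, measurable_fun setT (Y i)) ->
  measurable_fun setT (lin_fun v b Y).
Proof.
by move=> mY; apply: measurable_sum => i; apply: measurable_funM => //;
  exact: measurable_funB.
Qed.

Definition rectangle : set (set ('I_k -> R)) :=
  [set E | exists A, (forall i, measurable (A i)) /\ E = [set x | forall i, A i (x i)]].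

Let jointfun Y (w : T) : 'I_k -> R := fun i => Y i w.

Lemma measurable_lin_rectangle v b (B : set R) : measurable B ->
  <<s rectangle >> [set x | B (\sum_i v i 0 * (x i - b i 0))].
Proof.
move=> mB; pose TT := g_sigma_algebraType rectangle.
have mco i : measurable_fun (setT : set TT) (fun x : TT => x i : R).
  move=> _ A mA; rewrite setTI; apply: sub_sigma_algebra.
  exists (fun j => if j == i then A else setT); split.
    by move=> j; case: ifP.
  apply/seteqP; split => x /=; first by move=> Ax j; case: eqP => [->|].
  by move=> /(_ i); rewrite eqxx.
have ml : measurable_fun (setT : set TT)
    (fun x : TT => \sum_i v i 0 * ((x i : R) - b i 0)).
  by apply: measurable_sum => i; apply: measurable_funM => //; exact: measurable_funB.
by have := ml measurableT B mB; rewrite setTI.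
Qed.

(** The event is not a rectangle in the coordinates but lies in the sigma-algebra generated by
    rectangles, to which equality in law extends by the pi-lambda theorem. *)
Lemma same_law_lin_fun v b Y Z (B : set R) :
  (forall i, measurable_fun setT (Y i)) -> (forall i, measurable_fun setT (Z i)) ->
  same_law P Y Z -> measurable B ->
  P (lin_fun v b Y @^-1` B) = P (lin_fun v b Z @^-1` B).
Proof.
move=> mY mZ YZ mB.
pose H := [set E | [/\ measurable (jointfun Y @^-1` E),
  measurable (jointfun Z @^-1` E) & P (jointfun Y @^-1` E) = P (jointfun Z @^-1` E)]].
have mrect (X' : 'I_k -> T -> R) (A : 'I_k -> set R) : (forall i, measurable_fun setT (X' i)) ->
    (forall i, measurable (A i)) ->
    measurable (\bigcap_(i in [set: 'I_k]) (X' i @^-1` A i)).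
  move=> mX' mA; apply: fin_bigcap_measurable => // i _.
  by rewrite -[X in measurable X]setTI; exact: mX'.
have jE (X' : 'I_k -> T -> R) (A : 'I_k -> set R) : jointfun X' @^-1` [set x | forall i, A i (x i)] =
    \bigcap_(i in [set: 'I_k]) (X' i @^-1` A i).
  by apply/seteqP; split => w h i; [move=> _|]; exact: (h i).
suff : <<s rectangle >> `<=` H.
  by move=> /(_ _ (measurable_lin_rectangle v b mB))[].
rewrite -setI_closed_g_dynkin_g_sigma_algebra; last first.
  move=> _ _ [A [mA ->]] [A' [mA' ->]]; exists (fun i => A i `&` A' i); split.
    by move=> i; exact: measurableI.
  by apply/seteqP; split => x /=; [move=> [h h'] i|move=> h; split => i; case: (h i)].
apply: smallest_sub; last first.
  move=> _ [A [mA ->]]; rewrite /H /= !jE; split; [exact: mrect|exact: mrect|].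
  exact: YZ.
split.
- by rewrite /H /= !preimage_setT; split.
- move=> E [mE mE' EE]; rewrite /H/= -!preimage_setC; split.
  + exact: measurableC.
  + exact: measurableC.
  + by rewrite !probability_setC//= EE.
- move=> F tF mF; rewrite /H /= !preimage_bigcup; split.
  + by apply: bigcup_measurable => i _; case: (mF i).
  + by apply: bigcup_measurable => i _; case: (mF i).
  have tG (X' : 'I_k -> T -> R) : trivIset setT (fun i => jointfun X' @^-1` F i).
    apply/trivIsetP => i j _ _ ij; rewrite -preimage_setI.
    by move/trivIsetP : tF => ->//; rewrite preimage_set0.
  rewrite !measure_bigcup//=; last 2 first.
  + by move=> i _; case: (mF i).
  + by move=> i _; case: (mF i).
  by apply: eq_eseriesr => i _; case: (mF i).
Qed.

Lemma scalar_indep_lin_fun (L : choiceType) (S : set L) (v : L -> 'cV[R]_k) b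
    (Y : L -> 'I_k -> T -> R) : mutually_indep P S Y ->
  scalar_indep P S (fun l => lin_fun (v l) b (Y l)).
Proof.
move=> ind F FS A mA; apply: ind => // l _.
pose TT := g_sigma_algebraType
  [set E | exists i A, measurable (A : set R) /\ E = Y l i @^-1` A].
have mY i : measurable_fun (setT : set TT) (Y l i).
  by move=> _ B mB; rewrite setTI; apply: sub_sigma_algebra; exists i, B.
have mlf : measurable_fun (setT : set TT) (lin_fun (v l) b (Y l)).
  by apply: measurable_sum => i; apply: measurable_funM => //; exact: measurable_funB.
by have := mlf measurableT (A l) (mA l); rewrite setTI.
Qed.

End equality_in_law.

Lemma Rintegral_sum d (T : measurableType d) (R : realType) (P : probability T R)
    I (s : seq I) (h : I -> T -> R) : (forall i, P.-integrable setT (EFin \o h i)) ->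
  P.-integrable setT (EFin \o (fun w => \sum_(i <- s) h i w)) /\
  \int[P]_w (\sum_(i <- s) h i w) = \sum_(i <- s) \int[P]_w h i w.
Proof.
move=> ih; elim: s => [|i s [IH1 IH2]].
  split; last by under eq_Rintegral do rewrite big_nil; rewrite big_nil Rintegral_cst_prob.
  rewrite (_ : _ \o _ = cst 0%E); first exact: integrable0.
  by apply/funext => w /=; rewrite big_nil.
have E : (fun w => \sum_(j <- i :: s) h j w) = (fun w => h i w + \sum_(j <- s) h j w).
  by apply/funext => w; rewrite big_cons.
rewrite E big_cons; split; first exact: (integrableD _ (ih i) IH1).
by rewrite RintegralD// IH2.
Qed.

Section moments.
Context d (T : measurableType d) (R : realType) (P : probability T R) (k : nat).

Lemma equal_law_Rintegral (f g : T -> R) (h : R -> R) :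
  measurable_fun setT f -> measurable_fun setT g -> measurable_fun setT h ->
  (forall B : set R, measurable B -> P (f @^-1` B) = P (g @^-1` B)) ->
  \int[P]_w h (f w) = \int[P]_w h (g w).
Proof.
move=> mf mg mh fg; rewrite /Rintegral; congr fine.
have mh' : measurable_fun setT (EFin \o h) by apply/measurable_EFinP.
have <- := integral_distributionT P (mfun_Sub (mem_set mf)) mh'.
have <- := integral_distributionT P (mfun_Sub (mem_set mg)) mh'.
by apply: eq_measure_integral => A mA _; exact: fg.
Qed.

Lemma equal_law_integrable (f g : T -> R) (h : R -> R) :
  measurable_fun setT f -> measurable_fun setT g -> measurable_fun setT h ->
  (forall B : set R, measurable B -> P (f @^-1` B) = P (g @^-1` B)) ->
  P.-integrable setT (EFin \o (h \o f)) -> P.-integrable setT (EFin \o (h \o g)).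
Proof.
move=> mf mg mh fg /integrableP[_ i]; apply/integrableP; split.
  by apply/measurable_EFinP; exact: measurableT_comp.
have mh' : measurable_fun setT (fun x => `|(h x)%:E|%E).
  by apply: measurableT_comp => //; apply/measurable_EFinP.
have E1 := integral_distributionT P (mfun_Sub (mem_set mf)) mh'.
have E2 := integral_distributionT P (mfun_Sub (mem_set mg)) mh'.
move: i => /=; rewrite -[X in (X < _)%E -> _]E1 -[X in _ -> (X < _)%E]E2.
suff -> : (\int[distribution P (mfun_Sub (mem_set mf))]_y `|(h y)%:E| =
  \int[distribution P (mfun_Sub (mem_set mg))]_y `|(h y)%:E|)%E by [].
by apply: eq_measure_integral => A mA _; exact: fg.
Qed.

Variable X : 'I_k -> T -> R.
Hypothesis X2 : forall i, X i \in Lfun P 2%:E.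
Implicit Type v : 'cV[R]_k.

Let D i (w : T) := X i w - mean_vec P X i 0.

Let D2 i : D i \in Lfun P 2%:E.
Proof.
have -> : D i = X i - cst (mean_vec P X i 0) by [].
by rewrite rpredB//= ?lee1n// => _; exact: Lfun_cst.
Qed.

Let D1_integrable i : P.-integrable setT (EFin \o D i).
Proof.
apply/Lfun1_integrable; apply: Lfun_subset12 (D2 i).
exact: fin_num_measure.
Qed.

Let DD_integrable i j : P.-integrable setT (EFin \o (fun w => D i w * D j w)).
Proof. by apply/Lfun1_integrable; exact: Lfun2_mul_Lfun1. Qed.

Let mean_D i : \int[P]_w D i w = 0.
Proof.
have X1 : P.-integrable setT (EFin \o X i).
  apply/Lfun1_integrable; apply: Lfun_subset12 (X2 i); exact: fin_num_measure.
rewrite /D RintegralB//; last exact: finite_measure_integrable_cst.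
by rewrite Rintegral_cst_prob mxE unlock subrr.
Qed.

Lemma lin_fun_moments v : [/\
  P.-integrable setT (EFin \o (fun w => lin_fun v (mean_vec P X) X w ^+ 2)),
  \int[P]_w lin_fun v (mean_vec P X) X w = 0 &
  \int[P]_w (lin_fun v (mean_vec P X) X w ^+ 2) = quadf (cov_mx P X) v].
Proof.
have iZ (f : T -> R) (c : R) : P.-integrable setT (EFin \o f) ->
    P.-integrable setT (EFin \o (fun w => c * f w)).
  by move=> fi; exact: (integrableZl _ c fi).
have ev i : P.-integrable setT (EFin \o (fun w => v i 0 * D i w)) by exact: iZ.
have evv i j : P.-integrable setT
    (EFin \o (fun w => v i 0 * v j 0 * (D i w * D j w))) by exact: iZ.
have sqE : (fun w => lin_fun v (mean_vec P X) X w ^+ 2) =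
    (fun w => \sum_i \sum_j v i 0 * v j 0 * (D i w * D j w)).
  apply/funext => w; rewrite /lin_fun expr2 mulr_suml; apply: eq_bigr => i _.
  by rewrite mulr_sumr; apply: eq_bigr => j _; rewrite /D; ring.
have e2 i : _ := Rintegral_sum (index_enum 'I_k) (evv i).
have [E2 I2] := Rintegral_sum (index_enum 'I_k) (fun i => (e2 i).1).
have [_ I1] := Rintegral_sum (index_enum 'I_k) ev.
split.
- by rewrite sqE.
- by rewrite I1 big1// => i _; rewrite RintegralZl// mean_D mulr0.
rewrite sqE I2 quadfE dotvE; apply: eq_bigr => i _.
rewrite (e2 i).2 mxE mulr_sumr; apply: eq_bigr => j _.
rewrite RintegralZl// mxE; suff <- : \int[P]_w (D i w * D j w) =
  fine (covariance P (X i) (X j)) by ring.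
rewrite unlock unlock; congr fine.
by apply: eq_integral => w _; rewrite /D !mxE unlock.
Qed.

End moments.

(** Lindeberg's condition: after multiplication by [t] the integrand is the minimum of [K * xi ^ 2]
    and [L * |xi| ^ 3 / sqrt t], dominated and pointwise vanishing. Dominated convergence is applied
    along integers, and monotonicity in [n.+1 <= sqrt t] transfers it to real [t]. *)
Lemma taylor2_err_rescaled_small d (T : measurableType d) (R : realType)
    (P : probability T R) (K L : R) (xi : T -> R) (eta : R) :
  0 <= K -> 0 <= L -> measurable_fun setT xi ->
  P.-integrable setT (EFin \o (fun w => xi w ^+ 2)) -> 0 < eta ->
  \forall t \near +oo, t * taylor2_err P K L (fun w => xi w / Num.sqrt t) <= eta.
Proof.
move=> K0 L0 mxi ixi eta0.
pose G (n : nat) w := Num.min (K * xi w ^+ 2) (L * `|xi w| ^+ 3 / n.+1%:R).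
have mG n : measurable_fun setT (G n).
  apply: measurable_minr.
    by apply: measurable_funM => //; exact: measurable_funX.
  apply: measurable_funM => //; apply: measurable_funM => //.
  by apply: measurable_funX; exact: measurableT_comp.
have G0 n w : 0 <= G n w.
  by rewrite le_min mulr_ge0 ?sqr_ge0//= divr_ge0// mulr_ge0// exprn_ge0.
have GK n w : G n w <= K * xi w ^+ 2 by rewrite ge_min lexx.
have iK : P.-integrable setT (fun w => (K * xi w ^+ 2)%:E).
  exact: (integrableZl _ K ixi).
have iG n : P.-integrable setT (EFin \o G n).
  apply: le_integrable iK => //; first by apply/measurable_EFinP.
  move=> w _ /=; rewrite lee_fin !ger0_norm//.
  exact: le_trans (GK n w).
have Gcvg w : (G n w)%:E @[n --> \oo] --> 0%E.
  apply: cvg_EFin; first by near=> n.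
  apply/cvgrPdist_le => e e0.
  have a0 : 0 < L * `|xi w| ^+ 3 + 1 by rewrite ltr_wpDl// mulr_ge0// exprn_ge0.
  near=> n; rewrite /= sub0r normrN ger0_norm// /G ge_min; apply/orP; right.
  rewrite ler_pdivrMr//.
  have ne : n.+1%:R^-1 <= e / (L * `|xi w| ^+ 3 + 1).
    apply: ltW; near: n.
    exact: (near_infty_natSinv_lt (PosNum (divr_gt0 e0 a0))).
  move: ne; rewrite ler_pdivlMr// mulrC ler_pdivrMr// => h.
  by rewrite (le_trans _ h)// lerDl.
have dom w n : (`|(G n w)%:E| <= (K * xi w ^+ 2)%:E)%E.
  by rewrite /= lee_fin ger0_norm.
have [_ _] := @dominated_convergence _ _ _ P setT measurableT
  (fun n w => (G n w)%:E) (cst 0%E) (fun w => (K * xi w ^+ 2)%:E)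
  (fun n => (measurable_EFinP _ _).2 (mG n)) (measurable_cst _)
  (aeW _ (fun w _ => Gcvg w)) iK
  (aeW _ (fun w n _ => dom w n)).
rewrite integral0 => cv.
have [n nP] : exists n, \int[P]_w G n w <= eta.
  have /fine_cvgP[_ /cvgrPdist_le/(_ eta eta0)[n _ /(_ n (leqnn n))]] := cv.
  by rewrite sub0r normrN => /(le_trans (ler_norm _)) h; exists n.
near=> t; have t0 : 0 < t by near: t; exact: nbhs_pinfty_gt.
have st : n.+1%:R <= Num.sqrt t.
  rewrite -(ler_pXn2r (n := 2))// ?nnegrE ?sqrtr_ge0// sqr_sqrtr ?(ltW t0)//.
have st0 : 0 < Num.sqrt t by rewrite sqrtr_gt0.
have tE : t = Num.sqrt t ^+ 2 by rewrite sqr_sqrtr// ltW.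
set s := Num.sqrt t in st st0 tE *.
have mxs : measurable_fun setT (fun w => xi w / s) by exact: measurable_funM.
have ixs : P.-integrable setT (EFin \o (fun w => (xi w / s) ^+ 2)).
  rewrite (_ : _ \o _ = (fun w => (s^-1 ^+ 2)%:E * (xi w ^+ 2)%:E)%E).
    exact: integrableZl.
  by apply/funext => w /=; rewrite exprMn EFinM muleC.
have iT := integrable_taylor2_err K0 L0 mxs ixs.
apply: le_trans nP; rewrite /taylor2_err -RintegralZl//.
apply: le_Rintegral => //; first exact: (integrableZl _ t iT).
move=> w _; rewrite /G le_min; apply/andP; split.
  rewrite (_ : K * xi w ^+ 2 = t * (K * (xi w / s) ^+ 2)).
    by rewrite ler_wpM2l ?(ltW t0)// ge_min lexx.
  by rewrite tE; field; rewrite gt_eqF.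
apply: (@le_trans _ _ (L * `|xi w| ^+ 3 / s)).
  rewrite (_ : L * `|xi w| ^+ 3 / s = t * (L * `|xi w / s| ^+ 3)).
    by rewrite ler_wpM2l ?(ltW t0)// ge_min lexx orbT.
  by rewrite normrM normfV (gtr0_norm st0) tE; field; rewrite gt_eqF.
rewrite ler_wpM2l ?mulr_ge0 ?exprn_ge0//.
by rewrite lef_pV2// posrE.
Unshelve. all: by end_near. Qed.

(** The rounded design has a variance that only converges to [V]. The expansion of [g] bounds the
    increment for [h = (s - s') * z] by [M * |h| + (M + K) * h ^ 2], which is integrated using
    [|z| <= z ^ 2 + 1]. *)
Lemma gauss_avg_lipschitz (R : realType) (g : R -> R) (K L C : R) : 0 <= K -> continuous g ->
  (forall x, `|g x| <= C) -> taylor2_class K L g ->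
  exists2 M, 0 <= M & forall s s', `|gauss_avg s g 0 - gauss_avg s' g 0| <=
    M * (`|s - s'| + `|s - s'| ^+ 2).
Proof.
move=> K0 cg gC [M [g1 [g2 [_ _ g1M g2M tay]]]].
have mg : measurable_fun setT g by exact: continuous_measurable_fun.
have M0 : 0 <= M by rewrite (le_trans _ (g1M 0)).
have gh x h : `|g (x + h) - g x| <= M * `|h| + (M + K) * h ^+ 2.
  have := tay x h; rewrite le_min => /andP[t _].
  rewrite (_ : g (x + h) - g x = (g (x + h) - (g x + g1 x * h + g2 x * h ^+ 2)) +
    (g1 x * h + g2 x * h ^+ 2)); last by ring.
  rewrite (le_trans (ler_normD _ _))//.
  have n1 : `|g1 x * h| <= M * `|h| by rewrite normrM ler_wpM2r.
  have n2 : `|g2 x * h ^+ 2| <= M * h ^+ 2.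
    by rewrite normrM (ger0_norm (sqr_ge0 h)) ler_wpM2r ?sqr_ge0.
  by have := ler_normD (g1 x * h) (g2 x * h ^+ 2); lra.
exists (2 * M + K); first lra.
move=> s s'; have := normr_ge0 (s - s'); set dl := `|s - s'| => dl0.
have mgs (r : R) : measurable_fun setT (fun z : R => g (0 + r * z)).
  by apply: (measurableT_comp mg); exact: measurable_fun_affine.
have ig (r : R) : (normal_prob 0 1).-integrable setT (EFin \o (fun z : R => g (0 + r * z))).
  by have /= := integrable_gauss_avg r 0 mg gC.
rewrite /gauss_avg -RintegralB//.
have mid : measurable_fun setT (@id R) by [].
have iH := @integrable_quadratic _ _ _ (@normal_prob R 0 1)
  (M * dl) 0 (M * dl + (M + K) * dl ^+ 2) id mid (@integrable_sqr_normal R).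
have EH := @Rintegral_quadratic _ _ _ (@normal_prob R 0 1)
  (M * dl) 0 (M * dl + (M + K) * dl ^+ 2) id mid (@integrable_sqr_normal R).
rewrite (le_trans (le_normr_Rintegral _ _))//; first exact: (integrableB _ (ig s) (ig s')).
apply: (@le_trans _ _ (\int[normal_prob 0 1]_z
  (M * dl + 0 * z + (M * dl + (M + K) * dl ^+ 2) * z ^+ 2))).
  apply: le_Rintegral => //.
    by apply: integrable_norm => //; exact: (integrableB _ (ig s) (ig s')).
  move=> z _; rewrite !add0r mul0r addr0.
  have -> : s * z = s' * z + (s - s') * z by ring.
  apply: le_trans (gh _ _) _; rewrite normrM exprMn -/dl.
  have -> : (s - s') ^+ 2 = dl ^+ 2 by rewrite -(real_normK (num_real (s - s'))).
  have z1 : `|z| <= z ^+ 2 + 1.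
    rewrite -(real_normK (num_real z)); have := sqr_ge0 (`|z| - 1).
    by have := normr_ge0 z; nra.
  have : M * dl * `|z| <= M * dl * (z ^+ 2 + 1) by rewrite ler_wpM2l// mulr_ge0.
  lra.
rewrite EH.
have -> : \int[normal_prob 0 1]_z (@id R z ^+ 2) = 1 by rewrite /Rintegral integral_sqr_normal.
rewrite mul0r addr0.
have : 0 <= K * dl by rewrite mulr_ge0.
have : 0 <= M * dl ^+ 2 by rewrite mulr_ge0 ?exprn_ge0.
lra.
Qed.

(** * Partial sums of the sample array *)

Section iid_array.
Context d (T : measurableType d) (R : realType) (P : probability T R) (k : nat).
Variables (calI : {set {set 'I_k}}) (X : 'I_k -> T -> R).
Variable Xa : {set 'I_k} -> nat -> 'I_k -> T -> R.
Hypothesis mX : forall i, measurable_fun setT (X i).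
Hypothesis X2 : forall i, X i \in Lfun P 2%:E.
Hypothesis mXa : forall I j i, measurable_fun setT (Xa I j i).
Hypothesis ind : mutually_indep P [set Ij | Ij.1 \in calI] (fun Ij => Xa Ij.1 Ij.2).
Hypothesis iid : forall I j, I \in calI -> same_law P (Xa I j) X.

Local Notation mu := (mean_vec P X).
Local Notation Sigma := (cov_mx P X).
Let L := ({set 'I_k} * nat)%type.
Let S : set L := [set Ij | Ij.1 \in calI].

Definition array_lin (v : {set 'I_k} -> 'cV[R]_k) (l : {set 'I_k} * nat) : T -> R :=
  lin_fun (v l.1) mu (Xa l.1 l.2).

Lemma measurable_array_lin v l : measurable_fun setT (array_lin v l).
Proof. exact: measurable_lin_fun. Qed.

Lemma array_lin_law v (l : L) (B : set R) : S l -> measurable B ->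
  P (lin_fun (v l.1) mu X @^-1` B) = P (array_lin v l @^-1` B).
Proof. by move=> Sl mB; apply/esym/same_law_lin_fun => //; exact: iid. Qed.

Lemma scalar_indep_array_lin v : scalar_indep P S (array_lin v).
Proof. exact: (scalar_indep_lin_fun (fun l : L => v l.1) _ ind). Qed.

Lemma array_lin_sqr_integrable v l : S l ->
  P.-integrable setT (EFin \o (fun w => array_lin v l w ^+ 2)).
Proof.
move=> Sl; have [i2 _ _] := lin_fun_moments X2 (v l.1).
apply: (@equal_law_integrable _ _ _ P (lin_fun (v l.1) mu X) (array_lin v l)
  (fun x => x ^+ 2)) => //.
- exact: measurable_lin_fun.
- exact: measurable_array_lin.
- by move=> B; exact: array_lin_law.
Qed.

Lemma array_lin_mean v l : S l -> \int[P]_w array_lin v l w = 0.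
Proof.
move=> Sl; have [_ <- _] := lin_fun_moments X2 (v l.1).
apply/esym/(@equal_law_Rintegral _ _ _ P (lin_fun (v l.1) mu X) (array_lin v l) id) => //.
- exact: measurable_lin_fun.
- exact: measurable_array_lin.
- by move=> B; exact: array_lin_law.
Qed.

Lemma array_lin_variance v l : S l ->
  \int[P]_w (array_lin v l w ^+ 2) = quadf Sigma (v l.1).
Proof.
move=> Sl; have [_ _ <-] := lin_fun_moments X2 (v l.1).
apply/esym/(@equal_law_Rintegral _ _ _ P (lin_fun (v l.1) mu X) (array_lin v l)
  (fun x => x ^+ 2)) => //.
- exact: measurable_lin_fun.
- exact: measurable_array_lin.
- by move=> B; exact: array_lin_law.
Qed.

Lemma quadf_cov_ge0 v : 0 <= quadf Sigma v.
Proof.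
have [_ _ <-] := lin_fun_moments X2 v.
by apply: Rintegral_ge0 => w _; exact: sqr_ge0.
Qed.

Definition partial_sum v I n w : R := \sum_(j <- iota 0 n) array_lin v (I, j) w.

(* The n with |n / t - nu| <= e form a window of at most 3 t e indices, to which
   Ottaviani's inequality applies. *)
Lemma partial_sum_fluctuation v I (nu x eta : R) : I \in calI -> 0 <= nu ->
  0 < x -> 0 < eta -> exists2 e, 0 < e & \forall t \near +oo,
  exists B, [/\ measurable B, (P B <= eta%:E)%E & forall w, ~ B w ->
    forall n : nat, `|n%:R / t - nu| <= e ->
    `|partial_sum v I n w - partial_sum v I (Num.truncn (t * nu)) w|
      <= x * Num.sqrt t].
Proof.
move=> IC nu0 x0 eta0; set q := quadf Sigma (v I).
have q0 : 0 <= q := quadf_cov_ge0 _.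
pose h := Num.min 1 eta; have h0 : 0 < h by rewrite lt_min ltr01.
have h1 : h <= 1 by rewrite ge_min lexx.
have heta : h <= eta by rewrite ge_min lexx orbT.
(* With at most [3 * t * e] summands and [y ^ 2 = t * x ^ 2 / 16], Ottaviani's hypothesis reads
   [96 * q * e <= x ^ 2] and the desired probability [96 * q * e <= eta * x ^ 2]; [h] covers
   both. *)
have D0 : 0 < 96 * (q + 1) by rewrite mulr_gt0// ltr_wpDl.
exists (h * x ^+ 2 / (96 * (q + 1))); first by rewrite divr_gt0// mulr_gt0// exprn_gt0.
set e := h * _ / _; have e0 : 0 < e by rewrite divr_gt0// mulr_gt0// exprn_gt0.
have qe : 96 * q * e <= h * x ^+ 2.
  have -> : h * x ^+ 2 = 96 * (q + 1) * e.
    by rewrite /e; field; rewrite gt_eqF// ltr_wpDl.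
  by rewrite ler_wpM2r ?(ltW e0)//; lra.
near=> t; have t0 : 0 < t by near: t; exact: nbhs_pinfty_gt.
(* Absorbs the rounding of the endpoints: a window of length [2 * t * e + 1] has at most [3 * t * e]
   indices. *)
have te : 1 <= t * e.
  rewrite -ler_pdivrMr//; near: t; apply: nbhs_pinfty_ge; exact: num_real.
have tE : t = Num.sqrt t ^+ 2 by rewrite sqr_sqrtr// ltW.
have st0 : 0 < Num.sqrt t by rewrite sqrtr_gt0.
(* Both partial sums are compared with the one at the left end of the window, at a cost of [2 * y]
   each. *)
pose y := x * Num.sqrt t / 4.
have y0 : 0 < y by rewrite divr_gt0// mulr_gt0.
pose lo := t * Num.max 0 (nu - e).
have lo0 : 0 <= lo by rewrite mulr_ge0 ?(ltW t0)// le_max lexx.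
have hi0 : 0 <= t * (nu + e) by rewrite mulr_ge0 ?addr_ge0 ?(ltW t0) ?(ltW e0).
pose a0 := Num.truncn lo; pose b := Num.truncn (t * (nu + e)).
have loE : t * (nu - e) <= lo by rewrite ler_wpM2l ?(ltW t0)// le_max lexx orbT.
have ab (n : nat) : lo <= n%:R -> n%:R <= t * (nu + e) -> (a0 <= n <= b)%N.
  move=> ln nh; rewrite /b truncn_ge_nat// nh andbT.
  by rewrite -(ler_nat R) (le_trans _ ln)// /a0 truncn_le.
pose r : seq L := [seq (I, j) | j <- iota a0 (b - a0)].
have rS : {in r, forall l, S l} by move=> l /mapP[j _ ->].
have ur : uniq r by rewrite map_inj_uniq ?iota_uniq// => j j' [].
have cnt : (b - a0)%:R <= 3 * (t * e).
  have hb : b%:R <= t * (nu + e) by rewrite truncn_le.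
  have ha : lo < a0%:R + 1 by rewrite natr1; exact: truncnS_gt.
  have [ba|/ltnW ba] := leqP b a0.
    by move: ba; rewrite -subn_eq0 => /eqP ->; rewrite mulr_ge0// mulr_ge0// ltW.
  by rewrite natrB//; move: hb loE; rewrite mulrDr mulrBr; lra.
have sumq : \sum_(l <- r) quadf Sigma (v l.1) = q * (b - a0)%:R.
  rewrite big_map /= big_const_seq count_predT size_iota iter_addr_0.
  by rewrite mulr_natr.
have vx : \sum_(l <- r) quadf Sigma (v l.1) <= y ^+ 2 / 2.
  rewrite sumq (le_trans (ler_wpM2l q0 cnt))// /y expr_div_n exprMn -tE.
  have : t * (96 * q * e) <= t * x ^+ 2.
    by rewrite ler_wpM2l ?(ltW t0)// (le_trans qe)// ler_piMl ?sqr_ge0.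
  lra.
have [mB PB] := ottaviani (measurable_array_lin v) (scalar_indep_array_lin v)
  (@array_lin_sqr_integrable v) (@array_lin_mean v) (@array_lin_variance v)
  y0 rS ur vx.
exists [set w | exists m, 2 * y < `|sumxi (array_lin v) (take m r) w|]; split=> //.
  apply: (le_trans PB); rewrite lee_fin mulrA ler_pdivrMr ?exprn_gt0//.
  rewrite sumq (le_trans (ler_wpM2l _ (ler_wpM2l q0 cnt)))//.
  rewrite /y expr_div_n exprMn -tE.
  have : t * (96 * q * e) <= t * (eta * x ^+ 2).
    by rewrite ler_wpM2l ?(ltW t0)// (le_trans qe)// ler_wpM2r ?sqr_ge0.
  lra.
move=> w Bw.
have step n : (a0 <= n <= b)%N ->
    `|partial_sum v I n w - partial_sum v I a0 w| <= 2 * y.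
  move=> /andP[an nb]; rewrite leNgt; apply/negP => hn; apply: Bw; exists (n - a0)%N.
  move: hn; congr (_ < `| _ |).
  rewrite /sumxi -map_take take_iota big_map /partial_sum.
  have -> : minn (n - a0) (b - a0) = (n - a0)%N.
    by apply/minn_idPl; exact: leq_sub2r.
  by rewrite -{1}(subnKC an) iotaD big_cat/= add0n addrAC subrr add0r.
move=> n; rewrite ler_norml => /andP[hn1 hn2].
have nE : (n%:R : R) = t * (n%:R / t) by rewrite mulrC divfK ?gt_eqF.
have n_ab : (a0 <= n <= b)%N.
  apply: ab; rewrite nE; last by rewrite ler_wpM2l ?(ltW t0)//; lra.
  rewrite ler_wpM2l ?(ltW t0)// ge_max; apply/andP; split; last lra.
  by rewrite divr_ge0// ltW.
have N_ab : (a0 <= Num.truncn (t * nu) <= b)%N.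
  apply/andP; split; apply: le_truncn.
    rewrite ler_wpM2l ?(ltW t0)// ge_max nu0/=; lra.
  by rewrite ler_wpM2l ?(ltW t0)//; lra.
rewrite (_ : _ - _ = (partial_sum v I n w - partial_sum v I a0 w) -
  (partial_sum v I (Num.truncn (t * nu)) w - partial_sum v I a0 w)); last by ring.
have := step _ n_ab; have := step _ N_ab; rewrite /y => s1 s2.
apply: le_trans (ler_normB _ _) _; lra.
Unshelve. all: by end_near. Qed.

(** Chebyshev: the variance is at most [t * nu * q], so [A] does not depend on [t]. Since [A >= 1],
    the inequality [nu * q <= A * eta] suffices for [nu * q <= A ^ 2 * eta]. *)
Lemma partial_sum_tight v I (nu eta : R) : I \in calI -> 0 <= nu -> 0 < eta ->
  exists2 A, 0 < A & forall t, 0 < t ->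
  exists B, [/\ measurable B, (P B <= eta%:E)%E & forall w, ~ B w ->
    `|partial_sum v I (Num.truncn (t * nu)) w| <= A * Num.sqrt t].
Proof.
move=> IC nu0 eta0; set q := quadf Sigma (v I).
have q0 : 0 <= q by exact: quadf_cov_ge0.
pose A := 1 + nu * q / eta; have A1 : 1 <= A by rewrite lerDl divr_ge0 ?mulr_ge0// ltW.
have A0 : 0 < A by exact: lt_le_trans A1.
exists A => // t t0; have st0 : 0 < Num.sqrt t by rewrite sqrtr_gt0.
have y0 : 0 < A * Num.sqrt t by rewrite mulr_gt0.
pose n := Num.truncn (t * nu).
pose r := [seq (I, j) | j <- iota 0 n].
have rS : {in r, forall l, l.1 \in calI} by move=> l /mapP[j _ ->].
have ur : uniq r by rewrite map_inj_uniq ?iota_uniq// => j j' [].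
have [i2 _ e2] := sumxi_moments (measurable_array_lin v)
  (scalar_indep_array_lin v) (@array_lin_sqr_integrable v)
  (@array_lin_mean v) (@array_lin_variance v) rS ur.
have sE : partial_sum v I n = sumxi (array_lin v) r.
  by apply/funext => w; rewrite /sumxi big_map.
have mr := measurable_sumxi (measurable_array_lin v) r.
exists [set w | A * Num.sqrt t < `|partial_sum v I n w|]; split.
- by rewrite sE; exact: measurable_norm_gt.
- rewrite sE; apply: (le_trans (chebyshev_second_moment y0 mr i2)).
  rewrite e2 big_map /= big_const_seq count_predT size_iota iter_addr_0 -/q.
  rewrite lee_fin exprMn sqr_sqrtr ?(ltW t0)// ler_pdivrMr ?mulr_gt0 ?exprn_gt0//.
  have nt : n%:R <= t * nu by rewrite truncn_le mulr_ge0// ltW.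
  rewrite -(mulr_natr q); apply: le_trans (ler_wpM2l q0 nt) _.
  have qA : nu * q <= A * eta by rewrite -ler_pdivrMr// lerDr.
  have AA : A * eta <= A ^+ 2 * eta.
    by rewrite ler_wpM2r ?(ltW eta0)// expr2 ler_peMl// ltW.
  rewrite (_ : q * (t * nu) = t * (nu * q)); last by ring.
  rewrite [leRHS](_ : _ = t * (A ^+ 2 * eta)); last by ring.
  by rewrite ler_wpM2l ?(ltW t0)// (le_trans qA).
by move=> w /negP; rewrite -leNgt.
Qed.

(** * The limit law for the deterministic design *)

Section array_clt.
Variables (v : {set 'I_k} -> 'cV[R]_k) (nu : {set 'I_k} -> R) (V : R).
Hypotheses (nu0 : forall I, 0 <= nu I) (V0 : 0 < V).
Hypothesis VE : \sum_(I in calI) nu I * quadf Sigma (v I) = V.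

Let N t I := Num.truncn (t * nu I).
Let r t : seq L := [seq (J, j) | J <- enum calI, j <- iota 0 (N t J)].
Let vt t I := (Num.sqrt t)^-1 *: v I.

Definition linear_stat (t : R) (w : T) : R :=
  (Num.sqrt t)^-1 * \sum_(I in calI) partial_sum v I (Num.truncn (t * nu I)) w.

Let array_vt t l w : array_lin (vt t) l w = (Num.sqrt t)^-1 * array_lin v l w.
Proof.
rewrite /array_lin /lin_fun mulr_sumr; apply: eq_bigr => i _.
by rewrite mxE mulrA.
Qed.

Let big_r t (F : L -> R) :
  \sum_(l <- r t) F l = \sum_(I in calI) \sum_(j <- iota 0 (N t I)) F (I, j).
Proof. by rewrite /r big_allpairs_dep big_enum. Qed.

Let linear_statE t : linear_stat t = sumxi (array_lin (vt t)) (r t).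
Proof.
apply/funext => w; rewrite /sumxi big_r /linear_stat mulr_sumr.
apply: eq_bigr => I _; rewrite /partial_sum mulr_sumr.
by apply: eq_bigr => j _; rewrite array_vt.
Qed.

Let rS t : {in r t, forall l, S l}.
Proof. by move=> l /allpairsPdep[I [j [+ _ ->]]]; rewrite mem_enum. Qed.

Let ur t : uniq (r t).
Proof.
apply: allpairs_uniq_dep; first exact: enum_uniq.
  by move=> I _; exact: iota_uniq.
by move=> [I j] [I' j'] _ _ /= [-> ->].
Qed.

Let variance t : 0 < t -> \sum_(l <- r t) quadf Sigma (vt t l.1) =
  \sum_(I in calI) (N t I)%:R / t * quadf Sigma (v I).
Proof.
move=> t0; rewrite big_r; apply: eq_bigr => I _ /=.
rewrite big_const_seq count_predT size_iota iter_addr_0 quadfZ.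
rewrite exprVn sqr_sqrtr ?(ltW t0)// -mulr_natr; ring.
Qed.

Let N_bounds t I : 0 < t -> nu I - t^-1 <= (N t I)%:R / t <= nu I.
Proof.
move=> t0; have tn0 : 0 <= t * nu I by rewrite mulr_ge0 ?(ltW t0).
have := truncn_itv tn0; rewrite -/(N t I) => /andP[l u].
rewrite ler_pdivrMr// ler_pdivlMr// (mulrC (nu I)) l andbT mulrBl mulVf ?gt_eqF//.
by rewrite mulrC lerBlDr natr1 ltW.
Qed.

Let variance_cvg :
  (\sum_(I in calI) (N t I)%:R / t * quadf Sigma (v I)) @[t --> +oo] --> V.
Proof.
rewrite -VE; apply: cvg_big => [|I _].
  by move=> x; apply: cvgD; [exact: cvg_fst|exact: cvg_snd].
apply: cvgM; last exact: cvg_cst.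
have cv : (nu I - t^-1) @[t --> +oo] --> nu I.
  rewrite -[X in _ --> X]subr0; apply: cvgB; first exact: cvg_cst.
  by apply/gtr0_cvgV0; [exact: nbhs_pinfty_gt|exact: cvg_id].
apply: (squeeze_cvgr _ cv (cvg_cst (nu I))).
by near=> t; apply: N_bounds.
Unshelve. all: by end_near. Qed.

Lemma linear_stat_second_moment : \forall t \near +oo,
  P.-integrable setT (EFin \o (fun w => linear_stat t w ^+ 2)) /\
  \int[P]_w (linear_stat t w ^+ 2) <= V + 1.
Proof.
near=> t; have t0 : 0 < t by near: t; exact: nbhs_pinfty_gt.
rewrite linear_statE.
have [i2 _ ->] := sumxi_moments (measurable_array_lin (vt t))
  (scalar_indep_array_lin (vt t)) (@array_lin_sqr_integrable (vt t))
  (@array_lin_mean (vt t)) (@array_lin_variance (vt t))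
  (@rS t) (ur t).
split=> //; rewrite (variance t0).
near: t; apply: (cvgr_le _ variance_cvg); rewrite ltrDl ltr01.
Unshelve. all: by end_near. Qed.


(** All summands for [I] have the same law, hence the same error, which is o(1/t), and there are at
    most [t * nu I] of them. *)
Let gaussian_part_small (K K' eta : R) I : 0 <= K -> 0 <= K' -> I \in calI -> 0 < eta ->
  \forall t \near +oo, \sum_(j <- iota 0 (N t I))
    (taylor2_err P K K' (array_lin (vt t) (I, j)) +
     taylor2_err (@normal_prob R 0 1) K K'
       (fun z : R => Num.sqrt (quadf Sigma (vt t I)) * z)) <= eta.
Proof.
move=> K0 K'0 IC eta0.
pose f := lin_fun (v I) mu X; pose sg := Num.sqrt (quadf Sigma (v I)).
have mf : measurable_fun setT f by exact: measurable_lin_fun.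
have [f2 _ _] := lin_fun_moments X2 (v I).
have [msg isg _ _] := scaled_normal_moments sg.
have d0 : 0 < 2 * (nu I + 1) by rewrite mulr_gt0// ltr_wpDl.
pose h := eta / (2 * (nu I + 1)); have h0 : 0 < h by rewrite divr_gt0.
have E1 := @taylor2_err_rescaled_small _ _ _ P K K' f h K0 K'0 mf f2 h0.
have E2 := @taylor2_err_rescaled_small _ _ _ (@normal_prob R 0 1) K K'
  (fun z : R => sg * z) h K0 K'0 msg isg h0.
near=> t; have t0 : 0 < t by near: t; exact: nbhs_pinfty_gt.
have st0 : 0 < Num.sqrt t by rewrite sqrtr_gt0.
have e1 : t * taylor2_err P K K' (fun w => f w / Num.sqrt t) <= h by near: t; exact: E1.
have e2 : t * taylor2_err (@normal_prob R 0 1) K K' (fun z => sg * z / Num.sqrt t) <= h.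
  by near: t; exact: E2.
have P1 j : taylor2_err P K K' (array_lin (vt t) (I, j)) =
    taylor2_err P K K' (fun w => f w / Num.sqrt t).
  pose F (x : R) := Num.min (K * (x / Num.sqrt t) ^+ 2) (K' * `|x / Num.sqrt t| ^+ 3).
  have mF : measurable_fun setT F.
    have mq : measurable_fun setT (fun x : R => x / Num.sqrt t) by exact: measurable_funM.
    apply: measurable_minr.
      by apply: measurable_funM => //; exact: measurable_funX.
    apply: measurable_funM => //; apply: measurable_funX; exact: measurableT_comp.
  rewrite /taylor2_err -[RHS]/(\int[P]_w F (f w)).
  rewrite (@equal_law_Rintegral _ _ _ P f (array_lin v (I, j)) F) //.
  - by apply: eq_Rintegral => w _; rewrite /F array_vt [_^-1 * _]mulrC.
  - exact: measurable_array_lin.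
  - by move=> B; exact: (array_lin_law v (l := (I, j))).
have P2 : taylor2_err (@normal_prob R 0 1) K K'
    (fun z : R => Num.sqrt (quadf Sigma (vt t I)) * z) =
    taylor2_err (@normal_prob R 0 1) K K' (fun z => sg * z / Num.sqrt t).
  rewrite quadfZ sqrtrM ?sqr_ge0// sqrtr_sqr ger0_norm ?invr_ge0 ?(ltW st0)//.
  by congr taylor2_err; apply/funext => z; rewrite -mulrA mulrC.
under eq_bigr do rewrite P1 P2.
rewrite big_const_seq count_predT size_iota iter_addr_0 -mulr_natr.
set q := taylor2_err P _ _ _ + _.
have tq : t * q <= 2 * h by rewrite /q mulrDr mulr_natl mulr2n; exact: lerD.
have /andP[_ Nn] := N_bounds I t0.
have -> : q * (N t I)%:R = (t * q) * ((N t I)%:R / t) by field; rewrite gt_eqF.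
have Nt0 : 0 <= (N t I)%:R / t by rewrite divr_ge0// ltW.
apply: le_trans (ler_wpM2r Nt0 tq) _.
have h20 : 0 <= 2 * h by rewrite mulr_ge0// ltW.
apply: le_trans (ler_wpM2l h20 Nn) _.
have -> : eta = 2 * h * (nu I + 1) by rewrite /h; field; rewrite gt_eqF// ltr_wpDl.
by rewrite ler_wpM2l// lerDl.
Unshelve. all: by end_near. Qed.

(** The exchange argument reaches the Gaussian average with the variance [Vt t] of the rounded
    design; [gauss_avg_lipschitz] then replaces [Vt t] by its limit. *)
Lemma linear_stat_cvg (g : R -> R) (K K' C : R) : 0 <= K -> 0 <= K' -> continuous g ->
  (forall x, `|g x| <= C) -> taylor2_class K K' g ->
  \int[P]_w g (linear_stat t w) @[t --> +oo] --> gauss_avg (Num.sqrt V) g 0.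
Proof.
move=> K0 K'0 cg gC gK; apply/cvgrPdist_le => e e0.
have e20 : 0 < e / 2 by rewrite divr_gt0.
have [M M0 gM] := gauss_avg_lipschitz K0 cg gC gK.
pose Vt t := \sum_(I in calI) (N t I)%:R / t * quadf Sigma (v I).
have gcvg : gauss_avg (Num.sqrt (Vt t)) g 0 @[t --> +oo] --> gauss_avg (Num.sqrt V) g 0.
  have sV : Num.sqrt (Vt t) @[t --> +oo] --> Num.sqrt V.
    exact: (cvg_comp _ _ variance_cvg (@sqrt_continuous R V)).
  have dcv : `|Num.sqrt (Vt t) - Num.sqrt V| @[t --> +oo] --> (0 : R).
    rewrite -(normr0 R); apply: cvg_norm; rewrite -(subrr (Num.sqrt V)).
    by apply: cvgB => //; exact: cvg_cst.
  have mcv : M * (`|Num.sqrt (Vt t) - Num.sqrt V| + `|Num.sqrt (Vt t) - Num.sqrt V| ^+ 2)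
      @[t --> +oo] --> (0 : R).
    rewrite -(mulr0 M) -[X in M * X](addr0 0) -[X in M * (_ + X)](mulr0 0).
    apply: cvgM; first exact: cvg_cst.
    by apply: cvgD => //; under eq_fun do rewrite expr2; exact: cvgM.
  apply/cvgrPdist_le => e' e'0; move/cvgrPdist_le : mcv => /(_ e' e'0) mcv.
  near=> t; rewrite distrC (le_trans (gM _ _))//.
  rewrite (le_trans (ler_norm _))// -normrN -sub0r; near: t; exact: mcv.
move/cvgrPdist_le : gcvg => /(_ _ e20) gcvg.
pose m := (#|calI|)%:R + 1 : R; have m0 : 0 < m by rewrite ltr_wpDl.
have small : \forall t \near +oo, \sum_(l <- r t)
    (taylor2_err P K K' (array_lin (vt t) l) +
     taylor2_err (@normal_prob R 0 1) K K'
       (fun z : R => Num.sqrt (quadf Sigma (vt t l.1)) * z)) <= e / 2.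
  have em0 : 0 < e / 2 / m by rewrite divr_gt0.
  have : \forall t \near +oo, forall J, J \in calI -> \sum_(j <- iota 0 (N t J))
    (taylor2_err P K K' (array_lin (vt t) (J, j)) +
     taylor2_err (@normal_prob R 0 1) K K'
       (fun z : R => Num.sqrt (quadf Sigma (vt t J)) * z)) <= e / 2 / m.
    apply: filter_forall => J.
    have [JC|JC] := boolP (J \in calI); last by near=> t.
    have := gaussian_part_small K0 K'0 JC em0; apply: filterS => t h _; exact: h.
  apply: filterS => t h; rewrite big_r.
  apply: le_trans (ler_sum _ h) _.
  rewrite big_const iter_addr_0 -(mulr_natr (e / 2 / m)) mulrAC ler_pdivrMr//.
  by rewrite ler_wpM2l ?(ltW e20)// lerDl.
near=> t; have t0 : 0 < t by near: t; exact: nbhs_pinfty_gt.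
have s1 : `|gauss_avg (Num.sqrt V) g 0 - gauss_avg (Num.sqrt (Vt t)) g 0| <= e / 2.
  by near: t; exact: gcvg.
have s2 : `|\int[P]_w g (linear_stat t w) - gauss_avg (Num.sqrt (Vt t)) g 0| <= e / 2.
  have qE (l : L) : S l -> quadf Sigma (vt t l.1) = Num.sqrt (quadf Sigma (vt t l.1)) ^+ 2.
    by move=> _; rewrite sqr_sqrtr//; exact: quadf_cov_ge0.
  have := sumxi_lindeberg (measurable_array_lin (vt t))
    (scalar_indep_array_lin (vt t)) (@array_lin_sqr_integrable (vt t))
    (@array_lin_mean (vt t)) (@array_lin_variance (vt t))
    0 K0 K'0 cg gC gK (@rS t) (ur t) (s := fun l : L => Num.sqrt (quadf Sigma (vt t l.1)))
    (fun l => sqrtr_ge0 _) qE.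
  rewrite (_ : \sum_(l <- r t) _ = Vt t); last first.
    rewrite /Vt -(variance t0); apply: eq_bigr => l _; rewrite sqr_sqrtr//.
    exact: quadf_cov_ge0.
  rewrite -linear_statE; under eq_Rintegral do rewrite add0r.
  by move=> /le_trans; apply; near: t; exact: small.
rewrite (_ : _ - _ = (gauss_avg (Num.sqrt V) g 0 - gauss_avg (Num.sqrt (Vt t)) g 0) -
  (\int[P]_w g (linear_stat t w) - gauss_avg (Num.sqrt (Vt t)) g 0)); last by ring.
by apply: le_trans (ler_normB _ _) _; lra.
Unshelve. all: by end_near. Qed.

Lemma measurable_linear_stat t : measurable_fun setT (linear_stat t).
Proof. by rewrite linear_statE; apply: measurable_sumxi; exact: measurable_array_lin. Qed.

Lemma array_clt (Y : R -> T -> R) : (forall t, measurable_fun setT (Y t)) ->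
  (forall x eta, 0 < x -> 0 < eta ->
    \forall t \near +oo, exists B, [/\ measurable B, (P B <= eta%:E)%E &
      forall w, ~ B w -> `|Y t w - linear_stat t w| <= x]) ->
  cvg_dist_normal P Y V.
Proof.
move=> mY YZ; apply: (cvg_dist_normal_approx V0 mY measurable_linear_stat _
  linear_stat_second_moment).
- move=> x eta x0 eta0; apply: filterS (YZ x eta x0 eta0) => t [B [mB PB BY]].
  apply: le_trans PB; apply: le_measure.
  + apply/mem_set/measurable_norm_gt/measurable_funB => //.
    exact: measurable_linear_stat.
  + exact/mem_set.
  move=> w /= xw; apply: contrapT => /BY; rewrite leNgt => /negP; exact.
- move=> g K K' C K0 K'0 cg gC gK; exact: (linear_stat_cvg K0 K'0 cg gC gK).
Qed.

End array_clt.

End iid_array.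

(** * The discrete value *)

Section discrete_value.
Variables (R : realType) (k m : nat) (Sigma : 'M[R]_k) (calI : {set {set 'I_k}}).
Variables (c : {set 'I_k} -> 'I_m -> R) (B0 : 'I_m -> R) (a : 'cV[R]_k).
Hypothesis Sp : posdef Sigma.

(** At a small positive multiple of [a] the linear gain of the dual objective beats its quadratic
    term; [s = A / (1 + q)] is small enough. *)
Lemma var_obj_gt0 nu : a != 0 -> (forall I, 0 <= nu I) -> covering calI a nu ->
  0 < var_obj Sigma calI a nu.
Proof.
move=> a0 nu0 cov; pose A := sqnorm a; pose q := quadf (info_mx Sigma calI nu) a.
have A0 : 0 < A.
  rewrite lt_neqAle eq_sym sqnorm_ge0 andbT.
  by apply: contra_neq a0; exact: sqnorm_eq0.
have q0 : 0 <= q.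
  rewrite /q quadf_info_mx; apply: sumr_ge0 => I _.
  by rewrite mulr_ge0//; exact: iquad_ge0.
pose s := A / (1 + q); have q1 : 0 < 1 + q by rewrite ltr_pwDl.
have s0 : 0 < s by rewrite divr_gt0.
apply: lt_le_trans (dual_obj_le_var_obj Sp (s *: a) nu0 cov).
rewrite /dual_obj -quadf_info_mx quadfZ -/q dotvZr dotvv -/A.
rewrite (_ : _ - _ = s * (A + (A - s * q))); last by ring.
rewrite mulr_gt0// ltr_pwDl// subr_ge0 /s mulrAC ler_pdivrMr//.
by rewrite ler_wpM2l ?(ltW A0)// lerDr.
Qed.

Lemma var_obj_scale nu (t : R) : 0 < t -> (forall I, 0 <= nu I) -> covering calI a nu ->
  var_obj Sigma calI a (fun I => nu I / t) = t * var_obj Sigma calI a nu.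
Proof.
move=> t0 nu0 cov; have [w Mw] := info_mx_solve Sp nu0 cov.
rewrite (var_obj_solution Sp Mw) (var_obj_solution (w := t *: w) Sp) ?dotvZr//.
rewrite -Mw !info_mx_mulmx; apply: eq_bigr => I _.
by rewrite -!scalemxAr scalerA mulfVK// gt_eqF.
Qed.

Hypotheses (c0 : forall I r, 0 <= c I r) (a0 : a != 0).
Variable nustar : {set 'I_k} -> R.
Hypothesis nustar_feasible : cont_feasible calI c B0 a nustar.
Hypothesis nustar_min : forall nu, cont_feasible calI c B0 a nu ->
  var_obj Sigma calI a nustar <= var_obj Sigma calI a nu.

Local Notation Vstar := (var_obj Sigma calI a nustar).

Let disc_value_ge (t : R) n : 0 < t -> disc_feasible calI c (fun r => t * B0 r) a n ->
  Vstar <= t * var_obj Sigma calI a (fun I => (n I)%:R).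
Proof.
move=> t0 [nC nB nU]; rewrite -var_obj_scale//; last first.
  by move=> i /nU[I IC [nI iI]]; exists I => //; rewrite ltr0n.
apply: nustar_min; split.
- by move=> I /nC ->; rewrite mul0r.
- by move=> I; rewrite divr_ge0// ltW.
- move=> r; rewrite -(ler_pM2l t0); apply: le_trans (nB r); rewrite mulr_sumr.
  by apply: ler_sum => I _; rewrite mulrA mulrCA divff ?gt_eqF// mulr1.
- move=> i /nU[I IC [nI iI]]; exists I => //; split=> //.
  by rewrite divr_gt0// ltr0n.
Qed.

(** Dividing an integer allocation by [t] makes it feasible for the continuous problem, which gives
    the lower bound; rounding [nustar] down gives the upper one. They also show that the infimum is
    over a nonempty set bounded below. *)
Lemma V_disc_asymptotics : (forall I, 0 <= nustar I) ->
  (t * V_disc Sigma calI c (fun r => t * B0 r) a) @[t --> +oo] --> Vstar.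
Proof.
move=> nustar0.
have cov : covering calI a nustar by have [_ _ _] := nustar_feasible.
have V0 := var_obj_gt0 a0 nustar0 cov.
have [w Mw] := info_mx_solve Sp nustar0 cov.
(* Chosen so that [Vstar / (1 - rho) = Vstar + e]. *)
apply/cvgrPdist_le => e e0; pose rho := e / (Vstar + e).
have Ve0 : 0 < Vstar + e by rewrite addr_gt0.
have rho0 : 0 < rho by rewrite divr_gt0.
have rho1 : rho < 1 by rewrite ltr_pdivrMr// mul1r ltrDr.
have [T0 T00 floorT] := floor_alloc_ge nustar_feasible rho0.
near=> t.
have tT : T0 <= t by near: t; apply: nbhs_pinfty_ge; exact: num_real.
have t0 : 0 < t := lt_le_trans T00 tT.
have [[nC nB _] fU fV] := floor_alloc_feasible Sp c0 nustar_feasible t0 rho1 Mw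
  (floorT t tT).
set n := floor_alloc nustar t in nC nB fU fV.
have n0 I : 0 <= (n I)%:R / t by rewrite divr_ge0// ltW.
have ncov : covering calI a (fun I => (n I)%:R).
  move=> i /(unbiased_covering fU)[I IC [nI iI]]; exists I => //; split=> //.
  by move: nI; rewrite pmulr_lgt0// invr_gt0.
have nfeas : disc_feasible calI c (fun r => t * B0 r) a n.
  by split=> // i /ncov[I IC [nI iI]]; exists I => //; rewrite ltr0n in nI.
set E := [set var_obj Sigma calI a (fun I => (n I)%:R) |
        n in [set n | disc_feasible calI c (fun r => t * B0 r) a n]].
have En : E (var_obj Sigma calI a (fun I => (n I)%:R)) by exists n.
have lbE : lbound E (Vstar / t).
  by move=> _ [n' fn' <-]; rewrite ler_pdivrMr// mulrC; exact: disc_value_ge.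
have low : Vstar <= t * inf E.
  rewrite mulrC -ler_pdivrMr//; apply: lb_le_inf => //.
  by exists (var_obj Sigma calI a (fun I => (n I)%:R)).
have up : t * inf E <= Vstar + e.
  apply: (@le_trans _ _ (t * var_obj Sigma calI a (fun I => (n I)%:R))).
    by rewrite ler_wpM2l ?(ltW t0)//; apply: ge_inf => //; exists (Vstar / t).
  rewrite -var_obj_scale//; apply: le_trans (var_obj_le_real_obj Sp n0 fU) _.
  have rE : 1 - rho = Vstar / (Vstar + e) by rewrite /rho; field; rewrite gt_eqF.
  move: fV; rewrite rE mulrAC ler_pdivrMr// ler_pM2l//.
rewrite -/(V_disc _ _ _ _ _) in low up *.
by rewrite distrC ger0_norm ?subr_ge0// lerBlDl.
Unshelve. all: by end_near. Qed.

End discrete_value.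

(** * The estimation error *)

Lemma finite_exceptional_union d (T : measurableType d) (R : realType)
    (P : probability T R) (F : finType) (Q : F -> T -> Prop) (eta : R) :
  (forall p, exists B, [/\ measurable B, (P B <= eta%:E)%E & forall w, ~ B w -> Q p w]) ->
  exists B, [/\ measurable B, (P B <= (#|F|%:R * eta)%:E)%E &
    forall w, ~ B w -> forall p, Q p w].
Proof.
move=> QB; suff [B [mB PB QBw]] : exists B, [/\ measurable B,
    (P B <= ((size (enum F))%:R * eta)%:E)%E &
    forall w, ~ B w -> forall p, p \in enum F -> Q p w].
  exists B; split=> //; first by rewrite cardE.
  by move=> w Bw p; apply: QBw; rewrite ?mem_enum.
elim: (enum F) => [|p s [B [mB PB QBw]]].
  by exists set0; split=> //=; rewrite measure0 mul0r.
have [B' [mB' PB' QBw']] := QB p.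
exists (B' `|` B); split; first exact: measurableU.
  apply: (le_trans (measureU2 P mB' mB)).
  by rewrite -natr1 mulrDl mul1r addrC EFinD; exact: leeD.
move=> w /not_orP[nB' nB] p'; rewrite in_cons => /orP[/eqP ->|p's].
  exact: QBw'.
exact: QBw.
Qed.

Section estimation_error.
Context d (T : measurableType d) (R : realType) (P : probability T R) (k : nat).
Variables (calI : {set {set 'I_k}}) (X : 'I_k -> T -> R).
Variable Xa : {set 'I_k} -> nat -> 'I_k -> T -> R.

(** Free of the weights: exceptional events for these sums can be fixed before the data-dependent
    weights enter, which is how arbitrary dependence on the sample is tolerated. *)
Definition coord_sum I (j : 'I_k) (n : nat) (w : T) : R :=
  partial_sum P X Xa (fun=> delta_mx j 0) I n w.

Lemma coord_sumE I j n w :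
  coord_sum I j n w = \sum_(l < n) (Xa I l j w - mean_vec P X j 0).
Proof.
rewrite /coord_sum /partial_sum -(big_mkord xpredT (fun l => Xa I l j w - _)) /index_iota subn0.
apply: eq_bigr => l _; rewrite /array_lin /lin_fun (bigD1 j)//= mxE !eqxx mul1r.
by rewrite big1 ?addr0// => i ij; rewrite mxE (negPf ij) mul0r.
Qed.

Lemma partial_sum_coord v I n w :
  partial_sum P X Xa v I n w = \sum_j v I j 0 * coord_sum I j n w.
Proof.
under [RHS]eq_bigr do rewrite coord_sumE mulr_sumr.
rewrite exchange_big/= /partial_sum.
rewrite -(big_mkord xpredT (fun l => \sum_j v I j 0 * (Xa I l j w - mean_vec P X j 0))).
by rewrite /index_iota subn0.
Qed.

(** Unbiasedness distributes [a^T mu] over the samples, so that each is centred. The random weights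
    remain only as coefficients of the coordinate sums. *)
Lemma theta_hat_error (a : 'cV[R]_k) (n : {set 'I_k} -> nat)
    (lam : forall I : {set 'I_k}, 'cV[R]_#|I|) (t : R) w : 0 < t ->
  \sum_(I in calI | (0 < n I)%N) ((projI R I)^T *m lam I) = a ->
  Num.sqrt t * (theta_hat calI n lam (fun I j => rvec (Xa I j) w) -
     (a^T *m mean_vec P X) 0 0) =
  (Num.sqrt t)^-1 * \sum_(I in calI) \sum_j
     (t / (n I)%:R * ((projI R I)^T *m lam I) j 0) * coord_sum I j (n I) w.
Proof.
move=> t0 <-; have st0 : 0 < Num.sqrt t by rewrite sqrtr_gt0.
rewrite -[(_ *m mean_vec P X) 0 0]/(dotv _ _) dotv_suml /theta_hat -sumrB.
rewrite mulr_sumr big_mkcondr mulr_sumr; apply: eq_bigr => I IC.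
have [|nI] := ifPn; last first.
  rewrite big1 ?mulr0// => j _; rewrite coord_sumE.
  by move: nI; rewrite -eqn0Ngt => /eqP ->; rewrite big_ord0 mulr0.
move=> nI; have n0 : (n I)%:R != 0 :> R by rewrite pnatr_eq0 -lt0n.
set V := (projI R I)^T *m lam I.
have tE : (Num.sqrt t)^-1 * t = Num.sqrt t.
  by rewrite -{2}(sqr_sqrtr (ltW t0)) expr2 mulKf// gt_eqF.
have -> : (n I)%:R^-1 * (\sum_(j < n I) ((lam I)^T *m (projI R I *m rvec (Xa I j) w)) 0 0) -
    dotv V (mean_vec P X) =
    (n I)%:R^-1 * \sum_(l < n I) \sum_j V j 0 * (Xa I l j w - mean_vec P X j 0).
  rewrite -[X in _ - X](mulKf n0) -mulrBr; congr (_ * _).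
  have -> : (n I)%:R * dotv V (mean_vec P X) = \sum_(l < n I) dotv V (mean_vec P X).
    by rewrite sumr_const card_ord mulr_natl.
  rewrite -sumrB; apply: eq_bigr => l _.
  have -> : ((lam I)^T *m (projI R I *m rvec (Xa I l) w)) 0 0 = dotv V (rvec (Xa I l) w).
    by rewrite /dotv /V trmx_mul trmxK mulmxA.
  rewrite !dotvE -sumrB; apply: eq_bigr => j _.
  by rewrite mulrBr [rvec _ _ _ _]mxE.
rewrite exchange_big/= mulrA !mulr_sumr; apply: eq_bigr => j _.
by rewrite coord_sumE -mulr_sumr -{1}tE; ring.
Qed.

(* If nu I = 0 the reference sum over I is empty, so u - v need not be small
   there; if n I = 0 then u I = 0, as t / 0 = 0. *)
Lemma theta_hat_linear_stat_dist (v : {set 'I_k} -> 'cV[R]_k) (nu : {set 'I_k} -> R)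
    (a : 'cV[R]_k) (n : {set 'I_k} -> nat) (lam : forall I : {set 'I_k}, 'cV[R]_#|I|)
    (t C y e A : R) w : 0 < t -> 0 <= C -> 0 <= e ->
  \sum_(I in calI | (0 < n I)%N) ((projI R I)^T *m lam I) = a ->
  let u I j := t / (n I)%:R * ((projI R I)^T *m lam I) j 0 in
  (forall I j, I \in calI -> [/\ `|u I j| <= C,
     nu I != 0 -> `|u I j - v I j 0| <= e,
     `|coord_sum I j (n I) w - coord_sum I j (Num.truncn (t * nu I)) w| <= y * Num.sqrt t &
     `|coord_sum I j (Num.truncn (t * nu I)) w| <= A * Num.sqrt t]) ->
  `|Num.sqrt t * (theta_hat calI n lam (fun I j => rvec (Xa I j) w) -
     (a^T *m mean_vec P X) 0 0) - linear_stat P calI X Xa v nu t w| <=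
  #|calI|%:R * (k%:R * (C * y + e * A)).
Proof.
move=> t0 C0 e0 ub u H; have st0 : 0 < Num.sqrt t by rewrite sqrtr_gt0.
rewrite (theta_hat_error w t0 ub) /linear_stat -mulrBr normrM.
rewrite gtr0_norm ?invr_gt0// mulrC ler_pdivrMr// -sumrB.
rewrite -mulrA; apply: le_trans (ler_norm_sum _ _ _) _.
have -> : #|calI|%:R * (k%:R * (C * y + e * A) * Num.sqrt t) =
    \sum_(I in calI) \sum_(j < k) (C * y + e * A) * Num.sqrt t.
  under eq_bigr do rewrite sumr_const card_ord.
  by rewrite sumr_const -(mulrA k%:R) (mulr_natl _ k) mulr_natl.
apply: ler_sum => I IC; rewrite partial_sum_coord -sumrB.
apply: le_trans (ler_norm_sum _ _ _) _; apply: ler_sum => j _.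
have [uC uv Dn DN] := H I j IC; rewrite -/(u I j); move: (u I j) uC uv => {H}{}u uC uv.
set D := coord_sum I j (n I) w in Dn *; set D' := coord_sum I j _ w in Dn DN *.
(* A bounded coefficient times a small fluctuation, plus a small coefficient error times a tight
   sum. *)
have -> : u * D - v I j 0 * D' = u * (D - D') + (u - v I j 0) * D' by ring.
apply: le_trans (ler_normD _ _) _; rewrite [leRHS]mulrDl !normrM.
apply: lerD; first by rewrite -mulrA ler_pM.
have [nu0|/uv uve] := eqVneq (nu I) 0; last by rewrite -mulrA ler_pM.
rewrite /D' nu0 mulr0 truncn0 coord_sumE big_ord0 normr0 mulr0 -mulrA mulr_ge0//.
exact: le_trans (normr_ge0 _) DN.
Qed.

End estimation_error.

Theorem theorem2
  (R : realType) (d : measure_display) (Omega : measurableType d)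
  (P : probability Omega R)
  (k m : nat) (a : 'cV[R]_k) (calI : {set {set 'I_k}})
  (c : {set 'I_k} -> 'I_m -> R) (B0 : 'I_m -> R)
  (* the random vector X and the i.i.d. array (X^{(I,j)})_{I in calI, j} *)
  (X : 'I_k -> Omega -> R) (Xa : {set 'I_k} -> nat -> 'I_k -> Omega -> R)
  (* the estimated covariances Sigma_hat_t and the selected minimizers *)
  (Shat : R -> Omega -> 'M[R]_k)
  (nhat : R -> Omega -> {set 'I_k} -> nat)
  (lamhat : R -> Omega -> forall I : {set 'I_k}, 'cV[R]_#|I|)
  (nustar : {set 'I_k} -> R) :
  a != 0 ->
  (forall I, I \in calI -> I != finset.set0) ->
  (forall I r, 0 <= c I r) ->
  (forall r, 0 < B0 r) ->
  (* X has finite second moments, Sigma = Cov(X) positive definite *)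
  (forall i, measurable_fun setT (X i)) ->
  (forall i, X i \in Lfun P 2%:E) ->
  posdef (cov_mx P X) ->
  (* i.i.d. copies of X *)
  (forall I j i, measurable_fun setT (Xa I j i)) ->
  mutually_indep P [set Ij | Ij.1 \in calI] (fun Ij => Xa Ij.1 Ij.2) ->
  (forall I j, I \in calI -> same_law P (Xa I j) X) ->
  (* the continuous problem has the unique minimizer nustar *)
  cont_feasible calI c B0 a nustar ->
  (forall nu, cont_feasible calI c B0 a nu ->
     var_obj (cov_mx P X) calI a nustar <= var_obj (cov_mx P X) calI a nu) ->
  (forall nu, cont_feasible calI c B0 a nu ->
     var_obj (cov_mx P X) calI a nu = var_obj (cov_mx P X) calI a nustar ->
     nu = nustar) ->
  (* Sigma_hat_t : random symmetric matrices, -> Sigma in probability *)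
  (forall t i j, measurable_fun setT (fun w => Shat t w i j)) ->
  (forall t w, (Shat t w)^T = Shat t w) ->
  cvg_prob_opnorm P Shat (cov_mx P X) ->
  (* (nhat, lamhat) : a (measurable) minimizer of the design problem *)
  (forall t I, measurable_fun setT (fun w => (nhat t w I)%:R : R)) ->
  (forall t I i, measurable_fun setT (fun w => lamhat t w I i 0)) ->
  (\forall t \near +oo, forall w,
     (exists n lam, est_minimizer (Shat t w) calI c (fun r => t * B0 r) a n lam) ->
     est_minimizer (Shat t w) calI c (fun r => t * B0 r) a
                   (nhat t w) (lamhat t w)) ->
  cvg_dist_normal P
    (fun t w => Num.sqrt t *
       (theta_hat calI (nhat t w) (lamhat t w) (fun I j => rvec (Xa I j) w)
        - (a^T *m mean_vec P X) 0 0))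
    (var_obj (cov_mx P X) calI a nustar)
  /\
  (t * V_disc (cov_mx P X) calI c (fun r => t * B0 r) a) @[t --> +oo] -->
     var_obj (cov_mx P X) calI a nustar.
Proof.
move=> a0 _ c0 B0_gt0 mX X2 Sp mXa ind iid nustar_feasible nustar_min nustar_unique.
move=> mS Ssym ScvP mn mlam hat_min.
have [_ nu0 _ cov] := nustar_feasible.
split; last exact: V_disc_asymptotics.
have [w0 Mw] := info_mx_solve Sp nu0 cov.
pose ustar I := invmx (subM (cov_mx P X) I) *m (projI R I *m w0).
pose v I : 'cV[R]_k := (projI R I)^T *m ustar I.
have VE : \sum_(I in calI) nustar I * quadf (cov_mx P X) (v I) = var_obj (cov_mx P X) calI a nustar.
  rewrite (var_obj_solution Sp Mw) -Mw dotvC -quadfE quadf_info_mx.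
  apply: eq_bigr => I _; congr (_ * _).
  by rewrite /v -quadf_subM /ustar -quadf_invmx//; exact: posdef_subM.
apply: (array_clt mX X2 mXa ind iid nu0 (var_obj_gt0 Sp a0 nu0 cov) VE).
  move=> t; apply: measurable_funM => //; apply: measurable_funB => //.
  exact: measurable_theta_hat.
move=> x eta x0 eta0.
pose F : finType := ({set 'I_k} * 'I_k)%type.
pose M : R := #|calI|%:R * k%:R + 1; have M0 : 0 < M by rewrite ltr_wpDl// mulr_ge0.
(* The budget of probability: one event for the covariance estimate and two, fluctuation and
   tightness, for each pair of a set and a coordinate. *)
pose eta1 := eta / (1 + #|F|%:R * 2).
have D0 : 0 < 1 + #|F|%:R * 2 :> R by rewrite ltr_pwDl// mulr_ge0.
have eta10 : 0 < eta1 by rewrite divr_gt0.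
pose tight (p : F) (A : R) := 0 < A /\ (p.1 \in calI ->
    forall t, 0 < t -> exists B, [/\ measurable B, (P B <= eta1%:E)%E & forall w, ~ B w ->
    `|coord_sum P X Xa p.1 p.2 (Num.truncn (t * nustar p.1)) w| <= A * Num.sqrt t]).
have /choice[A_ A_P] : forall p, exists A, tight p A.
  move=> [I j].
  have [IC|IC] := boolP (I \in calI); last by exists 1; split=> //= ; rewrite (negPf IC).
  have [A A0 AP] := partial_sum_tight mX X2 mXa ind iid (fun=> delta_mx j 0) IC (nu0 I) eta10.
  by exists A; split.
pose A := \sum_p A_ p.
have A0 : 0 <= A by apply: sumr_ge0 => p _; rewrite ltW//; case: (A_P p).
have A_le p : A_ p <= A.
  rewrite /A (bigD1 p)//= lerDl; apply: sumr_ge0 => q _; rewrite ltW//.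
  by case: (A_P q).
have [C0 design] := design_asymptotics Sp c0 B0_gt0 nustar_feasible nustar_min
  nustar_unique Mw.
(* The order of choices matters: [A] and [C] do not depend on the precision [e], so [y] may be taken
   in terms of [C], and then [e] in terms of [A] and the window widths [e_ p] obtained for [y]. *)
pose C := `|C0| + 1; have Cp : 0 < C by rewrite ltr_wpDl.
pose y := x / (2 * M * C); have y0 : 0 < y by rewrite divr_gt0// !mulr_gt0.
pose stable (p : F) (e t : R) := exists B,
  [/\ measurable B, (P B <= eta1%:E)%E & forall w, ~ B w ->
    forall n : nat, `|n%:R / t - nustar p.1| <= e ->
    `|coord_sum P X Xa p.1 p.2 n w -
      coord_sum P X Xa p.1 p.2 (Num.truncn (t * nustar p.1)) w| <= y * Num.sqrt t].
have /choice[e_ e_P] : forall p : F, exists e, 0 < e /\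
    (p.1 \in calI -> \forall t \near +oo, stable p e t).
  move=> [I j].
  have [IC|IC] := boolP (I \in calI); last by exists 1; split=> //= ; rewrite (negPf IC).
  have [e e0 eP] := partial_sum_fluctuation mX X2 mXa ind iid (fun=> delta_mx j 0) IC
    (nu0 I) y0 eta10.
  by exists e; split.
pose e' := x / (2 * M * (A + 1)).
have e'0 : 0 < e' by rewrite divr_gt0// !mulr_gt0// ltr_wpDl.
(* A positive lower bound of e' and of every e_ p. *)
pose e := (e'^-1 + \sum_p (e_ p)^-1)^-1.
have se0 : 0 <= \sum_p (e_ p)^-1.
  by apply: sumr_ge0 => p _; rewrite invr_ge0 ltW//; case: (e_P p).
have e0 : 0 < e by rewrite invr_gt0 ltr_pwDl// invr_gt0.
have ee' : e <= e'.
  rewrite -[leRHS]invrK lef_pV2 ?posrE ?invr_gt0//; last by rewrite ltr_pwDl// invr_gt0.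
  by rewrite lerDl.
have e_le p : e <= e_ p.
  have [ep _] := e_P p.
  rewrite -[leRHS]invrK lef_pV2 ?posrE ?invr_gt0//; last by rewrite ltr_pwDl// invr_gt0.
  rewrite (bigD1 p)//= addrCA lerDl addr_ge0// ?invr_ge0 ?(ltW e'0)//.
  by apply: sumr_ge0 => q _; rewrite invr_ge0 ltW//; case: (e_P q).
have [delta [T0 [delta0 T00 {}design]]] := design e e0.
have opnear := cvg_prob_opnorm_entry mS ScvP delta0 eta10.
have flnear : \forall t \near +oo, forall p : F, p.1 \in calI -> stable p (e_ p) t.
  apply: filter_forall => p; have [pC|pC] := boolP (p.1 \in calI); last by near=> t.
  by have [_ /(_ pC)] := e_P p; apply: filterS.
near=> t.
have tT : T0 <= t by near: t; apply: nbhs_pinfty_ge; exact: num_real.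
have t0 : 0 < t := lt_le_trans T00 tT.
have [B1 [mB1 PB1 B1P]] : exists B, [/\ measurable B, (P B <= eta1%:E)%E &
    forall w, ~ B w -> forall i j, `|Shat t w i j - (cov_mx P X) i j| <= delta].
  by near: t.
have fl : forall p : F, p.1 \in calI -> stable p (e_ p) t.
  by near: t.
have hm : forall w,
  (exists n lam, est_minimizer (Shat t w) calI c (fun r => t * B0 r) a n lam) ->
  est_minimizer (Shat t w) calI c (fun r => t * B0 r) a (nhat t w) (lamhat t w).
  by near: t.
have [|B2 [mB2 PB2 B2P]] := @finite_exceptional_union _ _ _ P F (fun p w => p.1 \in calI ->
    (forall n : nat, `|n%:R / t - nustar p.1| <= e_ p ->
    `|coord_sum P X Xa p.1 p.2 n w -
      coord_sum P X Xa p.1 p.2 (Num.truncn (t * nustar p.1)) w| <= y * Num.sqrt t) /\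
    `|coord_sum P X Xa p.1 p.2 (Num.truncn (t * nustar p.1)) w| <= A_ p * Num.sqrt t)
    (2 * eta1).
  move=> p; have [pC|pC] := boolP (p.1 \in calI); last first.
    by exists set0; split=> //; rewrite measure0 lee_fin mulr_ge0// ltW.
  have [_ /(_ pC t t0)[B [mB PB BP]]] := A_P p.
  have [B' [mB' PB' BP']] := fl p pC.
  exists (B `|` B'); split; first exact: measurableU.
    apply: (le_trans (measureU2 P mB mB')).
    by rewrite mulr_natl mulr2n EFinD; exact: leeD.
  by move=> w /not_orP[nB nB'] _; split; [exact: BP'|exact: BP].
exists (B1 `|` B2); split; first exact: measurableU.
  apply: (le_trans (measureU2 P mB1 mB2)).
  have -> : eta = eta1 + #|F|%:R * (2 * eta1) by rewrite /eta1; field; rewrite gt_eqF.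
  by rewrite EFinD; exact: leeD.
(* From here on the argument is deterministic, at a fixed sample point. *)
move=> w /not_orP[/B1P S1 /B2P S2].
have [/hm hmin /(_ _ _ hmin)[n_near lam_near lam_le]] := design t _ tT (Ssym t w) S1.
have [[_ _ ub] _] := hmin.
apply: (@le_trans _ _ (#|calI|%:R * (k%:R * (C * y + e * A)))); last first.
  rewrite mulrA; have CA : C * y + e * A <= x / M.
    have -> : x / M = C * y + e' * (A + 1).
      by rewrite /y /e'; field; rewrite !gt_eqF// ltr_wpDl.
    rewrite lerD2l ler_pM ?(ltW e0)//; lra.
  have q0 : 0 <= C * y + e * A by rewrite addr_ge0// mulr_ge0// ltW.
  have -> : x = M * (x / M) by field; rewrite gt_eqF.
  by apply: ler_pM => //; rewrite lerDl.
apply: theta_hat_linear_stat_dist => //; [exact: ltW|exact: ltW|].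
move=> I j IC; have [S2f S2t] := S2 (I, j) IC.
split.
- have [n0|n0] := posnP (nhat t w I).
    by rewrite n0 invr0 mulr0 mul0r normr0 ltW.
  have [jI|jI] := boolP (j \in I); last first.
    by rewrite trmx_projI_mulmx_out// mulr0 normr0 ltW.
  rewrite -(enum_rankK_in jI jI) trmx_projI_mulmxE.
  apply: (le_trans (lam_le I _ IC n0)).
  by rewrite (le_trans (ler_norm _))// lerDl.
- move=> nuI; have nuI0 : 0 < nustar I by rewrite lt_neqAle eq_sym nuI nu0.
  rewrite /v; have [jI|jI] := boolP (j \in I); last first.
    by rewrite !trmx_projI_mulmx_out// mulr0 subr0 normr0 ltW.
  rewrite -(enum_rankK_in jI jI) !trmx_projI_mulmxE.
  by have [_] := lam_near I (enum_rank_in jI j) IC nuI0.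
- by apply: S2f; rewrite /= (le_trans (n_near I IC)).
- apply: (le_trans S2t); rewrite ler_wpM2r ?sqrtr_ge0//.
Unshelve. all: by end_near. Qed.
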